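(* If AE-Exact-Tri for $n$-node graphs has an $O(n^{3-\varepsilon})$-time algorithm for some $\varepsilon>0$, then \#AE-Exact-Tri for $n$-node graphs has an $O(n^{3-\varepsilon'})$-time algorithm for some $\varepsilon'>0$.
   Context: Word-RAM model with $O(\log n)$-bit words; edge weights are $O(\log n)$-bit integers. AE-Exact-Tri: given an edge-weighted $n$-node graph $G$ and a target $t$, determine for every edge $e$ whether $e$ is contained in a triangle whose edge weights sum to $t$. \#AE-Exact-Tri: for every edge $e$, count the number of triangles containing $e$ whose edge weights sum to $t$. *)

(* Defs.v *)
From Stdlib Require Import ZArith Reals List Bool.
Import ListNotations.
Open Scope Z_scope.
Local Open Scope bool_scope.

Inductive binop :=
  | OAdd | OSub | OMul | ODiv | OMod
  | OAnd | OOr | OXor | OShl | OShr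
  | OLt | OEq.

Definition eval_binop (o : binop) (x y : Z) : Z :=
  match o with
  | OAdd => x + y | OSub => x - y | OMul => x * y
  | ODiv => x / y | OMod => x mod y
  | OAnd => Z.land x y | OOr => Z.lor x y | OXor => Z.lxor x y
  | OShl => Z.shiftl x y | OShr => Z.shiftr x y
  | OLt => if x <? y then 1 else 0
  | OEq => if x =? y then 1 else 0
  end.

(* Memory is an infinite array of words indexed by Z.  Cell addresses in
   instructions are program constants; indirect addressing via ILoad/IStore. *)
Inductive instr :=
  | IConst (d : nat) (c : Z)              (* M[d] := c *)
  | IBin (o : binop) (d a b : nat)        (* M[d] := M[a] o M[b] *)
  | ILoad (d a : nat)                     (* M[d] := M[M[a]] *)
  | IStore (a s : nat)                    (* M[M[a]] := M[s] *)
  | IJz (a : nat) (l : nat)               (* if M[a] = 0 then goto l *)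
  | IHalt.

Definition program := list instr.
Definition memory := Z -> Z.

Definition upd (M : memory) (a v : Z) : memory :=
  fun x => if x =? a then v else M x.

Definition fits (w : nat) (v : Z) : bool := Z.abs v <? 2 ^ Z.of_nat w.

Inductive outcome :=
  | Running (pc : nat) (M : memory)
  | Halted (M : memory)
  | Crashed.

Definition step (w : nat) (P : program) (pc : nat) (M : memory) : outcome :=
  match nth_error P pc with
  | None => Halted M
  | Some IHalt => Halted M
  | Some (IConst d c) =>
      if fits w c then Running (S pc) (upd M (Z.of_nat d) c) else Crashed
  | Some (IBin o d a b) =>
      let v := eval_binop o (M (Z.of_nat a)) (M (Z.of_nat b)) in
      if fits w v then Running (S pc) (upd M (Z.of_nat d) v) else Crashed
  | Some (ILoad d a) => Running (S pc) (upd M (Z.of_nat d) (M (M (Z.of_nat a))))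
  | Some (IStore a s) => Running (S pc) (upd M (M (Z.of_nat a)) (M (Z.of_nat s)))
  | Some (IJz a l) => if M (Z.of_nat a) =? 0 then Running l M else Running (S pc) M
  end.

Fixpoint exec (w : nat) (P : program) (k : nat) (pc : nat) (M : memory)
  : option memory :=
  match k with
  | O => None
  | S k' =>
      match step w P pc M with
      | Halted M' => Some M'
      | Crashed => None
      | Running pc' M' => exec w P k' pc' M'
      end
  end.

(* O(log n)-bit words: word size c * (floor(log2 n) + 1) for a constant c. *)
Definition word_size (c n : nat) : nat := (c * (Nat.log2 n + 1))%nat.

(* An instance: n nodes 0..n-1, symmetric irreflexive adjacency adj,
   symmetric weights wt (meaningful on edges), target t.  Edge weights and
   the target are O(log n)-bit integers: absolute value at most n^K. *)
Definition valid_instance (K n : nat) (t : Z) (adj : nat -> nat -> bool)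
  (wt : nat -> nat -> Z) : Prop :=
  (forall i j, (i < n)%nat -> (j < n)%nat -> adj i j = adj j i) /\
  (forall i, (i < n)%nat -> adj i i = false) /\
  (forall i j, (i < n)%nat -> (j < n)%nat -> wt i j = wt j i) /\
  (forall i j, (i < n)%nat -> (j < n)%nat -> adj i j = true ->
      Z.abs (wt i j) <= Z.of_nat (n ^ K)) /\
  Z.abs t <= Z.of_nat (n ^ K).

Definition closes (n : nat) (t : Z) (adj : nat -> nat -> bool)
  (wt : nat -> nat -> Z) (i j k : nat) : bool :=
  adj i k && adj j k && (wt i j + wt i k + wt j k =? t).

(* #AE-Exact-Tri answer for edge {i,j}: number of triangles {i,j,k}
   containing it with weight sum t (one per third vertex k). *)
Definition count_answer (n : nat) (t : Z) (adj : nat -> nat -> bool)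
  (wt : nat -> nat -> Z) (i j : nat) : Z :=
  Z.of_nat (length (filter (closes n t adj wt i j) (seq 0 n))).

Definition detect_answer (n : nat) (t : Z) (adj : nat -> nat -> bool)
  (wt : nat -> nat -> Z) (i j : nat) : Z :=
  if existsb (closes n t adj wt i j) (seq 0 n) then 1 else 0.

(* M[0] = n, M[1] = t, and for i, j < n:
   M[2 + 2(i n + j)]     = 1 if {i,j} is an edge, else 0,
   M[2 + 2(i n + j) + 1] = weight of {i,j} if it is an edge, else 0;
   all other cells are 0. *)
Definition init_mem (n : nat) (t : Z) (adj : nat -> nat -> bool)
  (wt : nat -> nat -> Z) : memory :=
  fun a =>
    if a =? 0 then Z.of_nat n
    else if a =? 1 then t
    else if (2 <=? a) && (a <? 2 + 2 * Z.of_nat n * Z.of_nat n) then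
      let q := (a - 2) / 2 in
      let i := Z.to_nat (q / Z.of_nat n) in
      let j := Z.to_nat (q mod Z.of_nat n) in
      if (a - 2) mod 2 =? 0 then (if adj i j then 1 else 0)
      else (if adj i j then wt i j else 0)
    else 0.

Definition out_addr (n i j : nat) : Z :=
  2 + 2 * Z.of_nat n * Z.of_nat n + Z.of_nat (i * n + j).

Definition answer_fn :=
  nat -> Z -> (nat -> nat -> bool) -> (nat -> nat -> Z) -> nat -> nat -> Z.

Definition has_subcubic_alg (ans : answer_fn) (K : nat) (eps : R) : Prop :=
  exists (P : program) (c n0 : nat) (C : R),
    forall (n : nat) (t : Z) (adj : nat -> nat -> bool) (wt : nat -> nat -> Z),
      (n0 <= n)%nat -> valid_instance K n t adj wt ->
      exists (T : nat) (M' : memory),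
        exec (word_size c n) P T 0 (init_mem n t adj wt) = Some M' /\
        (INR T <= C * Rpower (INR n) (3 - eps))%R /\
        (forall i j, (i < n)%nat -> (j < n)%nat -> adj i j = true ->
           M' (out_addr n i j) = ans n t adj wt i j).

Definition truly_subcubic (ans : answer_fn) : Prop :=
  exists eps : R, (0 < eps)%R /\ forall K : nat, has_subcubic_alg ans K eps.

(* Main.v *)
Require Import Defs.
From Stdlib Require Import ZArith Reals List Bool Lia Lra FunctionalExtensionality.
Import ListNotations.
Open Scope Z_scope.

(** Choose a power of two b with N = b^49 about n and pad the graph to N vertices.  The third
    vertices are cut into N/b groups of size b.  For each group, detection on tripartite
    instances with 3b vertices flags the edges having a witness in the group.  If fewer than
    N^2/b unsettled edges are flagged, their witnesses in the group are counted by brute force.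
    Otherwise every k0 in the group is tried as a pivot: for an edge ij with witness k0, another
    vertex k is a witness iff w(i,k) - w(i,k0) = w(k0,j) - w(k,j) (Fredman's trick), so the
    complete counts of all edges with witness k0 are entries of one equality product.  Such a
    group settles at least N^2/b edges, so this happens at most b times.

    The equality product treats, for each k, values occurring at most N/b^3 times by enumeration,
    and the fewer than b^3 remaining values by b^3 integer matrix products.  These use Strassen's
    algorithm, level by level; since 7^49 * 2^7 <= 8^49, a product costs O(N^3/b^6).

    Everything but the oracle calls takes time O(N^3/b), and the calls take O(N^3/b^eps). *)

(** * A structured language over the word RAM *)

(** The scheme balances powers of b. With up to b expensive groups, b pivots in each and b^3
    products per pivot, a product may cost at most about N^3/b^6 if N^3/b is to remain in total; one
    more factor b pays for charging all 49 a + 1 levels of the recursion alike, where b = 2^a and a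
    < b. This is 7^L * b^7 <= N^3, that is 49 * (3 - log2 7) >= 7, and 49 satisfies it with room to
    spare. The price is a diluted saving: b is about n^(1/49), so eps' = min(eps, 1)/49. Weights of
    size n^K also count as (3b)^(49K) on the small instances, so that a single eps has to serve all
    K.

    The detection program is an arbitrary word-RAM program that may leave garbage at any address,
    while its behaviour is known only on memory that vanishes outside the input. Clearing up after a
    call would mean tracking all addresses that it touched. Instead its code is relocated into the
    counting program, and each of the (N/b)^3 calls runs in a private memory, all of these being
    interleaved in one array. *)

(* The store of a program is split into arrays: [h k i] is cell [i] of array [k], with
   [64 <= k < 128] and [i] any integer; it lives at address [k - 128 * (i + 1)], so that
   nonnegative indices never collide with the input, which sits at nonnegative addresses. *)
Notation heap := (Z -> Z -> Z).

Definition updh (h : heap) (k i v : Z) : heap :=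
  fun k' => if k' =? k then (fun i' => if i' =? i then v else h k i') else h k'.

(* [EV i] is the [i]-th enclosing binder counted from the outside; its value is kept in cell
   [i < 48].  Cells 48 to 63 are temporaries. *)
Inductive exp :=
  | EC (c : Z)
  | EV (x : nat)
  | EB (o : binop) (e1 e2 : exp)
  | EL (k : Z) (e : exp).

(* [StR] and [LetR] use raw addresses.  [For e c] binds two variables in [c], the counter and
   the bound.  [Orc x y] runs the oracle program on the memory image described by the
   variables [x] and [y]. *)
Inductive cmd :=
  | Skip
  | Sto (k : Z) (e1 e2 : exp)
  | StR (e1 e2 : exp)
  | Seq (c1 c2 : cmd)
  | If (e : exp) (c1 c2 : cmd)
  | Let (e : exp) (c : cmd)
  | LetR (e : exp) (c : cmd)
  | For (e : exp) (c : cmd)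
  | Orc (x y : nat).

Fixpoint ev (l : list Z) (h : heap) (e : exp) : Z :=
  match e with
  | EC c => c
  | EV x => nth x l 0
  | EB o a b => eval_binop o (ev l h a) (ev l h b)
  | EL k a => h k (ev l h a)
  end.

(** Expressions compile to straight-line code, so this counts both steps and instructions. *)
Fixpoint ecost (e : exp) : Z :=
  match e with
  | EC _ => 1
  | EV _ => 2
  | EB _ a b => ecost a + ecost b + 1
  | EL _ a => ecost a + 5
  end.

(* If all variables and array entries are at most [Y] in absolute value, then [e] evaluates to
   at most [Y ^ deg e]; bounding [deg] statically is what makes all intermediate values fit. *)
Definition maxdeg : nat := 64.

Fixpoint deg (e : exp) : nat :=
  match e with
  | EC _ | EV _ | EL _ _ => 1
  | EB OMul a b => deg a + deg b
  | EB ODiv a _ => deg a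
  | EB OMod a b => Nat.max (deg a) (deg b)
  | EB OLt _ _ | EB OEq _ _ => 1
  | EB _ a b => S (Nat.max (deg a) (deg b))
  end%nat.

(** A left shift has no bound of the form [Y ^ deg]; the language keeps to operations that [deg] can
    handle. *)
Definition arith (o : binop) : bool :=
  match o with OAnd | OOr | OXor | OShl | OShr => false | _ => true end.

(** Cells [d] to 63 serve as evaluation stack, [d] receiving the result; code at depth [d] may also
    use cell [d + 1], hence [d < 63]. Literals up to 128 stay below the bound [Y >= 256] on stored
    values. *)
Fixpoint wfe (nv d : nat) (e : exp) : bool :=
  (deg e <=? maxdeg)%nat && (d <? 63)%nat &&
  match e with
  | EC c => Z.abs c <=? 128
  | EV x => (x <? nv)%nat
  | EB o a b => arith o && wfe nv d a && wfe nv (S d) b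
  | EL k a => wfe nv d a && (64 <=? k) && (k <? 128)
  end.

Fixpoint cexp (d : nat) (e : exp) : list instr :=
  match e with
  | EC c => [IConst d c]
  | EV x => [IConst d (Z.of_nat x); ILoad d d]
  | EB o a b => cexp d a ++ cexp (S d) b ++ [IBin o d d (S d)]
  | EL k a => cexp d a ++
      [IConst (S d) (-128); IBin OMul d d (S d); IConst (S d) (k - 128);
       IBin OAdd d d (S d); ILoad d d]
  end.

(* During a call with parameters [S] and [q], cell [z] of the oracle program is entry
   [z * S + q] of this array: distinct [q < S] give disjoint memories, so that every call finds
   its memory zeroed. *)
Definition ORC : Z := 64.

(** * Relocation of the oracle program *)

Section Oracle_code.
Variables x y : nat.

(** The variables [x] and [y] hold [-128 * S] and [ORC - 128 * (q + 1)], so this turns an oracle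
    address [z] into the address of entry [z * S + q] of array [ORC]. *)
Definition deref (T : nat) : list instr := [IBin OMul T T x; IBin OAdd T T y].
Definition addr (T c : nat) : list instr := IConst T (Z.of_nat c) :: deref T.

(** A jump past the end halts the oracle program, so labels are capped at [len], and the end of the
    block code is where the call returns; halting is an unconditional jump to it. The binary
    operation is the instruction that takes all 13 places. *)
Definition tr (base len : nat) (i : instr) : list instr :=
  match i with
  | IConst d c => addr 48 d ++ [IConst 49 c; IStore 48 49]
  | IBin o d a b => addr 48 a ++ [ILoad 48 48] ++ addr 49 b ++
      [ILoad 49 49; IBin o 48 48 49] ++ addr 49 d ++ [IStore 49 48]
  | ILoad d a => addr 48 a ++ [ILoad 48 48] ++ deref 48 ++ [ILoad 48 48] ++
      addr 49 d ++ [IStore 49 48]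
  | IStore a s => addr 48 a ++ [ILoad 48 48] ++ deref 48 ++ addr 49 s ++
      [ILoad 49 49; IStore 48 49]
  | IJz a l => addr 48 a ++ [ILoad 48 48; IJz 48 (base + 13 * Nat.min l len)]
  | IHalt => [IConst 48 0; IJz 48 (base + 13 * len)]
  end.

(* All blocks have length 13, so that label [l] of the oracle program becomes [base + 13 * l]. *)
Definition pad (p : list instr) : list instr :=
  p ++ repeat (IConst 48 0) (13 - length p).

Definition orc_code (base : nat) (P : program) : list instr :=
  flat_map (fun i => pad (tr base (length P) i)) P.

End Oracle_code.

(** * Compiler and weakest preconditions *)

Section Compiler.
Variable P : program.

(** Jump targets are absolute, so the position [pc] of the code is an argument. The number [d] of
    variables in scope is also the cell of the next one. *)
Fixpoint comp (d pc : nat) (c : cmd) : list instr :=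
  match c with
  | Skip => []
  | Sto k e1 e2 => cexp 48 e1 ++
      [IConst 49 (-128); IBin OMul 48 48 49; IConst 49 (k - 128); IBin OAdd 48 48 49]
      ++ cexp 49 e2 ++ [IStore 48 49]
  | StR e1 e2 => cexp 48 e1 ++ cexp 49 e2 ++ [IStore 48 49]
  | Seq a b => let ca := comp d pc a in ca ++ comp d (pc + length ca) b
  | If e a b =>
      let ce := cexp 48 e in
      let p1 := (pc + length ce + 1)%nat in
      let ca := comp d p1 a in
      let p2 := (p1 + length ca + 2)%nat in
      let cb := comp d p2 b in
      ce ++ [IJz 48 p2] ++ ca ++ [IConst 48 0; IJz 48 (p2 + length cb)] ++ cb
  | Let e c => let ce := cexp 48 e in
      ce ++ [IConst 49 (Z.of_nat d); IStore 49 48] ++ comp (S d) (pc + length ce + 2) c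
  | LetR e c => let ce := cexp 48 e in
      ce ++ [ILoad 48 48; IConst 49 (Z.of_nat d); IStore 49 48] ++
      comp (S d) (pc + length ce + 3) c
  | For e c =>
      let ce := cexp 48 e in
      let p1 := (pc + length ce + 3)%nat in
      let cc := comp (S (S d)) (p1 + 2) c in
      ce ++ [IConst 49 (Z.of_nat (S d)); IStore 49 48; IConst d 0] ++
      [IBin OLt 48 d (S d); IJz 48 (p1 + 2 + length cc + 4)] ++ cc ++
      [IConst 48 1; IBin OAdd d d 48; IConst 48 0; IJz 48 p1]
  | Orc x y => orc_code x y pc P
  end.

Fixpoint wfc (d : nat) (c : cmd) : bool :=
  match c with
  | Skip => true
  | Sto k e1 e2 => wfe d 48 e1 && wfe d 49 e2 && (64 <=? k) && (k <? 128)
  | StR e1 e2 => wfe d 48 e1 && wfe d 49 e2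
  | Seq a b => wfc d a && wfc d b
  | If e a b => wfe d 48 e && wfc d a && wfc d b
  | Let e c | LetR e c => (d <? 46)%nat && wfe d 48 e && wfc (S d) c
  | For e c => (d <? 46)%nat && wfe d 48 e && wfc (S (S d)) c
  | Orc x y => (x <? d)%nat && (y <? d)%nat && (d <=? 48)%nat
  end.

Variables (w w0 : nat) (Y Bm : Z).

(** Abstracted over the transformer [W] of the body so that [wp] can recurse through it. A round
    pays six steps of loop control, two for the test and four to increment and jump back; the
    failing test pays two. *)
Fixpoint wfor (W : (heap -> Z -> Prop) -> list Z -> heap -> Z -> Prop) (l : list Z)
  (lim : Z) (k : nat) (i : Z) (Q : heap -> Z -> Prop) (h : heap) (t : Z) : Prop :=
  match k with
  | O => Q h (t + 2)
  | S k' => W (wfor W l lim k' (i + 1) Q) (l ++ [i; lim]) h (t + 6)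
  end.

(* Weakest precondition.  The last argument is an upper bound on the number of steps made so
   far; the cost of a construct is charged when it is entered. *)
Fixpoint wp (c : cmd) (Q : heap -> Z -> Prop) (l : list Z) (h : heap) (t : Z) : Prop :=
  match c with
  | Skip => Q h t
  | Sto k e1 e2 => Z.abs (ev l h e2) <= Y /\
      Q (updh h k (ev l h e1) (ev l h e2)) (t + (ecost e1 + ecost e2 + 5))
  | StR e1 e2 => (ev l h e1 < 0 \/ 64 <= ev l h e1) /\ Z.abs (ev l h e2) <= Y /\
      Q (updh h (ev l h e1 mod 128) (-1 - ev l h e1 / 128) (ev l h e2))
        (t + (ecost e1 + ecost e2 + 1))
  | Seq a b => wp a (wp b Q l) l h t
  | If e a b => if ev l h e =? 0 then wp b Q l h (t + (ecost e + 3))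
                else wp a Q l h (t + (ecost e + 3))
  | Let e c => Z.abs (ev l h e) <= Y /\ wp c Q (l ++ [ev l h e]) h (t + (ecost e + 2))
  | LetR e c => (ev l h e < 0 \/ 64 <= ev l h e) /\
      wp c Q (l ++ [h (ev l h e mod 128) (-1 - ev l h e / 128)]) h (t + (ecost e + 3))
  | For e c => Z.abs (ev l h e) <= Y /\
      wfor (wp c) l (ev l h e) (Z.to_nat (ev l h e)) 0 Q h (t + (ecost e + 3))
  | Orc x y => exists S q T M',
      nth x l 0 = -128 * S /\ nth y l 0 = ORC - 128 * (q + 1) /\ 0 <= q < S /\
      (Bm + 2) * S <= Y /\ (forall z, Z.abs (h ORC (z * S + q)) <= Bm) /\
      exec w0 P T 0 (fun z => h ORC (z * S + q)) = Some M' /\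
      forall h', (forall k, k <> ORC -> h' k = h k) ->
        (forall z, h' ORC (z * S + q) = M' z) ->
        (forall i, i mod S <> q -> h' ORC i = h ORC i) ->
        Q h' (t + (13 * Z.of_nat T + 2))
  end.

Lemma wfor_mono W l lim
  (HW : forall (Q Q' : heap -> Z -> Prop) l h t,
     (forall h t, Q h t -> Q' h t) -> W Q l h t -> W Q' l h t) :
  forall k i (Q Q' : heap -> Z -> Prop) h t, (forall h t, Q h t -> Q' h t) ->
  wfor W l lim k i Q h t -> wfor W l lim k i Q' h t.
Proof.
  induction k; intros i Q Q' h t HQ; cbn [wfor]; auto.
  apply HW. intros. eapply IHk; eauto.
Qed.

Lemma wp_mono c : forall (Q Q' : heap -> Z -> Prop) l h t,
  (forall h t, Q h t -> Q' h t) -> wp c Q l h t -> wp c Q' l h t.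
Proof.
  induction c; intros Q Q' l h t HQ; cbn [wp]; intros H; try (intuition auto; fail).
  - eapply IHc1; [|exact H]. cbn beta. intros ? ? ?. eapply IHc2; eauto.
  - destruct (_ =? _); eauto.
  - destruct H; split; eauto.
  - destruct H; split; eauto.
  - destruct H as [H0 H]; split; auto. eapply wfor_mono; eauto.
  - destruct H as (S & q & T & M' & H1 & H2 & H3 & H4 & H5 & H6 & H7).
    exists S, q, T, M'. repeat split; auto; lia.
Qed.

(** * Word-range bounds and execution of single instructions *)

Definition bnd (l : list Z) (h : heap) :=
  (forall i, (i < length l)%nat -> Z.abs (nth i l 0) <= Y) /\
  (forall k i, Z.abs (h k i) <= Y).

Hypothesis HY : 256 <= Y.
Hypothesis Hw : forall d, (d <= maxdeg)%nat -> 256 * Y ^ Z.of_nat d <= 2 ^ Z.of_nat w.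

Lemma Yw : 256 * Y <= 2 ^ Z.of_nat w.
Proof.
  generalize (Hw 1 ltac:(unfold maxdeg; lia)). change (Z.of_nat 1) with 1.
  now rewrite Z.pow_1_r.
Qed.

Lemma Ypow_mono a b : (a <= b)%nat -> Y ^ Z.of_nat a <= Y ^ Z.of_nat b.
Proof. intros; apply Z.pow_le_mono_r; lia. Qed.

Lemma div_abs_le a b : Z.abs (a / b) <= Z.abs a.
Proof.
  destruct (Z.eq_dec b 0) as [->|Hb]; [rewrite Zdiv_0_r; lia|].
  pose proof (Z.div_mod a b Hb). pose proof (Z.mod_bound_or a b Hb). nia.
Qed.

Lemma mod_abs_le a b : Z.abs (a mod b) <= Z.max (Z.abs a) (Z.abs b).
Proof.
  destruct (Z.eq_dec b 0) as [->|Hb]; [rewrite Zmod_0_r; lia|].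
  pose proof (Z.mod_bound_or a b Hb). lia.
Qed.

Lemma ev_bound l h e nv d : bnd l h -> nv = length l -> wfe nv d e = true ->
  Z.abs (ev l h e) <= Y ^ Z.of_nat (deg e).
Proof.
  intros [Hl Hh] ->. revert d; induction e; intros d; cbn [wfe ev];
    rewrite ?andb_true_iff; intros H.
  - cbn [deg]. change (Z.of_nat 1) with 1. rewrite Z.pow_1_r. lia.
  - cbn [deg]. change (Z.of_nat 1) with 1. rewrite Z.pow_1_r. apply Hl. destruct H as [_ H].
    apply Nat.ltb_lt in H. lia.
  - destruct H as [_ [[Ho H1] H2]].
    specialize (IHe1 _ H1). specialize (IHe2 _ H2).
    assert (H1Y : 1 <= Y ^ Z.of_nat 1) by (change (Z.of_nat 1) with 1; rewrite Z.pow_1_r; lia).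
    pose proof (Ypow_mono (deg e1) (Nat.max (deg e1) (deg e2)) ltac:(lia)) as Ha.
    pose proof (Ypow_mono (deg e2) (Nat.max (deg e1) (deg e2)) ltac:(lia)) as Hb.
    destruct o; try discriminate; cbn [deg eval_binop].
    + rewrite Nat2Z.inj_succ, Z.pow_succ_r by lia. nia.
    + rewrite Nat2Z.inj_succ, Z.pow_succ_r by lia. nia.
    + rewrite Nat2Z.inj_add, Z.pow_add_r, Z.abs_mul by lia. nia.
    + etransitivity; [apply div_abs_le|assumption].
    + etransitivity; [apply mod_abs_le|lia].
    + destruct (_ <? _); lia.
    + destruct (_ =? _); lia.
  - cbn [deg]. change (Z.of_nat 1) with 1. rewrite Z.pow_1_r. apply Hh.
Qed.

Lemma ev_fits l h e nv d : bnd l h -> nv = length l -> wfe nv d e = true ->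
  256 * Z.abs (ev l h e) <= 2 ^ Z.of_nat w.
Proof.
  intros Hb Hnv He. pose proof (ev_bound l h e nv d Hb Hnv He).
  enough (256 * Y ^ Z.of_nat (deg e) <= 2 ^ Z.of_nat w) by lia.
  apply Hw. destruct e; cbn [wfe] in He; rewrite !andb_true_iff in He;
    destruct He as [[He _] _]; now apply Nat.leb_le in He.
Qed.

Variable prog : program.

(** Quantifying over the leftover fuel [j] makes runs compose by rewriting. *)
Definition reach (k pc : nat) (M : memory) (pc' : nat) (M' : memory) :=
  forall j, exec w prog (k + j) pc M = exec w prog j pc' M'.

Lemma reach_refl pc pc' M : pc = pc' -> reach 0 pc M pc' M.
Proof. now intros -> j. Qed.

Lemma reach_trans k1 k2 pc1 M1 pc2 M2 pc3 M3 :
  reach k1 pc1 M1 pc2 M2 -> reach k2 pc2 M2 pc3 M3 -> reach (k1 + k2) pc1 M1 pc3 M3.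
Proof. intros H1 H2 j. rewrite <- Nat.add_assoc, H1. apply H2. Qed.

Fixpoint code (pc : nat) (l : list instr) : Prop :=
  match l with
  | [] => True
  | i :: l' => nth_error prog pc = Some i /\ code (S pc) l'
  end.

Lemma code_app pc l1 l2 :
  code pc (l1 ++ l2) <-> code pc l1 /\ code (pc + length l1) l2.
Proof.
  revert pc; induction l1 as [|i l1 IH]; intros pc; cbn [app code length].
  - rewrite Nat.add_0_r. tauto.
  - rewrite IH. replace (S pc + length l1)%nat with (pc + S (length l1))%nat by lia. tauto.
Qed.

Definition set1 (M : memory) (a v : Z) (M' : memory) :=
  M' a = v /\ forall x, x <> a -> M' x = M x.

Lemma set1_upd M a v : set1 M a v (upd M a v).
Proof.
  split; unfold upd; [now rewrite Z.eqb_refl|].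
  intros x Hx. now rewrite (proj2 (Z.eqb_neq _ _) Hx).
Qed.

Lemma fits_true v : Z.abs v < 2 ^ Z.of_nat w -> fits w v = true.
Proof. intros. now apply Z.ltb_lt. Qed.

Lemma r_const pc M d c : nth_error prog pc = Some (IConst d c) ->
  Z.abs c < 2 ^ Z.of_nat w ->
  exists M', reach 1 pc M (S pc) M' /\ set1 M (Z.of_nat d) c M'.
Proof.
  intros H Hc. eexists; split; [|apply set1_upd]. intros j. cbn [Nat.add exec].
  unfold step. now rewrite H, fits_true.
Qed.

Lemma r_bin pc M o d a b va vb : nth_error prog pc = Some (IBin o d a b) ->
  M (Z.of_nat a) = va -> M (Z.of_nat b) = vb ->
  Z.abs (eval_binop o va vb) < 2 ^ Z.of_nat w ->
  exists M', reach 1 pc M (S pc) M' /\ set1 M (Z.of_nat d) (eval_binop o va vb) M'.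
Proof.
  intros H <- <- Hc. eexists; split; [|apply set1_upd]. intros j. cbn [Nat.add exec].
  unfold step. now rewrite H; cbv zeta; rewrite fits_true.
Qed.

Lemma r_load pc M d a p v : nth_error prog pc = Some (ILoad d a) ->
  M (Z.of_nat a) = p -> M p = v ->
  exists M', reach 1 pc M (S pc) M' /\ set1 M (Z.of_nat d) v M'.
Proof.
  intros H <- <-. eexists; split; [|apply set1_upd]. intros j. cbn [Nat.add exec].
  unfold step. now rewrite H.
Qed.

Lemma r_store pc M a s p v : nth_error prog pc = Some (IStore a s) ->
  M (Z.of_nat a) = p -> M (Z.of_nat s) = v ->
  exists M', reach 1 pc M (S pc) M' /\ set1 M p v M'.
Proof.
  intros H <- <-. eexists; split; [|apply set1_upd]. intros j. cbn [Nat.add exec].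
  unfold step. now rewrite H.
Qed.

Lemma r_jz pc M a l v : nth_error prog pc = Some (IJz a l) -> M (Z.of_nat a) = v ->
  reach 1 pc M (if v =? 0 then l else S pc) M.
Proof.
  intros H <- j. cbn [Nat.add exec]. unfold step. rewrite H. now destruct (_ =? _).
Qed.

(** Every address outside the 64 register cells, input and output included, is an entry of exactly
    one array: address [x] is entry [-1 - x / 128] of array [x mod 128]. Raw and array accesses thus
    speak about the same heap. *)
Definition rep (M : memory) (l : list Z) (h : heap) :=
  (forall i, (i < length l)%nat -> M (Z.of_nat i) = nth i l 0) /\
  (forall x, x < 0 \/ 64 <= x -> M x = h (x mod 128) (-1 - x / 128)).

Lemma rep_ext M M' l h : (length l <= 48)%nat -> rep M l h ->
  (forall x, x < 48 \/ 64 <= x -> M' x = M x) -> rep M' l h.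
Proof.
  intros Hl [H1 H2] H. split; intros; rewrite H by lia; auto.
Qed.

Lemma rep_arr M l h k i : rep M l h -> 64 <= k < 128 ->
  M (k - 128 * (i + 1)) = h k i.
Proof.
  intros [_ H] Hk. rewrite H by lia.
  replace (k - 128 * (i + 1)) with (k + (-1 - i) * 128) by lia.
  rewrite Z.mod_add, Z.div_add, Z.mod_small, Z.div_small by lia. f_equal; lia.
Qed.

Lemma rep_upd M M' l h p v : (length l <= 48)%nat -> p < 0 \/ 64 <= p -> rep M l h ->
  M' p = v -> (forall x, x < 48 \/ 64 <= x -> x <> p -> M' x = M x) ->
  rep M' l (updh h (p mod 128) (-1 - p / 128) v).
Proof.
  intros Hl Hp [H1 H2] Hv H. split.
  - intros. rewrite H by lia; auto.
  - intros x Hx. unfold updh. destruct (Z.eq_dec x p) as [->|Hxp].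
    + now rewrite !Z.eqb_refl.
    + rewrite H by lia. rewrite H2 by lia.
      destruct (Z.eqb_spec (x mod 128) (p mod 128)) as [E|E]; auto.
      destruct (Z.eqb_spec (-1 - x / 128) (-1 - p / 128)) as [E2|E2];
        [|now rewrite E].
      pose proof (Z.div_mod x 128 ltac:(lia)). pose proof (Z.div_mod p 128 ltac:(lia)). lia.
Qed.

Lemma cexp_cost d e : Z.of_nat (length (cexp d e)) = ecost e.
Proof.
  revert d; induction e; intros d; cbn [cexp ecost length]; rewrite ?length_app;
    cbn [length]; rewrite ?Nat2Z.inj_add, ?IHe, ?IHe1, ?IHe2; lia.
Qed.

Ltac inv_code :=
  repeat match goal with
  | H : code _ (_ ++ _) |- _ => apply code_app in H; destruct H
  | H : code _ (_ :: _) |- _ => cbn [code] in H; destruct H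
  | H : nth_error prog _ = Some _ /\ _ |- _ => destruct H
  | H : code _ [] |- _ => clear H
  | H : _ && _ = true |- _ => apply andb_true_iff in H; destruct H
  | H : Nat.ltb _ _ = true |- _ => apply Nat.ltb_lt in H
  | H : Nat.leb _ _ = true |- _ => apply Nat.leb_le in H
  | H : Z.ltb _ _ = true |- _ => apply Z.ltb_lt in H
  | H : Z.leb _ _ = true |- _ => apply Z.leb_le in H
  end.

Ltac reach_go :=
  match goal with
  | H : reach ?k ?p0 ?M ?p1 ?M1 |- reach (?k + _) ?p ?M _ _ =>
    replace p with p0 by (cbn [length] in *; lia);
    eapply (reach_trans k); [exact H|]
  end.

Ltac reaches :=
  repeat reach_go; apply reach_refl; cbn [length] in *; try lia.

Lemma addr_ok k T pc M v : code pc
    [IConst (S T) (-128); IBin OMul T T (S T); IConst (S T) (k - 128); IBin OAdd T T (S T)] ->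
  64 <= k < 128 -> M (Z.of_nat T) = v -> 256 * Z.abs v <= 2 ^ Z.of_nat w ->
  exists M', reach 4 pc M (pc + 4) M' /\ M' (Z.of_nat T) = k - 128 * (v + 1) /\
    forall x, x <> Z.of_nat T -> x <> Z.of_nat (S T) -> M' x = M x.
Proof.
  intros Hc Hk HM Hv. pose proof Yw. inv_code.
  destruct (r_const pc M (S T) (-128)) as (M1 & R1 & E1 & F1); [assumption|lia|].
  destruct (r_bin (S pc) M1 OMul T T (S T) v (-128)) as (M2 & R2 & E2 & F2);
    [assumption|rewrite F1 by lia; assumption|assumption|cbn [eval_binop]; lia|].
  destruct (r_const (S (S pc)) M2 (S T) (k - 128)) as (M3 & R3 & E3 & F3);
    [assumption|lia|].
  destruct (r_bin (S (S (S pc))) M3 OAdd T T (S T) (v * -128) (k - 128))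
    as (M4 & R4 & E4 & F4);
    [assumption|rewrite F3 by lia; assumption|assumption|cbn [eval_binop]; lia|].
  exists M4. split; [|split].
  - change 4%nat with (1 + (1 + (1 + (1 + 0))))%nat at 1. reaches.
  - rewrite E4. cbn [eval_binop]. lia.
  - intros. rewrite F4, F3, F2, F1 by lia. reflexivity.
Qed.

Lemma cexp_ok l h : bnd l h -> (length l <= 48)%nat ->
  forall e d pc M, rep M l h -> wfe (length l) d e = true -> (48 <= d)%nat ->
  code pc (cexp d e) ->
  exists M', reach (length (cexp d e)) pc M (pc + length (cexp d e)) M' /\
    M' (Z.of_nat d) = ev l h e /\
    forall x, x < Z.of_nat d \/ 64 <= x -> M' x = M x.
Proof.
  intros Hb Hl. pose proof Yw as HYw.
  induction e; intros d pc M HM We Hd Hc; pose proof We as We0;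
    cbn [wfe] in We; inv_code; cbn [cexp] in *.
  - destruct (r_const pc M d c) as (M1 & R1 & E1 & F1); [apply Hc|lia|].
    exists M1. split; [|split; [auto|]].
    + change (length _) with (1 + 0)%nat. reaches.
    + intros; apply F1; lia.
  - inv_code.
    destruct (r_const pc M d (Z.of_nat x)) as (M1 & R1 & E1 & F1); [assumption|lia|].
    destruct (r_load (S pc) M1 d d (Z.of_nat x) (nth x l 0)) as (M2 & R2 & E2 & F2);
      [assumption|exact E1|rewrite F1 by lia; apply HM; lia|].
    exists M2. split; [|split; [auto|]].
    + change (length _) with (1 + (1 + 0))%nat. reaches.
    + intros; rewrite F2, F1 by lia; auto.
  - inv_code.
    destruct (IHe1 d pc M) as (M1 & R1 & E1 & F1); auto.
    destruct (IHe2 (S d) (pc + length (cexp d e1))%nat M1) as (M2 & R2 & E2 & F2); auto.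
    { eapply rep_ext; eauto. intros; apply F1; lia. }
    destruct (r_bin (pc + length (cexp d e1) + length (cexp (S d) e2)) M2 o d d (S d)
      (ev l h e1) (ev l h e2)) as (M3 & R3 & E3 & F3);
      [assumption|rewrite F2 by lia; assumption|assumption| |].
    { pose proof (ev_fits _ _ _ _ _ Hb eq_refl We0). cbn [ev] in *. lia. }
    exists M3. split; [|split; [auto|]].
    + rewrite !length_app. change (length [_]) with (1 + 0)%nat. reaches.
    + intros; rewrite F3, F2, F1 by lia; auto.
  - change [IConst (S d) (-128); IBin OMul d d (S d); IConst (S d) (k - 128);
       IBin OAdd d d (S d); ILoad d d] with
      ([IConst (S d) (-128); IBin OMul d d (S d); IConst (S d) (k - 128);
       IBin OAdd d d (S d)] ++ [ILoad d d]) in *.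
    apply code_app in Hc; destruct Hc as [Hc Hc2].
    apply code_app in Hc2; destruct Hc2 as [Hc2 Hc3].
    destruct (IHe d pc M) as (M1 & R1 & E1 & F1); auto.
    pose proof (ev_fits l h e (length l) d Hb eq_refl ltac:(assumption)).
    destruct (addr_ok k d (pc + length (cexp d e)) M1 (ev l h e)) as (M2 & R2 & E2 & F2); auto.
    cbn [code length] in Hc3. destruct Hc3 as [Hc3 _].
    destruct (r_load _ M2 d d _ (h k (ev l h e)) Hc3 E2) as (M3 & R3 & E3 & F3).
    { rewrite F2 by lia. rewrite F1 by lia. eapply rep_arr; eauto. }
    exists M3. split; [|split; [auto|]].
    + rewrite !length_app. change (length [_;_;_;_]) with 4%nat.
      change (length [_]) with (1 + 0)%nat. reaches.
    + intros; rewrite F3, F2, F1 by lia; auto.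
Qed.

(** These cell numbers become constants of the relocated code, so they have to fit into a word;
    hypothesis [HP] below bounds them. *)
Definition iregs (i : instr) : list nat :=
  match i with
  | IConst d _ => [d]
  | IBin _ d a b => [d; a; b]
  | ILoad d a | IStore d a => [d; a]
  | IJz a _ => [a]
  | IHalt => []
  end.

Hypothesis Hw0 : (w0 <= w)%nat.
Hypothesis HBm : 2 ^ Z.of_nat w0 <= Bm.
Hypothesis HP : forall i a, In i P -> In a (iregs i) -> Z.of_nat a <= Bm.

Lemma tr_length x y base' len i : (length (tr x y base' len i) <= 13)%nat.
Proof. destruct i; cbn; lia. Qed.

Lemma pad_length p : (length p <= 13)%nat -> length (pad p) = 13%nat.
Proof. intros. unfold pad. rewrite length_app, repeat_length. lia. Qed.

Lemma flat_map_length13 (f : instr -> list instr) (Hf : forall i, length (f i) = 13%nat) L :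
  length (flat_map f L) = (13 * length L)%nat.
Proof.
  induction L; cbn [flat_map length]; [reflexivity|]. rewrite length_app, IHL, Hf. lia.
Qed.

(** * Simulation of one oracle call *)

Section Oracle_call.
Variables (x y base : nat) (S q : Z).
Hypothesis Hx : (x < 48)%nat.
Hypothesis Hy : (y < 48)%nat.
Hypothesis Hq : 0 <= q < S.
Hypothesis HS : (Bm + 2) * S <= Y.

Let F (z : Z) : Z := ORC - 128 * (z * S + q + 1).

Definition tmpeq (M M' : memory) := forall a, a <> 48 -> a <> 49 -> M' a = M a.

Definition osim (M Mp : memory) :=
  M (Z.of_nat x) = -128 * S /\ M (Z.of_nat y) = ORC - 128 * (q + 1) /\
  forall z, M (F z) = Mp z.

Lemma F_far z : F z < 0 \/ 64 <= F z.
Proof. unfold F, ORC. lia. Qed.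

Lemma F_inj z z' : F z = F z' -> z = z'.
Proof. unfold F. intros. assert (z * S = z' * S) by lia. nia. Qed.

Lemma osim_tmp M M' Mp : osim M Mp -> tmpeq M M' -> osim M' Mp.
Proof.
  intros (H1 & H2 & H3) H. repeat split; [rewrite H by lia; assumption..|].
  intros z. pose proof (F_far z). rewrite H by lia. apply H3.
Qed.

Lemma osim_set M Mp M' d v : osim M Mp -> set1 M (F d) v M' -> osim M' (upd Mp d v).
Proof.
  intros (H1 & H2 & H3) [E H]. pose proof (F_far d).
  repeat split; [rewrite H by lia; assumption..|].
  intros z. unfold upd. destruct (Z.eqb_spec z d) as [->|Hz]; [assumption|].
  rewrite H by (intros E2; apply Hz, F_inj, E2). apply H3.
Qed.

Lemma tmpeq_trans M1 M2 M3 : tmpeq M1 M2 -> tmpeq M2 M3 -> tmpeq M1 M3.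
Proof. intros H1 H2 a Ha Hb. rewrite H2, H1; auto. Qed.

Lemma set_tmp M a v M' : set1 M a v M' -> a = 48 \/ a = 49 -> tmpeq M M'.
Proof. intros [_ H] Ha b Hb Hb'. apply H. lia. Qed.

Lemma deref_ok T pc M Mp v : code pc (deref x y T) -> (T = 48 \/ T = 49)%nat ->
  osim M Mp -> M (Z.of_nat T) = v -> Z.abs v <= Bm ->
  exists M', reach 2 pc M (pc + 2) M' /\ M' (Z.of_nat T) = F v /\
    (forall a, a <> Z.of_nat T -> M' a = M a).
Proof.
  intros Hc HT (Sx & Sy & _) Hv HvB. unfold deref in Hc. inv_code. pose proof Yw.
  assert (Z.abs (v * S) <= Bm * S) by (rewrite Z.abs_mul; nia).
  destruct (r_bin pc M OMul T T x v (-128 * S)) as (M1 & R1 & E1 & F1); auto.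
  { cbn [eval_binop]. lia. }
  destruct (r_bin (Datatypes.S pc) M1 OAdd T T y (v * (-128 * S)) (ORC - 128 * (q + 1)))
    as (M2 & R2 & E2 & F2); auto.
  { rewrite F1 by lia. assumption. }
  { cbn [eval_binop]. unfold ORC. lia. }
  exists M2. repeat split.
  - change 2%nat with (1 + (1 + 0))%nat at 1. reaches.
  - rewrite E2. cbn [eval_binop]. unfold F. ring.
  - intros; rewrite F2, F1; auto.
Qed.

Lemma oaddr_ok T pc M Mp c : code pc (addr x y T c) -> (T = 48 \/ T = 49)%nat ->
  osim M Mp -> Z.of_nat c <= Bm ->
  exists M', reach 3 pc M (pc + 3) M' /\ M' (Z.of_nat T) = F (Z.of_nat c) /\
    (forall a, a <> Z.of_nat T -> M' a = M a).
Proof.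
  intros Hc HT HS' HcB. unfold addr in Hc. cbn [code] in Hc. destruct Hc as [Hc1 Hc2].
  pose proof Yw. assert (Bm <= Y) by nia.
  destruct (r_const pc M T (Z.of_nat c)) as (M1 & R1 & E1 & F1); [assumption|lia|].
  destruct (deref_ok T (Datatypes.S pc) M1 Mp (Z.of_nat c)) as (M2 & R2 & E2 & F2); auto.
  - eapply osim_tmp; eauto. intros a; intros. apply F1. lia.
  - lia.
  - exists M2. repeat split; auto.
    + change 3%nat with (1 + (2 + 0))%nat at 1. reaches.
    + intros; rewrite F2, F1; auto.
Qed.

Lemma pad_ok k pc M : code pc (repeat (IConst 48 0) k) ->
  exists M', reach k pc M (pc + k) M' /\ tmpeq M M'.
Proof.
  revert pc M; induction k; intros pc M Hc.
  - exists M. split; [apply reach_refl; lia|easy].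
  - cbn [repeat code] in Hc. destruct Hc as [Hc1 Hc2].
    destruct (r_const pc M 48 0 Hc1) as (M1 & R1 & E1).
    { pose proof Yw; lia. }
    destruct (IHk (Datatypes.S pc) M1 Hc2) as (M2 & R2 & E2).
    exists M2. split.
    + change (Datatypes.S k) with (1 + k)%nat at 1. replace (1 + k)%nat with (1 + (k + 0))%nat by lia.
      reaches.
    + eapply tmpeq_trans; eauto. eapply set_tmp; eauto.
Qed.

Definition oframe (M M' : memory) :=
  forall a, a <> 48 -> a <> 49 -> (forall z, a <> F z) -> M' a = M a.

(** A value written by the oracle program is either a copy of another cell or has passed its own
    test [fits w0], so the bound [Bm] on its memory persists. This bound is what keeps the relocated
    addresses of indirect accesses within the word range. *)
Lemma tr_ok base' len i pc M Mp pcP pcP' Mp' : In i P ->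
  (forall z, Z.abs (Mp z) <= Bm) ->
  code pc (tr x y base' len i) -> osim M Mp ->
  nth_error P pcP = Some i -> step w0 P pcP Mp = Running pcP' Mp' ->
  match i with IJz _ _ | IHalt => False | _ => True end ->
  pcP' = Datatypes.S pcP /\ (forall z, Z.abs (Mp' z) <= Bm) /\
  exists M', reach (length (tr x y base' len i)) pc M
     (pc + length (tr x y base' len i)) M' /\ osim M' Mp' /\ oframe M M'.
Proof.
  intros Hi HB Hc HM Hn Hs Hi'. pose proof (HP i) as Hr. pose proof Yw.
  assert (HBY : Bm <= Y) by nia.
  assert (Hww : 2 ^ Z.of_nat w0 <= 2 ^ Z.of_nat w) by (apply Z.pow_le_mono_r; lia).
  assert (HU : forall d v, Z.abs v <= Bm -> forall z, Z.abs (upd Mp d v z) <= Bm).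
  { intros d v Hv z. unfold upd. destruct (_ =? _); auto. }
  assert (Htmp : forall M1 M2 Mq, osim M1 Mq -> (forall b, b <> Z.of_nat 48 -> M2 b = M1 b) ->
    osim M2 Mq).
  { intros M1 M2 Mq H1 H2. eapply osim_tmp; eauto. intros b ? ?. apply H2. lia. }
  assert (Htmp' : forall M1 M2 Mq, osim M1 Mq -> (forall b, b <> Z.of_nat 49 -> M2 b = M1 b) ->
    osim M2 Mq).
  { intros M1 M2 Mq H1 H2. eapply osim_tmp; eauto. intros b ? ?. apply H2. lia. }
  unfold step in Hs. rewrite Hn in Hs.
  destruct i as [d c|o d a b|d a|a s|a l|]; try contradiction; cbn [iregs] in Hr.
  - assert (Hd := Hr d Hi ltac:(cbn; auto)).
    destruct (fits w0 c) eqn:Hf; [|discriminate]. injection Hs as <- <-.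
    apply Z.ltb_lt in Hf.
    split; [reflexivity|split; [apply HU; lia|]]. cbn [tr] in *.
    apply code_app in Hc; destruct Hc as [Hc1 Hc2].
    destruct (oaddr_ok _ _ _ _ _ Hc1 ltac:(lia) HM Hd) as (M1 & R1 & E1 & F1).
    cbn [code] in Hc2. change (length (addr x y 48 d)) with 3%nat in Hc2.
    destruct Hc2 as [Hc2 [Hc3 _]].
    destruct (r_const _ M1 _ _ Hc2) as (M2 & R2 & E2 & F2); [lia|].
    destruct (r_store _ M2 _ _ (F (Z.of_nat d)) c Hc3) as (M3 & R3 & E3).
    { rewrite F2 by lia. assumption. }
    { assumption. }
    exists M3. split; [|split].
    + change (length _) with (3 + (1 + (1 + 0)))%nat. reaches.
    + eapply osim_set; [|eassumption]; eauto.
    + intros e He1 He2 He3. destruct E3 as [_ E3]. rewrite E3, F2, F1 by auto. reflexivity.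
  - assert (Hd := Hr d Hi ltac:(cbn; auto)). assert (Ha := Hr a Hi ltac:(cbn; auto)).
    assert (Hb := Hr b Hi ltac:(cbn; auto)).
    cbv zeta in Hs. destruct (fits w0 _) eqn:Hf; [|discriminate]. injection Hs as <- <-.
    apply Z.ltb_lt in Hf.
    split; [reflexivity|split; [apply HU; lia|]]. cbn [tr] in *.
    apply code_app in Hc; destruct Hc as [Hc1 Hc].
    apply code_app in Hc; destruct Hc as [Hc2 Hc].
    apply code_app in Hc; destruct Hc as [Hc3 Hc].
    apply code_app in Hc; destruct Hc as [Hc4 Hc].
    apply code_app in Hc; destruct Hc as [Hc5 Hc6].
    cbn [length addr deref] in *.
    destruct (oaddr_ok _ _ _ _ _ Hc1 ltac:(lia) HM Ha) as (M1 & R1 & E1 & F1).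
    destruct Hc2 as [Hc2 _].
    pose proof (Htmp _ _ _ HM F1) as S1.
    destruct (r_load _ M1 _ _ _ (Mp (Z.of_nat a)) Hc2 E1 (proj2 (proj2 S1) _))
      as (M2 & R2 & E2 & F2).
    pose proof (Htmp _ _ _ S1 F2) as S2.
    destruct (oaddr_ok _ _ M2 _ _ Hc3 ltac:(lia) S2 Hb) as (M3 & R3 & E3 & F3).
    pose proof (Htmp' _ _ _ S2 F3) as S3.
    destruct Hc4 as [Hc4 [Hc4' _]].
    destruct (r_load _ M3 _ _ _ (Mp (Z.of_nat b)) Hc4 E3 (proj2 (proj2 S3) _))
      as (M4 & R4 & E4 & F4).
    pose proof (Htmp' _ _ _ S3 F4) as S4.
    destruct (r_bin _ M4 o _ _ _ (Mp (Z.of_nat a)) (Mp (Z.of_nat b)) Hc4') as (M5 & R5 & E5 & F5).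
    { rewrite F4, F3 by lia. assumption. }
    { assumption. }
    { lia. }
    pose proof (Htmp _ _ _ S4 F5) as S5.
    destruct (oaddr_ok _ _ M5 _ _ Hc5 ltac:(lia) S5 Hd) as (M6 & R6 & E6 & F6).
    pose proof (Htmp' _ _ _ S5 F6) as S6.
    destruct Hc6 as [Hc6 _].
    destruct (r_store _ M6 _ _ _ (eval_binop o (Mp (Z.of_nat a)) (Mp (Z.of_nat b))) Hc6 E6)
      as (M7 & R7 & E7).
    { rewrite F6 by lia. assumption. }
    exists M7. split; [|split].
    + replace (length _) with (3 + (1 + (3 + (1 + (1 + (3 + (1 + 0)))))))%nat by reflexivity.
      reaches.
    + eapply osim_set; [|eassumption]; eauto.
    + intros e He1 He2 He3. destruct E7 as [_ E7].
      rewrite E7, F6, F5, F4, F3, F2, F1 by auto. reflexivity.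
  - assert (Hd := Hr d Hi ltac:(cbn; auto)). assert (Ha := Hr a Hi ltac:(cbn; auto)).
    injection Hs as <- <-.
    split; [reflexivity|split; [apply HU; auto|]]. cbn [tr] in *.
    apply code_app in Hc; destruct Hc as [Hc1 Hc].
    apply code_app in Hc; destruct Hc as [Hc2 Hc].
    apply code_app in Hc; destruct Hc as [Hc3 Hc].
    apply code_app in Hc; destruct Hc as [Hc4 Hc].
    apply code_app in Hc; destruct Hc as [Hc5 Hc6].
    cbn [length addr deref] in *.
    destruct (oaddr_ok _ _ _ _ _ Hc1 ltac:(lia) HM Ha) as (M1 & R1 & E1 & F1).
    destruct Hc2 as [Hc2 _].
    pose proof (Htmp _ _ _ HM F1) as S1.
    destruct (r_load _ M1 _ _ _ (Mp (Z.of_nat a)) Hc2 E1 (proj2 (proj2 S1) _))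
      as (M2 & R2 & E2 & F2).
    pose proof (Htmp _ _ _ S1 F2) as S2.
    destruct (deref_ok _ _ M2 _ _ Hc3 ltac:(lia) S2 E2 (HB _)) as (M3 & R3 & E3 & F3).
    pose proof (Htmp _ _ _ S2 F3) as S3.
    destruct Hc4 as [Hc4 _].
    destruct (r_load _ M3 _ _ _ (Mp (Mp (Z.of_nat a))) Hc4 E3 (proj2 (proj2 S3) _))
      as (M4 & R4 & E4 & F4).
    pose proof (Htmp _ _ _ S3 F4) as S4.
    destruct (oaddr_ok _ _ M4 _ _ Hc5 ltac:(lia) S4 Hd) as (M5 & R5 & E5 & F5).
    pose proof (Htmp' _ _ _ S4 F5) as S5.
    destruct Hc6 as [Hc6 _].
    destruct (r_store _ M5 _ _ _ (Mp (Mp (Z.of_nat a))) Hc6 E5) as (M6 & R6 & E6).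
    { rewrite F5 by lia. assumption. }
    exists M6. split; [|split].
    + replace (length _) with (3 + (1 + (2 + (1 + (3 + (1 + 0))))))%nat by reflexivity.
      reaches.
    + eapply osim_set; [|eassumption]; eauto.
    + intros e He1 He2 He3. destruct E6 as [_ E6].
      rewrite E6, F5, F4, F3, F2, F1 by auto. reflexivity.
  - assert (Hd := Hr s Hi ltac:(cbn; auto)). assert (Ha := Hr a Hi ltac:(cbn; auto)).
    injection Hs as <- <-.
    split; [reflexivity|split; [apply HU; auto|]]. cbn [tr] in *.
    apply code_app in Hc; destruct Hc as [Hc1 Hc].
    apply code_app in Hc; destruct Hc as [Hc2 Hc].
    apply code_app in Hc; destruct Hc as [Hc3 Hc].
    apply code_app in Hc; destruct Hc as [Hc4 Hc5].
    cbn [length addr deref] in *.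
    destruct (oaddr_ok _ _ _ _ _ Hc1 ltac:(lia) HM Ha) as (M1 & R1 & E1 & F1).
    destruct Hc2 as [Hc2 _].
    pose proof (Htmp _ _ _ HM F1) as S1.
    destruct (r_load _ M1 _ _ _ (Mp (Z.of_nat a)) Hc2 E1 (proj2 (proj2 S1) _))
      as (M2 & R2 & E2 & F2).
    pose proof (Htmp _ _ _ S1 F2) as S2.
    destruct (deref_ok _ _ M2 _ _ Hc3 ltac:(lia) S2 E2 (HB _)) as (M3 & R3 & E3 & F3).
    pose proof (Htmp _ _ _ S2 F3) as S3.
    destruct (oaddr_ok _ _ M3 _ _ Hc4 ltac:(lia) S3 Hd) as (M4 & R4 & E4 & F4).
    pose proof (Htmp' _ _ _ S3 F4) as S4.
    destruct Hc5 as [Hc5 [Hc6 _]].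
    destruct (r_load _ M4 _ _ _ (Mp (Z.of_nat s)) Hc5 E4 (proj2 (proj2 S4) _))
      as (M5 & R5 & E5 & F5).
    pose proof (Htmp' _ _ _ S4 F5) as S5.
    destruct (r_store _ M5 _ _ (F (Mp (Z.of_nat a))) (Mp (Z.of_nat s)) Hc6) as (M6 & R6 & E6).
    { rewrite F5, F4 by lia. assumption. }
    { assumption. }
    exists M6. split; [|split].
    + replace (length _) with (3 + (1 + (2 + (3 + (1 + (1 + 0))))))%nat by reflexivity.
      reaches.
    + eapply osim_set; [|eassumption]; eauto.
    + intros e He1 He2 He3. destruct E6 as [_ E6].
      rewrite E6, F5, F4, F3, F2, F1 by auto. reflexivity.
Qed.

Lemma code_flat (f : instr -> list instr) (Hf : forall i, length (f i) = 13%nat) :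
  forall (L : list instr) pc k i,
  code pc (flat_map f L) -> nth_error L k = Some i -> code (pc + 13 * k) (f i).
Proof.
  induction L as [|j L IH]; intros pc [|k] i Hc Hk; try discriminate; cbn [flat_map] in Hc;
    apply code_app in Hc; destruct Hc as [Hc1 Hc2].
  - injection Hk as <-. replace (pc + 13 * 0)%nat with pc by lia. assumption.
  - rewrite Hf in Hc2. specialize (IH _ _ _ Hc2 Hk).
    now replace (pc + 13 * Datatypes.S k)%nat with (pc + 13 + 13 * k)%nat by lia.
Qed.

(** Each oracle step runs at most one block of 13 instructions; taken jumps leave their block early,
    so 13 per step is only an upper bound. The label is capped in the starting position too, because
    any [pc] past the end means that the program has halted. *)
Lemma orc_sim : code base (orc_code x y base P) -> forall T pc M Mp M',
  exec w0 P T pc Mp = Some M' -> (forall z, Z.abs (Mp z) <= Bm) -> osim M Mp ->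
  exists k Mf, (k <= 13 * T)%nat /\
    reach k (base + 13 * Nat.min pc (length P)) M (base + 13 * length P) Mf /\
    osim Mf M' /\ (forall z, Z.abs (M' z) <= Bm) /\ oframe M Mf.
Proof.
  intros Hcode. induction T as [|T IH]; intros pc M Mp M' Hex HB HM; [discriminate|].
  cbn [exec] in Hex.
  destruct (nth_error P pc) as [i|] eqn:Hi.
  2:{ unfold step in Hex. rewrite Hi in Hex. injection Hex as <-.
      apply nth_error_None in Hi.
      exists 0%nat, M. repeat split; auto; try apply HM; try lia; try easy.
      apply reach_refl. lia. }
  assert (Hpc : (pc < length P)%nat) by (apply nth_error_Some; congruence).
  assert (Hin : In i P) by (eapply nth_error_In; eauto).
  assert (Hc := code_flat _ (fun j => pad_length _ (tr_length x y base (length P) j)) _ _ _ _ Hcode Hi).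
  cbv beta in Hc. unfold pad in Hc. apply code_app in Hc. destruct Hc as [Hc1 Hc2].
  pose proof Yw as HYw.
  assert (HBY : Bm <= Y) by nia.
  replace (Nat.min pc (length P)) with pc by lia.
  assert (Hjmp : match i with IJz _ _ | IHalt => False | _ => True end \/
                 i = IHalt \/ exists a l, i = IJz a l) by (destruct i; eauto).
  destruct Hjmp as [Hj|[->|(a & l & ->)]].
  - destruct (step w0 P pc Mp) as [pc1 Mp1| |] eqn:Hst;
      [|exfalso; unfold step in Hst; rewrite Hi in Hst; destruct i; cbv zeta in Hst;
        try contradiction; try discriminate;
        destruct (fits w0 _); discriminate|discriminate].
    pose proof (tr_length x y base (length P) i) as Htl.
    destruct (tr_ok _ _ _ _ _ _ _ _ _ Hin HB Hc1 HM Hi Hst Hj) as (-> & HB1 & M1 & R1 & S1 & F1).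
    destruct (pad_ok _ _ M1 Hc2) as (M2 & R2 & F2).
    pose proof (osim_tmp _ _ _ S1 F2) as S2.
    destruct (IH _ M2 _ _ Hex HB1 S2) as (k & Mf & Hk & R3 & S3 & HB3 & F3).
    exists (13 + k)%nat, Mf. split; [lia|]. split; [|split; [|split]]; auto.
    + pose proof (reach_trans _ _ _ _ _ _ _ _ R1 R2) as R12.
      match type of R12 with reach ?k' _ _ ?p' _ =>
        replace k' with 13%nat in R12 by lia;
        replace p' with (base + 13 * Nat.min (Datatypes.S pc) (length P))%nat in R12 by lia end.
      eapply reach_trans; eauto.
    + intros a Ha Hb Hz. rewrite F3, F2, F1; auto.
  - unfold step in Hex. rewrite Hi in Hex. injection Hex as <-.
    cbn [tr code] in Hc1. destruct Hc1 as [Hc [Hc' _]].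
    destruct (r_const _ M _ _ Hc) as (M1 & R1 & E1 & F1); [lia|].
    pose proof (r_jz _ M1 _ _ _ Hc' E1) as R2. cbn [Z.eqb] in R2.
    exists 2%nat, M1. split; [lia|]. split; [|split; [|split]]; auto.
    + change 2%nat with (1 + 1)%nat. eapply reach_trans; eauto.
    + eapply osim_tmp; eauto. intros b ? ?. apply F1. lia.
    + intros b ? ? ?. apply F1. lia.
  - unfold step in Hex. rewrite Hi in Hex.
    cbn [tr] in Hc1. apply code_app in Hc1. destruct Hc1 as [Hc [Hc' [Hc'' _]]].
    change (length (addr x y 48 a)) with 3%nat in *.
    assert (Ha := HP _ a Hin ltac:(cbn; auto)).
    destruct (oaddr_ok _ _ _ _ _ Hc ltac:(lia) HM Ha) as (M1 & R1 & E1 & F1).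
    assert (S1 : osim M1 Mp) by (eapply osim_tmp; eauto; intros b ? ?; apply F1; lia).
    destruct (r_load _ M1 _ _ _ (Mp (Z.of_nat a)) Hc' E1 (proj2 (proj2 S1) _))
      as (M2 & R2 & E2 & F2).
    assert (S2 : osim M2 Mp) by (eapply osim_tmp; eauto; intros b ? ?; apply F2; lia).
    pose proof (r_jz _ M2 _ _ _ Hc'' E2) as R3.
    destruct (Z.eqb_spec (Mp (Z.of_nat a)) 0) as [Hz|Hz].
    + destruct (IH _ M2 _ _ Hex HB S2) as (k & Mf & Hk & R4 & S4 & HB4 & F4).
      exists (3 + (1 + (1 + k)))%nat, Mf. split; [lia|]. split; [|split; [|split]]; auto.
      * repeat reach_go. assumption.
      * intros b ? ? ?. rewrite F4, F2, F1; auto.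
    + (* a jump that is not taken still runs through the padding *)
      destruct (pad_ok _ _ M2 Hc2) as (M3 & R3' & F3).
      pose proof (osim_tmp _ _ _ S2 F3) as S3.
      destruct (IH _ M3 _ _ Hex HB S3) as (k & Mf & Hk & R4 & S4 & HB4 & F4).
      change (length (tr x y base (length P) (IJz a l))) with 5%nat in *.
      replace (base + 13 * pc + 5)%nat with (Datatypes.S (Datatypes.S (base + 13 * pc + 3))) in R3' by lia.
      replace (Datatypes.S (Datatypes.S (base + 13 * pc + 3)) + (13 - 5))%nat with
        (base + 13 * Nat.min (Datatypes.S pc) (length P))%nat in R3' by lia.
      exists (3 + (1 + (1 + ((13 - 5) + k))))%nat, Mf. split; [lia|]. split; [|split; [|split]]; auto.
      * repeat reach_go. assumption.
      * intros b ? ? ?. rewrite F4, F3, F2, F1; auto.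
Qed.

End Oracle_call.

(** * Correctness of the compiled commands *)

Lemma bnd_snoc l h v : bnd l h -> Z.abs v <= Y -> bnd (l ++ [v]) h.
Proof.
  intros [H1 H2] Hv. split; auto. intros i Hi. rewrite length_app in Hi. cbn [length] in Hi.
  destruct (Nat.lt_ge_cases i (length l)).
  - rewrite app_nth1 by lia. auto.
  - rewrite app_nth2 by lia. replace (i - length l)%nat with 0%nat by lia. auto.
Qed.

Lemma bnd_prefix l l' h h' : bnd l h -> bnd (l ++ l') h' -> bnd l h'.
Proof. intros [H1 _] [_ H2]. split; auto. Qed.

Lemma rep_prefix M l l' h : rep M (l ++ l') h -> rep M l h.
Proof.
  intros [H1 H2]. split; auto. intros i Hi. rewrite H1 by (rewrite length_app; lia).
  now rewrite app_nth1.
Qed.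

Lemma rep_snoc M M' l h v : (length l < 48)%nat -> rep M l h ->
  M' (Z.of_nat (length l)) = v ->
  (forall x, x < Z.of_nat (length l) \/ 64 <= x -> M' x = M x) -> rep M' (l ++ [v]) h.
Proof.
  intros Hl [H1 H2] Hv HM. split.
  - intros i Hi. rewrite length_app in Hi. cbn [length] in Hi.
    destruct (Nat.lt_ge_cases i (length l)).
    + rewrite app_nth1, HM by lia. auto.
    + rewrite app_nth2 by lia. replace i with (length l) by lia.
      rewrite Nat.sub_diag. auto.
  - intros. rewrite HM by lia. auto.
Qed.

Lemma bnd_updh l h k i v : bnd l h -> Z.abs v <= Y -> bnd l (updh h k i v).
Proof.
  intros [H1 H2] Hv. split; auto. intros k' i'. unfold updh.
  destruct (_ =? _); auto. destruct (_ =? _); auto.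
Qed.

Definition okc (c : cmd) := forall Q l h t M pc,
  wfc (length l) c = true -> (length l <= 48)%nat ->
  code pc (comp (length l) pc c) -> bnd l h -> rep M l h -> wp c Q l h t ->
  exists k M' h' t', reach k pc M (pc + length (comp (length l) pc c)) M' /\
    rep M' l h' /\ bnd l h' /\ Q h' t' /\ t + Z.of_nat k <= t'.

Lemma ok_sto k e1 e2 : okc (Sto k e1 e2).
Proof.
  intros Q l h t M pc Hwf Hl Hc Hb HM [Hv HQ]. cbn [wfc] in Hwf. inv_code.
  cbn [comp] in *.
  apply code_app in Hc; destruct Hc as [Hc1 Hc].
  apply code_app in Hc; destruct Hc as [Hc2 Hc].
  apply code_app in Hc; destruct Hc as [Hc3 [Hc4 _]].
  destruct (cexp_ok l h Hb Hl e1 48 pc M) as (M1 & R1 & E1 & F1); auto; try lia.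
  pose proof (ev_fits l h e1 _ _ Hb eq_refl ltac:(eassumption)).
  destruct (addr_ok k 48 (pc + length (cexp 48 e1)) M1 (ev l h e1)) as (M2 & R2 & E2 & F2); auto.
  destruct (cexp_ok l h Hb Hl e2 49 (pc + length (cexp 48 e1) + 4)%nat M2)
    as (M3 & R3 & E3 & F3); auto; try lia.
  { eapply rep_ext; eauto. intros. rewrite F2, F1 by lia. auto. }
  destruct (r_store _ M3 _ _ (k - 128 * (ev l h e1 + 1)) (ev l h e2) Hc4) as (M4 & R4 & E4 & F4).
  { rewrite F3 by lia. assumption. }
  { assumption. }
  eexists (length (cexp 48 e1) + (4 + (length (cexp 49 e2) + (1 + 0))))%nat, M4, _, _.
  split; [|split; [|split; [|split; [exact HQ|]]]].
  - rewrite !length_app. reaches.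
  - assert (E : updh h k (ev l h e1) (ev l h e2) =
       updh h ((k - 128 * (ev l h e1 + 1)) mod 128)
         (-1 - (k - 128 * (ev l h e1 + 1)) / 128) (ev l h e2)).
    { replace (k - 128 * (ev l h e1 + 1)) with (k + (-1 - ev l h e1) * 128) by lia.
      rewrite Z.mod_add, Z.div_add, Z.mod_small, Z.div_small by lia. f_equal; lia. }
    rewrite E. eapply rep_upd; eauto; [lia|].
    intros. rewrite F4, F3, F2, F1 by lia. auto.
  - apply bnd_updh; auto.
  - rewrite <- (cexp_cost 48 e1), <- (cexp_cost 49 e2). lia.
Qed.

Lemma ok_str e1 e2 : okc (StR e1 e2).
Proof.
  intros Q l h t M pc Hwf Hl Hc Hb HM [Ha [Hv HQ]]. cbn [wfc] in Hwf. inv_code.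
  cbn [comp] in *.
  apply code_app in Hc; destruct Hc as [Hc1 Hc].
  apply code_app in Hc; destruct Hc as [Hc3 [Hc4 _]].
  destruct (cexp_ok l h Hb Hl e1 48 pc M) as (M1 & R1 & E1 & F1); auto; try lia.
  destruct (cexp_ok l h Hb Hl e2 49 (pc + length (cexp 48 e1))%nat M1)
    as (M3 & R3 & E3 & F3); auto; try lia.
  { eapply rep_ext; eauto; intros; rewrite F1 by lia; auto. }
  destruct (r_store _ M3 _ _ (ev l h e1) (ev l h e2) Hc4) as (M4 & R4 & E4 & F4).
  { rewrite F3 by lia. assumption. }
  { assumption. }
  eexists (length (cexp 48 e1) + (length (cexp 49 e2) + (1 + 0)))%nat, M4, _, _.
  split; [|split; [|split; [|split; [exact HQ|]]]].
  - rewrite !length_app. reaches.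
  - eapply rep_upd; eauto. intros. rewrite F4, F3, F1 by lia. auto.
  - apply bnd_updh; auto.
  - rewrite <- (cexp_cost 48 e1), <- (cexp_cost 49 e2). lia.
Qed.

(** Shared by both kinds of binding: once the value is in its cell, the body runs with one more
    variable, which is forgotten afterwards. The first [k0] steps and [n1] instructions compute and
    store the value. *)
Lemma ok_let_tail l h c v Q t M pc k0 pc0 M0 n1 : okc c ->
  wfc (S (length l)) c = true -> (length l < 46)%nat ->
  code pc (comp (S (length l)) pc c) -> bnd l h -> Z.abs v <= Y ->
  rep M (l ++ [v]) h -> wp c Q (l ++ [v]) h t ->
  reach k0 pc0 M0 pc M -> pc = (pc0 + n1)%nat ->
  exists k M' h' t', reach k pc0 M0 (pc0 + (n1 + length (comp (S (length l)) pc c))) M' /\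
    rep M' l h' /\ bnd l h' /\ Q h' t' /\ t + (Z.of_nat k - Z.of_nat k0) <= t'.
Proof.
  intros Hok Hwf Hl Hc Hb Hv HM Hwp R0 Hpc.
  assert (Hlen : length (l ++ [v]) = S (length l)) by (rewrite length_app; cbn [length]; lia).
  destruct (Hok Q (l ++ [v]) h t M pc) as (k & M' & h' & t' & R & HM' & Hb' & HQ & Ht);
    rewrite ?Hlen; auto; try lia.
  { apply bnd_snoc; auto. }
  rewrite Hlen in R. exists (k0 + k)%nat, M', h', t'. split; [|split; [|split; [|split]]]; auto.
  - eapply reach_trans; eauto.
    replace (pc0 + (n1 + length (comp (S (length l)) pc c)))%nat with
      (pc + length (comp (S (length l)) pc c))%nat by lia. assumption.
  - eapply rep_prefix; eauto.
  - eapply bnd_prefix; eauto.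
  - lia.
Qed.

Lemma ok_let e c : okc c -> okc (Let e c).
Proof.
  intros IH Q l h t M pc Hwf Hl Hc Hb HM [Hv HQ]. cbn [wfc] in Hwf. inv_code.
  cbn [comp] in *. cbv zeta in *.
  apply code_app in Hc; destruct Hc as [Hc1 Hc].
  apply code_app in Hc; destruct Hc as [[Hc2 [Hc3 _]] Hc4].
  destruct (cexp_ok l h Hb Hl e 48 pc M) as (M1 & R1 & E1 & F1); auto; try lia.
  destruct (r_const _ M1 _ _ Hc2) as (M2 & R2 & E2 & F2); [pose proof Yw; lia|].
  destruct (r_store _ M2 _ _ _ (ev l h e) Hc3 E2) as (M3 & R3 & E3 & F3).
  { rewrite F2 by lia. assumption. }
  destruct (ok_let_tail l h c (ev l h e) Q (t + (ecost e + 2)) M3 (pc + length (cexp 48 e) + 2)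
    (length (cexp 48 e) + (1 + (1 + 0))) pc M (length (cexp 48 e) + 2) IH)
    as (k & M' & h' & t' & R & HM' & Hb' & HQ' & Ht); eauto; try lia.
  { eapply rep_snoc; [lia|exact HM|assumption|]. intros; rewrite F3, F2, F1 by lia; auto. }
  { reaches. }
  exists k, M', h', t'. split; [|split; [|split; [|split]]]; auto.
  - rewrite !length_app. cbn [length].
    match goal with |- reach _ _ _ ?p _ => match type of R with reach _ _ _ ?p' _ =>
      replace p with p' by lia end end. assumption.
  - rewrite <- (cexp_cost 48 e) in Ht. lia.
Qed.

Lemma ok_letr e c : okc c -> okc (LetR e c).
Proof.
  intros IH Q l h t M pc Hwf Hl Hc Hb HM [Hv HQ]. cbn [wfc] in Hwf. inv_code.
  cbn [comp] in *. cbv zeta in *.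
  apply code_app in Hc; destruct Hc as [Hc1 Hc].
  apply code_app in Hc; destruct Hc as [[Hc2 [Hc3 [Hc4 _]]] Hc5].
  destruct (cexp_ok l h Hb Hl e 48 pc M) as (M1 & R1 & E1 & F1); auto; try lia.
  set (v := h (ev l h e mod 128) (-1 - ev l h e / 128)) in *.
  destruct (r_load _ M1 _ _ _ v Hc2 E1) as (M2 & R2 & E2 & F2).
  { rewrite F1 by lia. apply HM. auto. }
  destruct (r_const _ M2 _ _ Hc3) as (M3 & R3 & E3 & F3); [pose proof Yw; lia|].
  destruct (r_store _ M3 _ _ _ v Hc4 E3) as (M4 & R4 & E4 & F4).
  { rewrite F3 by lia. assumption. }
  destruct (ok_let_tail l h c v Q (t + (ecost e + 3)) M4 (pc + length (cexp 48 e) + 3)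
    (length (cexp 48 e) + (1 + (1 + (1 + 0)))) pc M (length (cexp 48 e) + 3) IH)
    as (k & M' & h' & t' & R & HM' & Hb' & HQ' & Ht); eauto; try lia.
  { apply Hb. }
  { eapply rep_snoc; [lia|exact HM|assumption|]. intros; rewrite F4, F3, F2, F1 by lia; auto. }
  { reaches. }
  exists k, M', h', t'. split; [|split; [|split; [|split]]]; auto.
  - rewrite !length_app. cbn [length].
    match goal with |- reach _ _ _ ?p _ => match type of R with reach _ _ _ ?p' _ =>
      replace p with p' by lia end end. assumption.
  - rewrite <- (cexp_cost 48 e) in Ht. lia.
Qed.

Lemma ok_if e a b : okc a -> okc b -> okc (If e a b).
Proof.
  intros IHa IHb Q l h t M pc Hwf Hl Hc Hb HM HQ. cbn [wfc wp] in *. inv_code.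
  cbn [comp] in *. cbv zeta in *.
  set (p1 := (pc + length (cexp 48 e) + 1)%nat) in *.
  set (ca := comp (length l) p1 a) in *.
  set (p2 := (p1 + length ca + 2)%nat) in *.
  set (cb := comp (length l) p2 b) in *.
  apply code_app in Hc; destruct Hc as [Hc1 Hc].
  apply code_app in Hc; destruct Hc as [[Hc2 _] Hc].
  apply code_app in Hc; destruct Hc as [Hc3 Hc].
  apply code_app in Hc; destruct Hc as [[Hc4 [Hc5 _]] Hc6].
  cbn [length] in *.
  destruct (cexp_ok l h Hb Hl e 48 pc M) as (M1 & R1 & E1 & F1); auto; try lia.
  pose proof (r_jz _ M1 _ _ _ Hc2 E1) as R2.
  assert (HM1 : rep M1 l h) by (eapply rep_ext; eauto; intros; apply F1; lia).
  pose proof (cexp_cost 48 e) as Hce.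
  assert (Elen : (pc + length (cexp 48 e ++ [IJz 48 p2] ++ ca ++
     [IConst 48 0; IJz 48 (p2 + length cb)] ++ cb))%nat = (p2 + length cb)%nat).
  { rewrite !length_app. cbn [length]. lia. }
  rewrite Elen.
  destruct (ev l h e =? 0) eqn:Hz.
  - destruct (IHb Q l h (t + (ecost e + 3)) M1 p2) with (6 := HQ) as (k & M' & h' & t' & R & HM' & Hb' & HQ' & Ht); auto.
    exists (length (cexp 48 e) + (1 + (k + 0)))%nat, M', h', t'.
    split; [|split; [|split; [|split]]]; auto; [|lia].
    fold cb in R. reaches.
  - destruct (IHa Q l h (t + (ecost e + 3)) M1 p1) with (6 := HQ) as (k & M' & h' & t' & R & HM' & Hb' & HQ' & Ht); auto.
    fold ca in R.
    replace (pc + length (cexp 48 e) + 1 + length ca)%nat with (p1 + length ca)%nat in * by lia.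
    destruct (r_const _ M' _ _ Hc4) as (M2 & R3 & E3 & F3); [pose proof Yw; lia|].
    pose proof (r_jz _ M2 _ _ _ Hc5 E3) as R4. cbn [Z.eqb] in R4.
    exists (length (cexp 48 e) + (1 + (k + (1 + (1 + 0)))))%nat, M2, h', t'.
    split; [|split; [|split; [|split]]]; auto; [| |lia].
    + reaches.
    + eapply rep_ext; eauto. intros; apply F3; lia.
Qed.

Lemma ok_for e c : okc c -> okc (For e c).
Proof.
  intros IH Q l h t M pc Hwf Hl Hc Hb HM [Hv HQ]. cbn [wfc] in *. inv_code.
  cbn [comp] in *. cbv zeta in *.
  set (p1 := (pc + length (cexp 48 e) + 3)%nat) in *.
  set (cc := comp (S (S (length l))) (p1 + 2) c) in *.
  apply code_app in Hc; destruct Hc as [Hc1 Hc].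
  apply code_app in Hc; destruct Hc as [[Hc2 [Hc3 [Hc4 _]]] Hc].
  apply code_app in Hc; destruct Hc as [[Hc5 [Hc6 _]] Hc].
  apply code_app in Hc; destruct Hc as [Hc7 [Hc8 [Hc9 [Hc10 [Hc11 _]]]]].
  cbn [length] in *.
  pose proof Yw as HYw.
  replace (pc + length (cexp 48 e) + 3)%nat with p1 in * by lia.
  destruct (cexp_ok l h Hb Hl e 48 pc M) as (M1 & R1 & E1 & F1); auto; try lia.
  destruct (r_const _ M1 _ _ Hc2) as (M2 & R2 & E2 & F2); [lia|].
  destruct (r_store _ M2 _ _ _ (ev l h e) Hc3 E2) as (M3 & R3 & E3 & F3).
  { rewrite F2 by lia. assumption. }
  destruct (r_const _ M3 _ _ Hc4) as (M4 & R4 & E4 & F4); [lia|].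
  set (lim := ev l h e) in *.
  (* Induction on the remaining rounds, entered at the test [p1]. The maximum with 0 covers a
     negative bound, which means no round at all. *)
  assert (Hloop : forall k i h0 t0 M0, bnd l h0 -> rep M0 (l ++ [i] ++ [lim]) h0 ->
    0 <= i -> Z.of_nat k = Z.max 0 (lim - i) -> (i <= Z.max 0 lim) ->
    wfor (wp c) l lim k i Q h0 t0 ->
    exists n M' h' t', reach n p1 M0 (p1 + 2 + length cc + 4) M' /\ rep M' l h' /\ bnd l h' /\
      Q h' t' /\ t0 + Z.of_nat n <= t').
  { induction k as [|k IHk]; intros i h0 t0 M0 Hb0 HM0 Hi Hk Him Hwp; cbn [wfor] in Hwp.
    - destruct (r_bin _ M0 _ _ _ _ i lim Hc5) as (N1 & S1 & G1 & I1).
      { rewrite (proj1 HM0) by (rewrite !length_app; cbn [length]; lia).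
        rewrite app_nth2, Nat.sub_diag by lia. reflexivity. }
      { rewrite (proj1 HM0) by (rewrite !length_app; cbn [length]; lia).
        rewrite app_nth2 by lia. replace (S (length l) - length l)%nat with 1%nat by lia. reflexivity. }
      { cbn [eval_binop]. destruct (_ <? _); lia. }
      cbn [eval_binop] in G1. rewrite (proj2 (Z.ltb_ge _ _)) in G1 by lia.
      pose proof (r_jz _ N1 _ _ _ Hc6 G1) as S2. cbn [Z.eqb] in S2.
      exists (1 + (1 + 0))%nat, N1, h0, (t0 + 2). split; [reaches|].
      split; [|split; [|split]]; auto; [|lia].
      eapply rep_ext; [lia|eapply rep_prefix; exact HM0|]. intros; apply I1; lia.
    - destruct (r_bin _ M0 _ _ _ _ i lim Hc5) as (N1 & S1 & G1 & I1).
      { rewrite (proj1 HM0) by (rewrite !length_app; cbn [length]; lia).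
        rewrite app_nth2, Nat.sub_diag by lia. reflexivity. }
      { rewrite (proj1 HM0) by (rewrite !length_app; cbn [length]; lia).
        rewrite app_nth2 by lia. replace (S (length l) - length l)%nat with 1%nat by lia. reflexivity. }
      { cbn [eval_binop]. destruct (_ <? _); lia. }
      cbn [eval_binop] in G1. rewrite (proj2 (Z.ltb_lt _ _)) in G1 by lia.
      pose proof (r_jz _ N1 _ _ _ Hc6 G1) as S2. cbn [Z.eqb] in S2.
      assert (Hlen : length (l ++ [i; lim]) = S (S (length l)))
        by (rewrite length_app; cbn [length]; lia).
      destruct (IH (wfor (wp c) l lim k (i + 1) Q) (l ++ [i; lim]) h0 (t0 + 6) N1 (p1 + 2)%nat) with (6 := Hwp)
        as (n & M' & h' & t' & S3 & HM' & Hb' & HQ' & Ht); rewrite ?Hlen; auto; try lia.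
      { change [i; lim] with ([i] ++ [lim]). rewrite app_assoc.
        apply bnd_snoc; [apply bnd_snoc|]; auto. lia. }
      { eapply rep_ext; [rewrite Hlen; lia|exact HM0|]. intros; apply I1; lia. }
      rewrite Hlen in S3. fold cc in S3.
      assert (Hd : M' (Z.of_nat (length l)) = i).
      { rewrite (proj1 HM') by (rewrite Hlen; lia).
        rewrite app_nth2, Nat.sub_diag by lia. reflexivity. }
      destruct (r_const _ M' _ _ Hc8) as (N2 & S4 & G4 & I4); [lia|].
      destruct (r_bin _ N2 _ _ _ _ i 1 Hc9) as (N3 & S5 & G5 & I5); auto.
      { rewrite I4 by lia. assumption. }
      { cbn [eval_binop]. lia. }
      cbn [eval_binop] in G5.
      destruct (r_const _ N3 _ _ Hc10) as (N4 & S6 & G6 & I6); [lia|].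
      pose proof (r_jz _ N4 _ _ _ Hc11 G6) as S7. cbn [Z.eqb] in S7.
      destruct (IHk (i + 1) h' t' N4) as (n2 & M2' & h2 & t2 & S8 & HM2 & Hb2 & HQ2 & Ht2); auto;
        try lia.
      { eapply bnd_prefix; eauto. }
      { split.
        - intros j Hj. rewrite !length_app in Hj. cbn [length] in Hj.
          destruct (Nat.eq_dec j (length l)) as [->|Hne].
          + rewrite app_nth2, Nat.sub_diag by lia. cbn [nth app].
            rewrite I6, G5 by lia. reflexivity.
          + rewrite I6, I5, I4 by lia. rewrite (proj1 HM') by (rewrite Hlen; lia).
            destruct (Nat.lt_ge_cases j (length l)).
            * now rewrite !app_nth1 by lia.
            * rewrite !app_nth2 by lia. replace (j - length l)%nat with 1%nat by lia. reflexivity.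
        - intros x Hx. rewrite I6, I5, I4 by lia. apply HM'. auto. }
      exists (1 + (1 + (n + (1 + (1 + (1 + (1 + n2)))))))%nat, M2', h2, t2.
      split; [|split; [|split; [|split]]]; auto; [|lia].
      repeat reach_go. assumption. }
  destruct (Hloop (Z.to_nat lim) 0 h (t + (ecost e + 3)) M4)
    as (n & M' & h' & t' & R & HM' & Hb' & HQ' & Ht); auto; try lia.
  { rewrite app_assoc. apply (rep_snoc M4 M4).
    - rewrite length_app. cbn [length]. lia.
    - eapply rep_snoc; [lia|exact HM|assumption|].
      intros. rewrite F4, F3, F2, F1 by lia. auto.
    - rewrite length_app. cbn [length]. rewrite F4 by lia.
      replace (length l + 1)%nat with (S (length l)) by lia. assumption.
    - auto. }
  exists (length (cexp 48 e) + (1 + (1 + (1 + (n + 0)))))%nat, M', h', t'.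
  split; [|split; [|split; [|split]]]; auto.
  - rewrite !length_app. reaches.
  - rewrite <- (cexp_cost 48 e) in Ht. lia.
Qed.

Lemma ok_orc x y : okc (Orc x y).
Proof.
  intros Q l h t M pc Hwf Hl Hc Hb HM HQ. cbn [wfc wp comp] in *. inv_code.
  destruct HQ as (S & q & T & M' & Ex & Ey & Hq & HS & HBh & Hex & HQ).
  destruct (orc_sim x y pc S q ltac:(lia) ltac:(lia) Hq HS Hc T 0 M _ _ Hex HBh)
    as (k & Mf & Hk & R & (_ & _ & HF) & HB' & Hfr).
  { repeat split.
    - rewrite (proj1 HM) by lia. assumption.
    - rewrite (proj1 HM) by lia. assumption.
    - intros z. eapply rep_arr; eauto. unfold ORC; lia. }
  cbn [Nat.min] in R. replace (pc + 13 * 0)%nat with pc in R by lia.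
  set (h' := fun k => if k =? ORC then (fun i => Mf (ORC - 128 * (i + 1))) else h k).
  (* An index of the oracle array either belongs to the residue class of this call, where the
     simulation describes it, or is covered by the frame condition. *)
  assert (Hdec : forall i, (exists z, i = z * S + q) \/ i mod S <> q).
  { intros i. destruct (Z.eq_dec (i mod S) q) as [E|E]; [left|right; auto].
    exists (i / S). pose proof (Z.div_mod i S ltac:(lia)). lia. }
  assert (Hold : forall i, i mod S <> q -> Mf (ORC - 128 * (i + 1)) = h ORC i).
  { intros i Hi. rewrite Hfr.
    - eapply rep_arr; eauto. unfold ORC; lia.
    - unfold ORC; lia.
    - unfold ORC; lia.
    - intros z E. apply Hi. assert (i = q + z * S) by lia. subst i.
      rewrite Z.mod_add by lia. apply Z.mod_small; lia. }
  assert (Hlen : length (orc_code x y pc P) = (13 * length P)%nat).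
  { apply flat_map_length13. intros. apply pad_length, tr_length. }
  exists k, Mf, h', (t + (13 * Z.of_nat T + 2)).
  split; [now rewrite Hlen|]. split; [|split; [|split]].
  - split.
    + intros i Hi. rewrite Hfr; [apply HM; auto|lia|lia|].
      intros z; unfold ORC; lia.
    + intros a Ha. unfold h'. destruct (Z.eqb_spec (a mod 128) ORC) as [E|E].
      * f_equal. pose proof (Z.div_mod a 128 ltac:(lia)). lia.
      * destruct (Z.lt_ge_cases a 64).
        -- rewrite Hfr; [apply HM; lia|lia|lia|].
           intros z Ez. apply E. rewrite Ez.
           replace (ORC - 128 * (z * S + q + 1)) with (ORC + (-(z * S + q + 1)) * 128) by lia.
           rewrite Z.mod_add by lia. reflexivity.
        -- rewrite Hfr; [apply HM; lia|lia|lia|].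
           intros z Ez. apply E. rewrite Ez.
           replace (ORC - 128 * (z * S + q + 1)) with (ORC + (-(z * S + q + 1)) * 128) by lia.
           rewrite Z.mod_add by lia. reflexivity.
  - split; [apply Hb|]. intros k' i. unfold h'. destruct (_ =? _); [|apply Hb].
    destruct (Hdec i) as [[z ->]|Hi].
    + rewrite HF. specialize (HB' z). nia.
    + rewrite Hold by auto. apply Hb.
  - apply HQ.
    + intros k' Hk'. unfold h'. now rewrite (proj2 (Z.eqb_neq _ _) Hk').
    + intros z. unfold h'. rewrite Z.eqb_refl. apply HF.
    + intros i Hi. unfold h'. rewrite Z.eqb_refl. auto.
  - lia.
Qed.

Theorem comp_ok c : okc c.
Proof.
  induction c.
  - intros Q l h t M pc Hwf Hl Hc Hb HM HQ. exists 0%nat, M, h, t.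
    repeat split; try apply HM; try apply Hb; auto; try lia. apply reach_refl. cbn. lia.
  - apply ok_sto.
  - apply ok_str.
  - intros Q l h t M pc Hwf Hl Hc Hb HM HQ. cbn [wfc wp comp] in *. inv_code.
    destruct (IHc1 (wp c2 Q l) l h t M pc) with (6 := HQ) as (k & M' & h' & t' & R & HM' & Hb' & HQ' & Ht); auto.
    destruct (IHc2 _ l h' t' M' _ ltac:(assumption) Hl ltac:(eassumption) Hb' HM' HQ')
      as (k2 & M2 & h2 & t2 & R2 & HM2 & Hb2 & HQ2 & Ht2).
    exists (k + (k2 + 0))%nat, M2, h2, t2. split; [|split; [|split; [|split]]]; auto; [|lia].
    rewrite length_app. reaches.
  - apply ok_if; assumption.
  - apply ok_let; assumption.
  - apply ok_letr; assumption.
  - apply ok_for; assumption.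
  - apply ok_orc.
Qed.

End Compiler.

(** * Finite sums over integer ranges *)

Fixpoint sumn (k : nat) (f : Z -> Z) : Z :=
  match k with O => 0 | S k' => sumn k' f + f (Z.of_nat k') end.

Definition zs (n : Z) (f : Z -> Z) : Z := sumn (Z.to_nat n) f.

Lemma zs_0 f : zs 0 f = 0.
Proof. reflexivity. Qed.

Lemma zs_succ n f : 0 <= n -> zs (n + 1) f = zs n f + f n.
Proof.
  intros. unfold zs. replace (Z.to_nat (n + 1)) with (S (Z.to_nat n)) by lia.
  cbn [sumn]. now rewrite Z2Nat.id.
Qed.

Lemma zs_1 f : zs 1 f = f 0.
Proof. reflexivity. Qed.

Lemma zs_ind (R : Z -> Prop) n : 0 <= n -> R 0 ->
  (forall i, 0 <= i < n -> R i -> R (i + 1)) -> R n.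
Proof.
  intros Hn H0 HS. revert HS. pattern n. apply natlike_ind; auto.
  intros m Hm IH HS. apply HS; [lia|]. apply IH. intros; apply HS; auto; lia.
Qed.

Lemma zs_ext n f g : (forall i, 0 <= i < n -> f i = g i) -> zs n f = zs n g.
Proof.
  destruct (Z.le_gt_cases 0 n) as [Hn|Hn].
  - pattern n. apply natlike_ind; auto. intros m Hm IH H.
    unfold Z.succ in *. rewrite !zs_succ by lia. rewrite H by lia.
    rewrite IH; auto. intros; apply H; lia.
  - unfold zs. replace (Z.to_nat n) with 0%nat by lia. reflexivity.
Qed.

Lemma zs_add n f g : zs n (fun i => f i + g i) = zs n f + zs n g.
Proof. unfold zs. induction (Z.to_nat n); cbn [sumn]; lia. Qed.

Lemma zs_opp n f : zs n (fun i => - f i) = - zs n f.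
Proof. unfold zs. induction (Z.to_nat n); cbn [sumn]; lia. Qed.

Lemma zs_mull n c f : zs n (fun i => c * f i) = c * zs n f.
Proof. unfold zs. induction (Z.to_nat n); cbn [sumn]; lia. Qed.

Lemma zs_const n c : 0 <= n -> zs n (fun _ => c) = n * c.
Proof.
  intros Hn. pattern n. apply (zs_ind _ n); auto.
  intros i Hi IH. rewrite zs_succ, IH by lia. ring.
Qed.

Lemma zs_zero n f : (forall i, 0 <= i < n -> f i = 0) -> zs n f = 0.
Proof.
  intros H. rewrite (zs_ext _ f (fun _ => 0 * 0)) by (intros; rewrite H; auto).
  rewrite zs_mull. lia.
Qed.

Lemma zs_le n f g : (forall i, 0 <= i < n -> f i <= g i) -> zs n f <= zs n g.
Proof.
  destruct (Z.le_gt_cases 0 n) as [Hn|Hn].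
  - pattern n. apply natlike_ind; auto; [intros; rewrite !zs_0; lia|]. intros m Hm IH H.
    unfold Z.succ in *. rewrite !zs_succ by lia. specialize (H m ltac:(lia)) as Hm'.
    specialize (IH ltac:(intros; apply H; lia)). lia.
  - intros _. unfold zs. replace (Z.to_nat n) with 0%nat by lia. reflexivity.
Qed.

Lemma zs_nonneg n f : (forall i, 0 <= i < n -> 0 <= f i) -> 0 <= zs n f.
Proof.
  intros H. etransitivity; [|apply (zs_le n (fun _ => 0))]; [|auto].
  rewrite zs_zero; auto; lia.
Qed.

Lemma zs_split a c f : 0 <= a -> 0 <= c -> zs (a + c) f = zs a f + zs c (fun i => f (a + i)).
Proof.
  intros Ha Hc. pattern c. apply (zs_ind _ c); auto.
  - rewrite zs_0, !Z.add_0_r. reflexivity.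
  - intros i Hi IH. rewrite Z.add_assoc, !zs_succ, IH by lia. ring.
Qed.

Lemma zs_exchange n m (f : Z -> Z -> Z) :
  zs n (fun i => zs m (fun j => f i j)) = zs m (fun j => zs n (fun i => f i j)).
Proof.
  unfold zs at 1 4. induction (Z.to_nat n) as [|k IH]; cbn [sumn].
  - symmetry. apply zs_zero. auto.
  - rewrite IH, <- zs_add. reflexivity.
Qed.

Definition b2z (c : bool) : Z := if c then 1 else 0.

Lemma b2z_range c : 0 <= b2z c <= 1.
Proof. destruct c; cbn; lia. Qed.

Lemma zs_delta n j f : 0 <= j < n -> zs n (fun i => b2z (i =? j) * f i) = f j.
Proof.
  intros Hj. replace n with (j + (1 + (n - j - 1))) by lia.
  rewrite !zs_split by lia. rewrite zs_zero.
  2:{ intros i Hi. replace (i =? j) with false by lia. reflexivity. }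
  rewrite zs_1, zs_zero.
  2:{ intros i Hi. replace (j + (1 + i) =? j) with false by lia. reflexivity. }
  rewrite !Z.add_0_r, Z.eqb_refl. cbn [b2z]. lia.
Qed.

Lemma zs_abs n f c : 0 <= n -> (forall i, 0 <= i < n -> Z.abs (f i) <= c) -> Z.abs (zs n f) <= n * c.
Proof.
  intros Hn H. rewrite <- (zs_const n c) by auto. apply Z.abs_le. split.
  - rewrite <- zs_opp. apply zs_le. intros i Hi. specialize (H i Hi). lia.
  - apply zs_le. intros i Hi. specialize (H i Hi). lia.
Qed.

(** * Division of mixed-radix indices *)

Lemma dm_div a r h : 0 <= r < h -> (a * h + r) / h = a.
Proof. intros. rewrite Z.add_comm, Z.div_add, Z.div_small by lia. lia. Qed.

Lemma dm_mod a r h : 0 <= r < h -> (a * h + r) mod h = r.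
Proof. intros. rewrite Z.add_comm, Z.mod_add, Z.mod_small by lia. lia. Qed.

Lemma dm_inj a r a' r' h : 0 <= r < h -> 0 <= r' < h ->
  a * h + r = a' * h + r' -> a = a' /\ r = r'.
Proof.
  intros H H' E. split.
  - rewrite <- (dm_div a r h), <- (dm_div a' r' h) by auto. now rewrite E.
  - rewrite <- (dm_mod a r h), <- (dm_mod a' r' h) by auto. now rewrite E.
Qed.

Lemma dm_range e a h : 0 <= e < a * h -> 0 < h ->
  0 <= e / h < a /\ 0 <= e mod h < h /\ e = e / h * h + e mod h.
Proof.
  intros He Hh. pose proof (Z.div_mod e h ltac:(lia)). pose proof (Z.mod_pos_bound e h Hh).
  split; [|split]; auto; [|lia]. split; [apply Z.div_pos; lia|apply Z.div_lt_upper_bound; nia].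
Qed.

Lemma dm_lt a r n h : 0 <= a < n -> 0 <= r < h -> 0 <= a * h + r < n * h.
Proof. nia. Qed.

(** * One level of Strassen's algorithm *)

(* Position of entry [(r, c)] of the [p]-th block in a sequence of [sz * sz] blocks stored
   row by row. *)
Definition ix (sz p r c : Z) : Z := (p * sz + r) * sz + c.

Lemma ix_div h x r c : 0 <= r < h -> 0 <= c < h ->
  ix h x r c / (h * h) = x /\ (ix h x r c / h) mod h = r /\ ix h x r c mod h = c.
Proof.
  intros Hr Hc. unfold ix. rewrite <- Z.div_div by lia.
  rewrite !dm_div, !dm_mod by lia. auto.
Qed.

Lemma ix_range n h x r c : 0 <= x < n -> 0 <= r < h -> 0 <= c < h -> 0 <= ix h x r c < n * h * h.
Proof. intros. unfold ix. apply dm_lt; auto. apply dm_lt; auto. Qed.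

Lemma ix_ex n h e : 0 < h -> 0 <= e < n * h * h ->
  exists x r c, 0 <= x < n /\ 0 <= r < h /\ 0 <= c < h /\ e = ix h x r c.
Proof.
  intros Hh He. destruct (dm_range e (n * h) h He Hh) as (H1 & H2 & H3).
  destruct (dm_range (e / h) n h H1 Hh) as (H4 & H5 & H6).
  exists (e / h / h), ((e / h) mod h), (e mod h). repeat split; try lia.
  unfold ix. rewrite <- H6. auto.
Qed.

(* One step down: block [7 p + s] of size [h] is the combination with coefficients [u_ij s]
   of the quadrants of block [p] of size [2 h].  [scat] is the step back up. *)
Definition gath (u11 u12 u21 u22 : Z -> Z) (h : Z) (A : Z -> Z) (e : Z) : Z :=
  let s := (e / (h * h)) mod 7 in
  let z := (e / (h * h) / 7 * (2 * h) + (e / h) mod h) * (2 * h) + e mod h in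
  u11 s * A z + u12 s * A (z + h) + u21 s * A (z + 2 * h * h) + u22 s * A (z + 2 * h * h + h).

Definition scat (h : Z) (C : Z -> Z) (e : Z) : Z :=
  let r := (e / (2 * h)) mod (2 * h) in
  let c := e mod (2 * h) in
  let dr := r / h in
  let dc := c / h in
  let z := (7 * (e / (2 * h * (2 * h))) * h + r mod h) * h + c mod h in
  (1 - dr - dc + 2 * (dr * dc)) * C z + dr * (1 - 2 * dc) * C (z + h * h)
  + dc * C (z + 2 * (h * h)) + (1 - dc) * C (z + 3 * (h * h))
  + (1 - dr) * (2 * dc - 1) * C (z + 4 * (h * h)) + dr * dc * C (z + 5 * (h * h))
  + (1 - dr) * (1 - dc) * C (z + 6 * (h * h)).

Notation eqz x y := (if x =? y then 1 else 0).

(* Strassen's products M1, ..., M7 are numbered 0, ..., 6; [a_ij s] and [b_ij s] are the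
   coefficients of the quadrants of the left and right factor in product [s]. *)
Definition a11 s := eqz s 0 + eqz s 2 + eqz s 4 - eqz s 5.
Definition a12 s := eqz s 4 + eqz s 6.
Definition a21 s := eqz s 1 + eqz s 5.
Definition a22 s := eqz s 0 + eqz s 1 + eqz s 3 - eqz s 6.
Definition b11 s := eqz s 0 + eqz s 1 - eqz s 3 + eqz s 5.
Definition b12 s := eqz s 2 + eqz s 5.
Definition b21 s := eqz s 3 + eqz s 6.
Definition b22 s := eqz s 0 - eqz s 2 + eqz s 4 + eqz s 6.

Lemma gath_ix u11 u12 u21 u22 h A p s r c : 0 <= s < 7 -> 0 <= r < h -> 0 <= c < h ->
  gath u11 u12 u21 u22 h A (ix h (7 * p + s) r c) =
  u11 s * A (ix (2 * h) p r c) + u12 s * A (ix (2 * h) p r (h + c)) +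
  u21 s * A (ix (2 * h) p (h + r) c) + u22 s * A (ix (2 * h) p (h + r) (h + c)).
Proof.
  intros Hs Hr Hc. unfold gath. destruct (ix_div h (7 * p + s) r c Hr Hc) as (-> & -> & ->).
  replace (7 * p + s) with (p * 7 + s) by lia. rewrite dm_div, dm_mod by lia.
  replace (ix (2 * h) p r (h + c)) with (ix (2 * h) p r c + h) by (unfold ix; ring).
  replace (ix (2 * h) p (h + r) c) with (ix (2 * h) p r c + 2 * h * h) by (unfold ix; ring).
  replace (ix (2 * h) p (h + r) (h + c)) with (ix (2 * h) p r c + 2 * h * h + h)
    by (unfold ix; ring).
  reflexivity.
Qed.

Lemma scat_ix h C p dr dc r c : 0 <= dr < 2 -> 0 <= dc < 2 -> 0 <= r < h -> 0 <= c < h ->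
  scat h C (ix (2 * h) p (dr * h + r) (dc * h + c)) =
  (1 - dr - dc + 2 * (dr * dc)) * C (ix h (7 * p + 0) r c)
  + dr * (1 - 2 * dc) * C (ix h (7 * p + 1) r c)
  + dc * C (ix h (7 * p + 2) r c) + (1 - dc) * C (ix h (7 * p + 3) r c)
  + (1 - dr) * (2 * dc - 1) * C (ix h (7 * p + 4) r c)
  + dr * dc * C (ix h (7 * p + 5) r c)
  + (1 - dr) * (1 - dc) * C (ix h (7 * p + 6) r c).
Proof.
  intros Hdr Hdc Hr Hc. unfold scat.
  destruct (ix_div (2 * h) p (dr * h + r) (dc * h + c)) as (-> & -> & ->); [nia|nia|].
  rewrite !dm_div, !dm_mod by lia.
  replace ((7 * p * h + r) * h + c) with (ix h (7 * p + 0) r c) by (unfold ix; ring).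
  replace (ix h (7 * p + 1) r c) with (ix h (7 * p + 0) r c + h * h) by (unfold ix; ring).
  replace (ix h (7 * p + 2) r c) with (ix h (7 * p + 0) r c + 2 * (h * h)) by (unfold ix; ring).
  replace (ix h (7 * p + 3) r c) with (ix h (7 * p + 0) r c + 3 * (h * h)) by (unfold ix; ring).
  replace (ix h (7 * p + 4) r c) with (ix h (7 * p + 0) r c + 4 * (h * h)) by (unfold ix; ring).
  replace (ix h (7 * p + 5) r c) with (ix h (7 * p + 0) r c + 5 * (h * h)) by (unfold ix; ring).
  replace (ix h (7 * p + 6) r c) with (ix h (7 * p + 0) r c + 6 * (h * h)) by (unfold ix; ring).
  reflexivity.
Qed.

(** Strassen's identity is bilinear in the two factors, so it already holds for each inner index
    [k < h] separately. Splitting the inner sum of length [2 * h] into its halves leaves one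
    polynomial identity for each of the four quadrants of the result. *)
Lemma strassen_level h np (A B C A' B' C' : Z -> Z) : 0 < h ->
  (forall e, 0 <= e < 7 * np * h * h -> A' e = gath a11 a12 a21 a22 h A e) ->
  (forall e, 0 <= e < 7 * np * h * h -> B' e = gath b11 b12 b21 b22 h B e) ->
  (forall x r c, 0 <= x < 7 * np -> 0 <= r < h -> 0 <= c < h ->
     C' (ix h x r c) = zs h (fun k => A' (ix h x r k) * B' (ix h x k c))) ->
  (forall e, 0 <= e < np * (2 * h) * (2 * h) -> C e = scat h C' e) ->
  forall p r c, 0 <= p < np -> 0 <= r < 2 * h -> 0 <= c < 2 * h ->
  C (ix (2 * h) p r c) = zs (2 * h) (fun k => A (ix (2 * h) p r k) * B (ix (2 * h) p k c)).
Proof.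
  intros Hh HA HB HC' HC p r c Hp Hr Hc.
  rewrite HC by (apply ix_range; auto).
  destruct (dm_range r 2 h ltac:(lia) Hh) as (R1 & R2 & R3).
  destruct (dm_range c 2 h ltac:(lia) Hh) as (C1 & C2 & C3).
  revert R1 R2 R3 C1 C2 C3.
  generalize (r / h) (r mod h) (c / h) (c mod h). intros dr r' dc c' R1 R2 -> C1 C2 ->.
  rewrite scat_ix by auto.
  rewrite !HC' by lia.
  assert (EA : forall s k, 0 <= s < 7 -> 0 <= k < h -> A' (ix h (7 * p + s) r' k) =
    a11 s * A (ix (2 * h) p r' k) + a12 s * A (ix (2 * h) p r' (h + k)) +
    a21 s * A (ix (2 * h) p (h + r') k) + a22 s * A (ix (2 * h) p (h + r') (h + k))).
  { intros. rewrite HA by (apply ix_range; lia). apply gath_ix; auto. }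
  assert (EB : forall s k, 0 <= s < 7 -> 0 <= k < h -> B' (ix h (7 * p + s) k c') =
    b11 s * B (ix (2 * h) p k c') + b12 s * B (ix (2 * h) p k (h + c')) +
    b21 s * B (ix (2 * h) p (h + k) c') + b22 s * B (ix (2 * h) p (h + k) (h + c'))).
  { intros. rewrite HB by (apply ix_range; lia). apply gath_ix; auto. }
  replace (2 * h) with (h + h) at 1 by lia. rewrite zs_split by lia.
  rewrite <- !zs_mull, <- !zs_add. apply zs_ext. intros k Hk.
  rewrite !EA, !EB by lia.
  assert (Hdr : dr = 0 \/ dr = 1) by lia. assert (Hdc : dc = 0 \/ dc = 1) by lia.
  destruct Hdr as [-> | ->], Hdc as [-> | ->];
    unfold a11, a12, a21, a22, b11, b12, b21, b22; cbn [Z.eqb Pos.eqb];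
    rewrite ?Z.mul_0_l, ?Z.mul_1_l, ?Z.add_0_l; ring.
Qed.

(** * Syntax, array names and proof rules *)

Notation "a +! b" := (EB OAdd a b) (at level 50, left associativity).
Notation "a -! b" := (EB OSub a b) (at level 50, left associativity).
Notation "a *! b" := (EB OMul a b) (at level 40, left associativity).
Notation "a /! b" := (EB ODiv a b) (at level 40, left associativity).
Notation "a %! b" := (EB OMod a b) (at level 40, left associativity).
Notation "a <! b" := (EB OLt a b) (at level 70).
Notation "a =! b" := (EB OEq a b) (at level 70).
Notation "c ;; d" := (Seq c d) (at level 90, right associativity).

(* [ADJ], [WT]: the input graph padded to [N] vertices; [SAVE]: input cells overwritten by
   registers; [TP2], [TP7]: powers of 2 and 7; [FLG]: oracle answers; [FRE]: unsettled edges
   with a witness in the current group; [DONE], [ANS]: settled edges and answers; [EQP]: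
   equality product; [FRQ], [LST]: frequency and occurrences of a value; [HVY], [HCN]: the
   frequent values; [MA], [MB], [MC]: all levels of Strassen's algorithm. *)
Notation ADJ := 65.
Notation WT := 66.
Notation SAVE := 67.
Notation TMP := 68.
Notation TP2 := 69.
Notation TP7 := 70.
Notation FLG := 71.
Notation FRE := 72.
Notation DONE := 73.
Notation ANS := 74.
Notation EQP := 75.
Notation FRQ := 76.
Notation LST := 77.
Notation HVY := 78.
Notation HCN := 79.
Notation MA := 80.
Notation MB := 81.
Notation MC := 82.

Lemma updh_same h k i v : updh h k i v k i = v.
Proof. unfold updh. now rewrite !Z.eqb_refl. Qed.

Lemma updh_idx h k i v j : j <> i -> updh h k i v k j = h k j.
Proof. intros H. unfold updh. rewrite Z.eqb_refl. now rewrite (proj2 (Z.eqb_neq _ _) H). Qed.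

Lemma updh_arr h k i v k' : k' <> k -> updh h k i v k' = h k'.
Proof. intros H. unfold updh. now rewrite (proj2 (Z.eqb_neq _ _) H). Qed.

Lemma updh_at h k i v j : updh h k i v k j = if j =? i then v else h k j.
Proof. unfold updh. now rewrite Z.eqb_refl. Qed.

Section Rules.
Variables (P : program) (w0 : nat) (Y Bm : Z).
Notation WP := (wp P w0 Y Bm).

Lemma wp_seq a c Q l h t : WP a (WP c Q l) l h t -> WP (a ;; c) Q l h t.
Proof. auto. Qed.

Lemma wp_cons c (Q Q' : heap -> Z -> Prop) l h t :
  WP c Q l h t -> (forall h t, Q h t -> Q' h t) -> WP c Q' l h t.
Proof. intros; eapply wp_mono; eauto. Qed.

Lemma wp_let v e c Q l h t : ev l h e = v -> Z.abs v <= Y ->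
  WP c Q (l ++ [v]) h (t + (ecost e + 2)) -> WP (Let e c) Q l h t.
Proof. intros <- H1 H2. split; auto. Qed.

Lemma wp_letr a e c Q l h t : ev l h e = a -> (a < 0 \/ 64 <= a) ->
  WP c Q (l ++ [h (a mod 128) (-1 - a / 128)]) h (t + (ecost e + 3)) -> WP (LetR e c) Q l h t.
Proof. intros <- H1 H2. split; auto. Qed.

Lemma wp_sto i v k e1 e2 (Q : heap -> Z -> Prop) l h t : ev l h e1 = i -> ev l h e2 = v ->
  Z.abs v <= Y -> Q (updh h k i v) (t + (ecost e1 + ecost e2 + 5)) ->
  WP (Sto k e1 e2) Q l h t.
Proof. intros <- <- H1 H2. split; auto. Qed.

Lemma wp_str i v e1 e2 (Q : heap -> Z -> Prop) l h t : ev l h e1 = i -> ev l h e2 = v ->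
  (i < 0 \/ 64 <= i) -> Z.abs v <= Y ->
  Q (updh h (i mod 128) (-1 - i / 128) v) (t + (ecost e1 + ecost e2 + 1)) ->
  WP (StR e1 e2) Q l h t.
Proof. intros <- <- H1 H2. split; auto. Qed.

Lemma wp_if e a c (Q : heap -> Z -> Prop) l h t :
  (ev l h e <> 0 -> WP a Q l h (t + (ecost e + 3))) ->
  (ev l h e = 0 -> WP c Q l h (t + (ecost e + 3))) -> WP (If e a c) Q l h t.
Proof.
  intros H1 H2. cbn [wp]. destruct (Z.eqb_spec (ev l h e) 0); auto.
Qed.

Lemma wp_for lim (I : Z -> heap -> Z -> Prop) e c (Q : heap -> Z -> Prop) l h t :
  ev l h e = lim -> 0 <= lim <= Y -> I 0 h (t + (ecost e + 3)) ->
  (forall i h' t', 0 <= i < lim -> I i h' t' -> WP c (I (i + 1)) (l ++ [i; lim]) h' (t' + 6)) ->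
  (forall h' t', I lim h' t' -> Q h' (t' + 2)) -> WP (For e c) Q l h t.
Proof.
  intros E Hlim H0 HS HQ. cbn [wp]. rewrite E. split; [lia|].
  assert (H : forall k i h' t', 0 <= i -> i + Z.of_nat k = lim -> I i h' t' ->
    wfor (WP c) l lim k i Q h' t').
  { induction k as [|k IHk]; intros i h' t' Hi Hk HI; cbn [wfor].
    - apply HQ. now replace lim with i by lia.
    - eapply wp_cons; [apply HS; auto; lia|]. intros h'' t'' HI'. apply IHk; auto; lia. }
  apply H; auto; lia.
Qed.

(** For loops that write one entry of one array per round. Injectivity of [idx] replaces an
    invariant: round [i] may assume that entries not written in earlier rounds are unchanged, and no
    later round overwrites its result. *)
Lemma wp_map lim k (idx val : Z -> Z) cost e c (Q : heap -> Z -> Prop) l h t :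
  ev l h e = lim -> 0 <= lim <= Y -> 0 <= cost ->
  (forall i i', 0 <= i < lim -> 0 <= i' < lim -> idx i = idx i' -> i = i') ->
  (forall i h' t', 0 <= i < lim -> (forall k', k' <> k -> h' k' = h k') ->
    (forall j, (forall i', 0 <= i' < i -> j <> idx i') -> h' k j = h k j) ->
    WP c (fun h'' t'' => (forall k', k' <> k -> h'' k' = h' k') /\ h'' k (idx i) = val i /\
       (forall j, j <> idx i -> h'' k j = h' k j) /\ t'' <= t' + cost) (l ++ [i; lim]) h' t') ->
  (forall h' t', (forall k', k' <> k -> h' k' = h k') ->
    (forall i, 0 <= i < lim -> h' k (idx i) = val i) ->
    (forall j, (forall i, 0 <= i < lim -> j <> idx i) -> h' k j = h k j) ->
    t' <= t + (ecost e + 5) + lim * (cost + 6) -> Q h' t') -> WP (For e c) Q l h t.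
Proof.
  intros E Hlim Hcost Hinj Hbody HQ.
  apply (wp_for lim (fun i h' t' =>
    (forall k', k' <> k -> h' k' = h k') /\
    (forall i', 0 <= i' < i -> h' k (idx i') = val i') /\
    (forall j, (forall i', 0 <= i' < i -> j <> idx i') -> h' k j = h k j) /\
    t' <= t + (ecost e + 3) + i * (cost + 6))); auto.
  - repeat split; auto; try lia.
  - intros i h' t' Hi (H1 & H2 & H3 & H4).
    eapply wp_cons; [apply Hbody; auto|]. cbn beta.
    intros h'' t'' (G1 & G2 & G3 & G4). split; [|split; [|split]].
    + intros k' Hk'. rewrite G1, H1; auto.
    + intros i' Hi'. destruct (Z.eq_dec i' i) as [->|Hne]; auto.
      rewrite G3; [apply H2; lia|]. intros Heq. apply Hne. apply Hinj; auto; lia.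
    + intros j Hj. rewrite G3 by (apply Hj; lia). apply H3. intros; apply Hj; lia.
    + lia.
  - intros h' t' (H1 & H2 & H3 & H4). apply HQ; auto; lia.
Qed.

End Rules.

Ltac evs := cbn [ev nth app eval_binop].
Ltac cs := cbn [ecost].
Ltac wseq := apply wp_seq.
Ltac wlet v := apply (wp_let _ _ _ _ v); [evs|  | cs; cbn [app]].
Ltac wsto i v := apply (wp_sto _ _ _ _ i v); [evs|evs| |cs].

(** * Matrix multiplication *)

(* Throughout, the variables 0 to 12 are n, t, b, L, V, NB, N, tau, D, H, N2, S, BB with
   N = b ^ 49 = 2 ^ L, NB = N / b, V = 7 ^ L, D = b ^ 3, tau = N / D, H = N * NB, N2 = N ^ 2,
   BB = b ^ 2 and S the stride of oracle memories.  Level [l] of a matrix starts at [l * V]. *)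
Definition gath_cmd (k : Z) (c11 c12 c21 c22 : exp) : cmd :=
  For (EV 3)
   (Let (EL TP2 (EV 3 -! EC 1 -! EV 20))
   (For (EC 7 *! EL TP7 (EV 20) *! EV 22 *! EV 22)
   (Let ((EV 23 /! (EV 22 *! EV 22)) %! EC 7)
   (Let ((EV 23 /! (EV 22 *! EV 22) /! EC 7 *! (EC 2 *! EV 22) +! (EV 23 /! EV 22) %! EV 22)
          *! (EC 2 *! EV 22) +! EV 23 %! EV 22)
   (Sto k ((EV 20 +! EC 1) *! EV 4 +! EV 23)
     (c11 *! EL k (EV 20 *! EV 4 +! EV 26)
      +! c12 *! EL k (EV 20 *! EV 4 +! (EV 26 +! EV 22))
      +! c21 *! EL k (EV 20 *! EV 4 +! (EV 26 +! EC 2 *! EV 22 *! EV 22))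
      +! c22 *! EL k (EV 20 *! EV 4 +! (EV 26 +! EC 2 *! EV 22 *! EV 22 +! EV 22)))))))).

Lemma gath_ext u11 u12 u21 u22 h np A A' e : 0 < h ->
  (forall z, 0 <= z < np * (2 * h) * (2 * h) -> A z = A' z) -> 0 <= e < 7 * np * h * h ->
  gath u11 u12 u21 u22 h A e = gath u11 u12 u21 u22 h A' e.
Proof.
  intros Hh HA He. destruct (ix_ex (7 * np) h e Hh ltac:(lia)) as (x & r & c & Hx & Hr & Hc & ->).
  destruct (dm_range x np 7 ltac:(lia) ltac:(lia)) as (H1 & H2 & ->).
  rewrite (Z.mul_comm _ 7), !gath_ix by auto.
  rewrite !HA by (apply ix_range; lia). reflexivity.
Qed.

(** Every factor of a Strassen product is a signed sum of at most two quadrants, so entries at most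
    double per level and end below [2 ^ L = N]. *)
Lemma gath_abs u11 u12 u21 u22 h np A e M : 0 < h -> 0 <= M ->
  (forall s, 0 <= s < 7 -> Z.abs (u11 s) + Z.abs (u12 s) + Z.abs (u21 s) + Z.abs (u22 s) <= 2) ->
  (forall z, 0 <= z < np * (2 * h) * (2 * h) -> Z.abs (A z) <= M) -> 0 <= e < 7 * np * h * h ->
  Z.abs (gath u11 u12 u21 u22 h A e) <= 2 * M.
Proof.
  intros Hh HM Hu HA He. destruct (ix_ex (7 * np) h e Hh ltac:(lia)) as (x & r & c & Hx & Hr & Hc & ->).
  destruct (dm_range x np 7 ltac:(lia) ltac:(lia)) as (H1 & H2 & ->).
  rewrite (Z.mul_comm _ 7), gath_ix by auto. specialize (Hu _ H2).
  pose proof (HA (ix (2 * h) (x / 7) r c) ltac:(apply ix_range; lia)) as B1.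
  pose proof (HA (ix (2 * h) (x / 7) r (h + c)) ltac:(apply ix_range; lia)) as B2.
  pose proof (HA (ix (2 * h) (x / 7) (h + r) c) ltac:(apply ix_range; lia)) as B3.
  pose proof (HA (ix (2 * h) (x / 7) (h + r) (h + c)) ltac:(apply ix_range; lia)) as B4.
  revert Hu B1 B2 B3 B4.
  generalize (A (ix (2 * h) (x / 7) r c)) (A (ix (2 * h) (x / 7) r (h + c)))
    (A (ix (2 * h) (x / 7) (h + r) c)) (A (ix (2 * h) (x / 7) (h + r) (h + c)))
    (u11 (x mod 7)) (u12 (x mod 7)) (u21 (x mod 7)) (u22 (x mod 7)).
  intros p1 p2 p3 p4 v1 v2 v3 v4 Hv B1 B2 B3 B4.
  assert (Hp : forall v p, Z.abs p <= M -> Z.abs (v * p) <= Z.abs v * M)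
    by (intros; rewrite Z.abs_mul; nia).
  pose proof (proj1 (Z.abs_le _ _) (Hp v1 _ B1)) as C1.
  pose proof (proj1 (Z.abs_le _ _) (Hp v2 _ B2)) as C2.
  pose proof (proj1 (Z.abs_le _ _) (Hp v3 _ B3)) as C3.
  pose proof (proj1 (Z.abs_le _ _) (Hp v4 _ B4)) as C4.
  pose proof (Z.mul_le_mono_nonneg_r _ _ M HM Hv) as Hs. clear Hp B1 B2 B3 B4 Hv.
  apply Z.abs_le.
  revert C1 C2 C3 C4 Hs. generalize (Z.abs v1) (Z.abs v2) (Z.abs v3) (Z.abs v4). intros; lia.
Qed.

(** Level [l] consists of [7 ^ l] blocks of [4 ^ (L - l)] entries. As this never exceeds [7 ^ L],
    all levels can be stored with stride [V] and each can be charged [V], which gives up only a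
    factor [L + 1] in time. *)
Lemma pow_level L l : 0 <= l <= L ->
  0 < 7 ^ l * 2 ^ (L - l) * 2 ^ (L - l) <= 7 ^ L.
Proof.
  intros Hl. assert (0 < 7 ^ l) by (apply Z.pow_pos_nonneg; lia).
  assert (0 < 2 ^ (L - l)) by (apply Z.pow_pos_nonneg; lia). split; [nia|].
  replace L with (l + (L - l)) at 3 by lia. rewrite Z.pow_add_r by lia.
  rewrite <- Z.mul_assoc, <- Z.pow_mul_l.
  apply Z.mul_le_mono_nonneg_l; [lia|]. apply Z.pow_le_mono_l. lia.
Qed.

Lemma pow2_half L l : 0 <= l < L -> 2 ^ (L - l) = 2 * 2 ^ (L - 1 - l).
Proof.
  intros. replace (L - l) with (Z.succ (L - 1 - l)) by lia. apply Z.pow_succ_r. lia.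
Qed.

Lemma pow7_succ l : 0 <= l -> 7 ^ (l + 1) = 7 * 7 ^ l.
Proof. intros. apply Z.pow_succ_r. auto. Qed.

Lemma scat_ext h np C C' e : 0 < h ->
  (forall z, 0 <= z < 7 * np * h * h -> C z = C' z) -> 0 <= e < np * (2 * h) * (2 * h) ->
  scat h C e = scat h C' e.
Proof.
  intros Hh HC He.
  destruct (ix_ex np (2 * h) e ltac:(lia) ltac:(lia)) as (x & r & c & Hx & Hr & Hc & ->).
  destruct (dm_range r 2 h ltac:(lia) Hh) as (R1 & R2 & R3).
  destruct (dm_range c 2 h ltac:(lia) Hh) as (C1 & C2 & C3).
  rewrite R3, C3, !scat_ix by auto.
  rewrite !HC by (apply ix_range; lia). reflexivity.
Qed.

Definition sq (x : nat) : exp := EV x *! EV x.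

(** Rebuilds the levels [L - 1] down to 0: variable 22 is the level, variable 23 half its block
    size. Variables 28 and 29 are the 0/1 coordinates of the quadrant, through which the
    coefficients of the seven products are computed arithmetically. *)
Definition scat_cmd : cmd :=
  For (EV 3)
   (Let (EV 3 -! EC 1 -! EV 20)
   (Let (EL TP2 (EV 20))
   (For (EL TP7 (EV 22) *! (EC 2 *! EV 23) *! (EC 2 *! EV 23))
   (Let ((EV 24 /! (EC 2 *! EV 23)) %! (EC 2 *! EV 23))
   (Let (EV 24 %! (EC 2 *! EV 23))
   (Let (EV 26 /! EV 23)
   (Let (EV 27 /! EV 23)
   (Let ((EC 7 *! (EV 24 /! (EC 2 *! EV 23 *! (EC 2 *! EV 23))) *! EV 23 +! EV 26 %! EV 23) *! EV 23
          +! EV 27 %! EV 23)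
   (Sto MC (EV 22 *! EV 4 +! EV 24)
     ((EC 1 -! EV 28 -! EV 29 +! EC 2 *! (EV 28 *! EV 29)) *! EL MC ((EV 22 +! EC 1) *! EV 4 +! EV 30)
      +! EV 28 *! (EC 1 -! EC 2 *! EV 29) *! EL MC ((EV 22 +! EC 1) *! EV 4 +! (EV 30 +! sq 23))
      +! EV 29 *! EL MC ((EV 22 +! EC 1) *! EV 4 +! (EV 30 +! EC 2 *! sq 23))
      +! (EC 1 -! EV 29) *! EL MC ((EV 22 +! EC 1) *! EV 4 +! (EV 30 +! EC 3 *! sq 23))
      +! (EC 1 -! EV 28) *! (EC 2 *! EV 29 -! EC 1) *! EL MC ((EV 22 +! EC 1) *! EV 4 +! (EV 30 +! EC 4 *! sq 23))
      +! EV 28 *! EV 29 *! EL MC ((EV 22 +! EC 1) *! EV 4 +! (EV 30 +! EC 5 *! sq 23))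
      +! (EC 1 -! EV 28) *! (EC 1 -! EV 29) *! EL MC ((EV 22 +! EC 1) *! EV 4 +! (EV 30 +! EC 6 *! sq 23)))))))))))).

Definition sel (i : Z) : exp := EV 25 =! EC i.

(** Variables are numbered from the outside, which ties the code to its nesting depth: 20 is the
    first number free inside the loop over frequent values. In [sel], variable 25 is the number of
    the Strassen product. *)
Definition mm_cmd : cmd :=
  gath_cmd MA (sel 0 +! sel 2 +! sel 4 -! sel 5) (sel 4 +! sel 6) (sel 1 +! sel 5)
    (sel 0 +! sel 1 +! sel 3 -! sel 6) ;;
  gath_cmd MB (sel 0 +! sel 1 -! sel 3 +! sel 5) (sel 2 +! sel 5) (sel 3 +! sel 6)
    (sel 0 -! sel 2 +! sel 4 +! sel 6) ;;
  For (EV 4) (Sto MC (EV 3 *! EV 4 +! EV 20)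
    (EL MA (EV 3 *! EV 4 +! EV 20) *! EL MB (EV 3 *! EV 4 +! EV 20))) ;;
  scat_cmd.

(** * Correctness and cost of matrix multiplication *)

Section MatMul.
Variables (P : program) (w0 : nat) (Y Bm : Z).
Notation WP := (wp P w0 Y Bm).
Variables g0 g1 g2 L V g5 N g7 g8 g9 g10 g11 g12 g13 g14 g15 g16 g17 g18 g19 : Z.
Notation env := [g0; g1; g2; L; V; g5; N; g7; g8; g9; g10; g11; g12; g13; g14; g15; g16; g17; g18; g19].
Hypothesis HL : 0 <= L.
Hypothesis HN : N = 2 ^ L.
Hypothesis HV : V = 7 ^ L.
Hypothesis HYN : 8 * N * N * N <= Y.

Definition tables (h : heap) :=
  forall x, 0 <= x <= L -> h TP2 x = 2 ^ x /\ h TP7 x = 7 ^ x.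

Lemma N_pos : 0 < N.
Proof. subst N. apply Z.pow_pos_nonneg; lia. Qed.

Lemma V_pos : 0 < V.
Proof. subst V. apply Z.pow_pos_nonneg; lia. Qed.

Lemma V_le : V <= N * N * N.
Proof.
  subst N V. rewrite <- !Z.pow_mul_l. apply Z.pow_le_mono_l. lia.
Qed.

Lemma L_lt : L < N.
Proof. subst N. apply Z.pow_gt_lin_r; lia. Qed.

Definition glev (u11 u12 u21 u22 : Z -> Z) (f : Z -> Z) (l : Z) :=
  forall e, 0 <= e < 7 * 7 ^ l * 2 ^ (L - 1 - l) * 2 ^ (L - 1 - l) ->
    f ((l + 1) * V + e) = gath u11 u12 u21 u22 (2 ^ (L - 1 - l)) (fun z => f (l * V + z)) e.

Definition gbnd (f : Z -> Z) (l : Z) :=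
  forall e, 0 <= e < 7 ^ l * 2 ^ (L - l) * 2 ^ (L - l) -> Z.abs (f (l * V + e)) <= 2 ^ l.

Lemma gath_ok k c11 c12 c21 c22 u11 u12 u21 u22 (Q : heap -> Z -> Prop) h t :
  (forall l h, ev l h c11 = u11 (nth 25 l 0)) -> (forall l h, ev l h c12 = u12 (nth 25 l 0)) ->
  (forall l h, ev l h c21 = u21 (nth 25 l 0)) -> (forall l h, ev l h c22 = u22 (nth 25 l 0)) ->
  (forall s, 0 <= s < 7 -> Z.abs (u11 s) + Z.abs (u12 s) + Z.abs (u21 s) + Z.abs (u22 s) <= 2) ->
  0 <= ecost c11 + ecost c12 + ecost c21 + ecost c22 <= 100 ->
  k <> TP2 -> k <> TP7 -> tables h ->
  (forall e, 0 <= e < N * N -> Z.abs (h k e) <= 1) ->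
  (forall h' t', (forall k', k' <> k -> h' k' = h k') ->
    (forall e, 0 <= e < N * N -> h' k e = h k e) ->
    (forall l, 0 <= l < L -> glev u11 u12 u21 u22 (h' k) l) ->
    (forall l, 0 <= l <= L -> gbnd (h' k) l) ->
    t' <= t + 500 * (L + 1) * V -> Q h' t') ->
  WP (gath_cmd k c11 c12 c21 c22) Q env h t.
Proof.
  intros Ec1 Ec2 Ec3 Ec4 Hu Hcost Hk2 Hk7 Htab Hb0 HQ.
  pose proof N_pos as HN0. pose proof V_pos as HV0. pose proof V_le as HVN. pose proof L_lt as HLN.
  assert (HN2 : N * N <= V).
  { pose proof (pow_level L 0 ltac:(lia)) as Hp. rewrite Z.sub_0_r, <- HN, <- HV in Hp. lia. }
  assert (HYV : V <= Y) by lia. assert (HYN' : 8 * N <= Y) by nia.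
  unfold gath_cmd.
  apply (wp_for _ _ _ _ L (fun l h' t' =>
    (forall k', k' <> k -> h' k' = h k') /\ (forall e, 0 <= e < N * N -> h' k e = h k e) /\
    (forall l', 0 <= l' < l -> glev u11 u12 u21 u22 (h' k) l') /\
    (forall l', 0 <= l' <= l -> gbnd (h' k) l') /\
    t' <= t + 10 + l * (490 * V))); [reflexivity|lia| | |].
  - split; [auto|]. split; [auto|]. split; [intros; lia|]. split; [|cs; lia].
    intros l' Hl' e He. replace l' with 0 in * by lia. rewrite Z.sub_0_r in He.
    rewrite <- HN in He. change (0 * V + e) with e. change (2 ^ 0) with 1 in *.
    change (7 ^ 0) with 1 in He. apply Hb0. lia.
  - intros l h1 t1 Hl (F1 & F2 & F3 & F4 & F5). cbn [app].
    set (hh := 2 ^ (L - 1 - l)) in *.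
    assert (Hhh : 0 < hh) by (apply Z.pow_pos_nonneg; lia).
    pose proof (pow_level L l ltac:(lia)) as Hlev. rewrite pow2_half in Hlev by lia. fold hh in Hlev.
    pose proof (pow_level L (l + 1) ltac:(lia)) as Hlev1.
    replace (L - (l + 1)) with (L - 1 - l) in Hlev1 by lia. fold hh in Hlev1.
    rewrite pow7_succ in Hlev1 by lia. rewrite <- HV in Hlev, Hlev1.
    assert (Hpl : 0 < 7 ^ l) by (apply Z.pow_pos_nonneg; lia).
    assert (HhN : hh <= N).
    { subst N hh. apply Z.pow_le_mono_r; lia. }
    wlet hh.
    { rewrite F1 by auto. apply Htab. lia. }
    { lia. }
    apply (wp_map _ _ _ _ (7 * 7 ^ l * hh * hh) k (fun e => (l + 1) * V + e)
      (gath u11 u12 u21 u22 hh (fun z => h1 k (l * V + z))) 400).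
    + evs. rewrite F1 by auto. rewrite (proj2 (Htab l ltac:(lia))). reflexivity.
    + lia.
    + lia.
    + intros; lia.
    + intros e h2 t2 He G1 G2. cbn [app].
      destruct (ix_ex (7 * 7 ^ l) hh e Hhh He) as (x & r & c & Hx & Hr & Hc & Ee).
      destruct (ix_div hh x r c Hr Hc) as (D1 & D2 & D3). rewrite <- Ee in D1, D2, D3.
      wlet ((e / (hh * hh)) mod 7); [reflexivity|pose proof (Z.mod_pos_bound (e / (hh * hh)) 7); lia|].
      set (z := (e / (hh * hh) / 7 * (2 * hh) + (e / hh) mod hh) * (2 * hh) + e mod hh).
      assert (Hz : 0 <= z < 7 ^ l * (2 * hh) * (2 * hh)).
      { unfold z. rewrite D1, D2, D3.
        destruct (dm_range x (7 ^ l) 7 ltac:(lia) ltac:(lia)) as (X1 & X2 & X3).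
        change (0 <= ix (2 * hh) (x / 7) r c < 7 ^ l * (2 * hh) * (2 * hh)).
        apply ix_range; lia. }
      wlet z; [reflexivity|lia|].
      assert (EG : gath u11 u12 u21 u22 hh (fun z => h2 k (l * V + z)) e =
                   gath u11 u12 u21 u22 hh (fun z => h1 k (l * V + z)) e).
      { apply (gath_ext _ _ _ _ hh (7 ^ l)); auto. intros z' Hz'. apply G2. intros; nia. }
      wsto ((l + 1) * V + e) (gath u11 u12 u21 u22 hh (fun z => h1 k (l * V + z)) e).
      * reflexivity.
      * rewrite <- EG, Ec1, Ec2, Ec3, Ec4. reflexivity.
      * etransitivity; [apply (gath_abs _ _ _ _ hh (7 ^ l) _ e (2 ^ l))|]; auto.
        -- apply Z.pow_nonneg; lia.
        -- intros z' Hz'. apply F4; [lia|]. rewrite pow2_half by lia. auto.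
        -- assert (2 ^ l <= N) by (subst N; apply Z.pow_le_mono_r; lia). lia.
      * split; [|split; [|split]].
        -- intros; apply updh_arr; auto.
        -- apply updh_same.
        -- intros; apply updh_idx; auto.
        -- lia.
    + intros h2 t2 G1 G2 G3 G4.
      assert (Hold : forall j, 0 <= j < (l + 1) * V -> h2 k j = h1 k j).
      { intros j Hj. apply G3. intros; lia. }
      assert (Hdown : forall l', 0 <= l' < l + 1 -> forall e, 0 <= e < V -> h2 k (l' * V + e) = h1 k (l' * V + e)).
      { intros l' Hl' e He. apply Hold. nia. }
      assert (Hlev' : forall l', 0 <= l' < L -> 0 < 2 ^ (L - 1 - l') /\
         7 ^ l' * (2 * 2 ^ (L - 1 - l')) * (2 * 2 ^ (L - 1 - l')) <= V /\
         7 * 7 ^ l' * 2 ^ (L - 1 - l') * 2 ^ (L - 1 - l') <= V).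
      { intros l' Hl'. split; [apply Z.pow_pos_nonneg; lia|].
        pose proof (pow_level L l' ltac:(lia)) as J1. rewrite pow2_half in J1 by lia.
        pose proof (pow_level L (l' + 1) ltac:(lia)) as J2.
        replace (L - (l' + 1)) with (L - 1 - l') in J2 by lia.
        rewrite pow7_succ in J2 by lia. lia. }
      assert (Hnew : glev u11 u12 u21 u22 (h2 k) l).
      { intros e He. rewrite G2 by auto.
        apply (gath_ext _ _ _ _ _ (7 ^ l)); auto.
        intros z Hz. symmetry. apply Hdown; lia. }
      split; [|split; [|split; [|split]]].
      * intros k' Hk'. rewrite G1, F1; auto.
      * intros e He. rewrite Hold by nia. auto.
      * intros l' Hl'. destruct (Z.eq_dec l' l) as [->|Hne]; [exact Hnew|].
        intros e He. destruct (Hlev' l' ltac:(lia)) as (J0 & J1 & J2).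
        rewrite Hdown by lia. rewrite F3 by lia.
        apply (gath_ext _ _ _ _ _ (7 ^ l')); auto. intros z Hz. symmetry. apply Hdown; lia.
      * intros l' Hl' e He. destruct (Z.eq_dec l' (l + 1)) as [->|Hne].
        -- replace (L - (l + 1)) with (L - 1 - l) in He by lia. fold hh in He.
           rewrite pow7_succ in He by lia. rewrite Hnew by auto.
           change (l + 1) with (Z.succ l). rewrite Z.pow_succ_r by lia.
           apply (gath_abs _ _ _ _ _ (7 ^ l)); auto; [apply Z.pow_nonneg; lia|].
           intros z Hz. fold hh in Hz. rewrite Hdown by lia. apply F4; [lia|].
           rewrite pow2_half by lia. auto.
        -- rewrite Hdown; [apply F4; auto; lia|lia|].
           pose proof (pow_level L l' ltac:(lia)). lia.
      * revert G4. cs. nia.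
  - intros h' t' (F1 & F2 & F3 & F4 & F5). apply HQ; auto. nia.
Qed.

Definition plev (fa fb fc : Z -> Z) (l : Z) :=
  forall x r c, 0 <= x < 7 ^ l -> 0 <= r < 2 ^ (L - l) -> 0 <= c < 2 ^ (L - l) ->
    fc (l * V + ix (2 ^ (L - l)) x r c) =
    zs (2 ^ (L - l)) (fun k => fa (l * V + ix (2 ^ (L - l)) x r k) *
                              fb (l * V + ix (2 ^ (L - l)) x k c)).

Lemma scat_ok (Q : heap -> Z -> Prop) h t : tables h ->
  (forall l, 0 <= l < L -> glev a11 a12 a21 a22 (h MA) l) ->
  (forall l, 0 <= l < L -> glev b11 b12 b21 b22 (h MB) l) ->
  (forall l, 0 <= l <= L -> gbnd (h MA) l) -> (forall l, 0 <= l <= L -> gbnd (h MB) l) ->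
  plev (h MA) (h MB) (h MC) L ->
  (forall h' t', (forall k', k' <> MC -> h' k' = h k') -> plev (h MA) (h MB) (h' MC) 0 ->
    t' <= t + 500 * (L + 1) * V -> Q h' t') ->
  WP scat_cmd Q env h t.
Proof.
  intros Htab HA HB HbA HbB HP0 HQ.
  pose proof N_pos as HN0. pose proof V_pos as HV0. pose proof V_le as HVN. pose proof L_lt as HLN.
  assert (HYV : V <= Y) by lia. assert (HYN' : 8 * N <= Y) by nia.
  unfold scat_cmd.
  apply (wp_for _ _ _ _ L (fun i h' t' =>
    (forall k', k' <> MC -> h' k' = h k') /\ plev (h MA) (h MB) (h' MC) (L - i) /\
    t' <= t + 10 + i * (490 * V))); [reflexivity|lia| | |].
  - rewrite Z.sub_0_r. repeat split; auto. cs; lia.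
  - intros i h1 t1 Hi (F1 & F2 & F3). cbn [app].
    set (l := L - 1 - i). assert (Hl : 0 <= l < L) by lia.
    set (hh := 2 ^ i) in *.
    assert (Ehh : 2 ^ (L - 1 - l) = hh) by (unfold hh; f_equal; lia).
    assert (Hhh : 0 < hh) by (apply Z.pow_pos_nonneg; lia).
    pose proof (pow_level L l ltac:(lia)) as Hlev. rewrite pow2_half, Ehh in Hlev by lia.
    pose proof (pow_level L (l + 1) ltac:(lia)) as Hlev1.
    replace (L - (l + 1)) with (L - 1 - l) in Hlev1 by lia. rewrite Ehh in Hlev1.
    rewrite pow7_succ in Hlev1 by lia. rewrite <- HV in Hlev, Hlev1.
    assert (Hpl : 0 < 7 ^ l) by (apply Z.pow_pos_nonneg; lia).
    assert (HhN : hh <= N) by (subst N hh; apply Z.pow_le_mono_r; lia).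
    replace (L - i) with (l + 1) in F2 by lia.
    assert (Hprod : forall C, (forall e, 0 <= e < 7 ^ l * (2 * hh) * (2 * hh) ->
        C e = scat hh (fun z => h1 MC ((l + 1) * V + z)) e) ->
      forall p r c, 0 <= p < 7 ^ l -> 0 <= r < 2 * hh -> 0 <= c < 2 * hh ->
      C (ix (2 * hh) p r c) = zs (2 * hh) (fun k => h MA (l * V + ix (2 * hh) p r k) *
        h MB (l * V + ix (2 * hh) p k c))).
    { intros C HC. apply (strassen_level hh (7 ^ l) (fun z => h MA (l * V + z))
        (fun z => h MB (l * V + z)) C (fun z => h MA ((l + 1) * V + z))
        (fun z => h MB ((l + 1) * V + z)) (fun z => h1 MC ((l + 1) * V + z))); auto.
      - intros e He. rewrite (HA l) by (rewrite ?Ehh; lia). now rewrite Ehh.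
      - intros e He. rewrite (HB l) by (rewrite ?Ehh; lia). now rewrite Ehh.
      - intros x r c Hx Hr Hc. unfold plev in F2.
        replace (L - (l + 1)) with (L - 1 - l) in F2 by lia. rewrite Ehh in F2.
        apply F2; auto. rewrite pow7_succ by lia. lia. }
    wlet l; [reflexivity|lia|].
    wlet hh; [|lia|].
    { rewrite F1 by discriminate. apply Htab. lia. }
    apply (wp_map _ _ _ _ (7 ^ l * (2 * hh) * (2 * hh)) MC (fun e => l * V + e)
      (scat hh (fun z => h1 MC ((l + 1) * V + z))) 450).
    + evs. rewrite F1 by discriminate. rewrite (proj2 (Htab l ltac:(lia))). reflexivity.
    + lia.
    + lia.
    + intros; lia.
    + intros e h2 t2 He G1 G2. cbn [app].
      destruct (ix_ex (7 ^ l) (2 * hh) e ltac:(lia) He) as (x & r & c & Hx & Hr & Hc & Ee).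
      destruct (ix_div (2 * hh) x r c Hr Hc) as (D1 & D2 & D3). rewrite <- Ee in D1, D2, D3.
      destruct (dm_range r 2 hh ltac:(lia) Hhh) as (R1 & R2 & R3).
      destruct (dm_range c 2 hh ltac:(lia) Hhh) as (C1 & C2 & C3).
      wlet ((e / (2 * hh)) mod (2 * hh)); [reflexivity|lia|].
      wlet (e mod (2 * hh)); [reflexivity|lia|].
      wlet ((e / (2 * hh)) mod (2 * hh) / hh); [reflexivity|rewrite D2; lia|].
      wlet (e mod (2 * hh) / hh); [reflexivity|rewrite D3; lia|].
      set (z := (7 * (e / (2 * hh * (2 * hh))) * hh + (e / (2 * hh)) mod (2 * hh) mod hh) * hh
         + e mod (2 * hh) mod hh).
      assert (Hz : 0 <= z < 7 * 7 ^ l * hh * hh).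
      { unfold z. rewrite D1, D2, D3.
        change (0 <= ix hh (7 * x) (r mod hh) (c mod hh) < 7 * 7 ^ l * hh * hh).
        apply ix_range; lia. }
      wlet z; [reflexivity|lia|].
      assert (EG : scat hh (fun z => h2 MC ((l + 1) * V + z)) e =
                   scat hh (fun z => h1 MC ((l + 1) * V + z)) e).
      { apply (scat_ext hh (7 ^ l)); auto. intros z' Hz'. apply G2. intros; nia. }
      wsto (l * V + e) (scat hh (fun z => h1 MC ((l + 1) * V + z)) e).
      * reflexivity.
      * rewrite <- EG. reflexivity.
      (* The stored value is bounded through its meaning, an inner product of [2 ^ (L - l)] terms of
         size at most [2 ^ l * 2 ^ l]. Bounding the combination of seven entries instead would lose
         a constant factor at every level. *)
      * rewrite Ee, (Hprod _ (fun e _ => eq_refl)) by auto.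
        assert (B2 : 0 < 2 ^ l) by (apply Z.pow_pos_nonneg; lia).
        etransitivity; [apply (zs_abs _ _ (2 ^ l * 2 ^ l)); [lia|]|].
        -- intros k Hk. rewrite Z.abs_mul. apply Z.mul_le_mono_nonneg; try apply Z.abs_nonneg.
           ++ apply HbA; [lia|]. rewrite pow2_half, Ehh by lia. apply ix_range; lia.
           ++ apply HbB; [lia|]. rewrite pow2_half, Ehh by lia. apply ix_range; lia.
        -- rewrite <- Ehh, <- pow2_half by lia.
           rewrite Z.mul_assoc, <- Z.pow_add_r by lia. replace (L - l + l) with L by lia.
           assert (2 ^ l <= 2 ^ L) by (apply Z.pow_le_mono_r; lia). rewrite <- HN in *. nia.
      * split; [|split; [|split]].
        -- intros; apply updh_arr; auto.
        -- apply updh_same.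
        -- intros; apply updh_idx; auto.
        -- cbn [ecost sq]. lia.
    + intros h2 t2 G1 G2 G3 G4. split; [|split].
      * intros k' Hk'. rewrite G1, F1; auto.
      * replace (L - (i + 1)) with l by lia. intros x r c Hx Hr Hc.
        rewrite pow2_half, Ehh in * by lia.
        apply (Hprod (fun e => h2 MC (l * V + e))); auto.
      * revert G4. cs. nia.
  - intros h' t' (F1 & F2 & F3). apply HQ; auto; [|nia]. now rewrite Z.sub_diag in F2.
Qed.

Lemma mm_ok (Q : heap -> Z -> Prop) h t : tables h ->
  (forall e, 0 <= e < N * N -> Z.abs (h MA e) <= 1) ->
  (forall e, 0 <= e < N * N -> Z.abs (h MB e) <= 1) ->
  (forall h' t', (forall k', k' <> MA -> k' <> MB -> k' <> MC -> h' k' = h k') ->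
    (forall i j, 0 <= i < N -> 0 <= j < N ->
       h' MC (i * N + j) = zs N (fun k => h MA (i * N + k) * h MB (k * N + j))) ->
    t' <= t + 1700 * (L + 1) * V -> Q h' t') ->
  WP mm_cmd Q env h t.
Proof.
  intros Htab HA HB HQ. unfold mm_cmd.
  pose proof N_pos as HN0. pose proof V_pos as HV0. pose proof V_le as HVN. pose proof L_lt as HLN.
  wseq. apply (gath_ok _ _ _ _ _ a11 a12 a21 a22); auto; try easy.
  { intros s Hs. assert (Hs' : s = 0 \/ s = 1 \/ s = 2 \/ s = 3 \/ s = 4 \/ s = 5 \/ s = 6) by lia.
    destruct Hs' as [->|[->|[->|[->|[->|[->| ->]]]]]]; cbn; lia. }
  intros h1 t1 F1 F2 F3 F4 F5. wseq.
  apply (gath_ok _ _ _ _ _ b11 b12 b21 b22); auto; try easy.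
  { intros s Hs. assert (Hs' : s = 0 \/ s = 1 \/ s = 2 \/ s = 3 \/ s = 4 \/ s = 5 \/ s = 6) by lia.
    destruct Hs' as [->|[->|[->|[->|[->|[->| ->]]]]]]; cbn; lia. }
  { intros x Hx. rewrite !F1 by discriminate. apply Htab; auto. }
  { intros e He. rewrite F1 by discriminate. auto. }
  intros h2 t2 G1 G2 G3 G4 G5. wseq.
  rewrite (F1 MB) in G2 by discriminate.
  assert (EA : h2 MA = h1 MA) by (apply G1; discriminate).
  apply (wp_map _ _ _ _ V MC (fun e => L * V + e) (fun e => h2 MA (L * V + e) * h2 MB (L * V + e)) 100);
    [reflexivity|lia|lia|intros; lia| |].
  { intros e h3 t3 He K1 K2. cbn [app].
    wsto (L * V + e) (h2 MA (L * V + e) * h2 MB (L * V + e)).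
    - reflexivity.
    - rewrite !K1 by discriminate. reflexivity.
    - assert (HeL : 0 <= e < 7 ^ L * 2 ^ (L - L) * 2 ^ (L - L))
        by (rewrite Z.sub_diag, <- HV; change (2 ^ 0) with 1; lia).
      pose proof (F4 L ltac:(lia) e HeL) as B1. pose proof (G4 L ltac:(lia) e HeL) as B2.
      rewrite EA, Z.abs_mul. rewrite <- HN in B1, B2. nia.
    - split; [|split; [|split]].
      + intros; apply updh_arr; auto.
      + apply updh_same.
      + intros; apply updh_idx; auto.
      + lia. }
  intros h3 t3 K1 K2 K3 K4.
  assert (EA3 : h3 MA = h1 MA) by (rewrite K1 by discriminate; auto).
  assert (EB3 : h3 MB = h2 MB) by (apply K1; discriminate).
  apply scat_ok.
  - intros x Hx. rewrite !K1, !G1, !F1 by discriminate. apply Htab; auto.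
  - rewrite EA3. exact F3.
  - rewrite EB3. exact G3.
  - rewrite EA3. exact F4.
  - rewrite EB3. exact G4.
  (* On the last level the blocks are single entries, so the entrywise product is the matrix
     product. *)
  - intros x r c Hx Hr Hc. rewrite Z.sub_diag in *. change (2 ^ 0) with 1 in *.
    rewrite zs_1. replace r with 0 by lia. replace c with 0 by lia.
    rewrite K2 by (unfold ix; lia). now rewrite EA, EA3, EB3.
  - intros h4 t4 M1 M2 M3. apply HQ.
    + intros k' H1 H2 H3. rewrite M1, K1, G1, F1; auto.
    + intros i j Hi Hj. specialize (M2 0 i j). rewrite Z.sub_0_r, <- HN in M2.
      change (7 ^ 0) with 1 in M2.
      specialize (M2 ltac:(lia) Hi Hj). unfold ix in M2.
      replace (0 * V + ((0 * N + i) * N + j)) with (i * N + j) in M2 by ring.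
      rewrite M2. apply zs_ext. intros k Hk.
      replace (0 * V + ((0 * N + i) * N + k)) with (i * N + k) by ring.
      replace (0 * V + ((0 * N + k) * N + j)) with (k * N + j) by ring.
      rewrite EA3, EB3, F2, G2 by nia. reflexivity.
    + revert K4. cs. nia.
Qed.

End MatMul.

(** * The equality product *)

(** [FRQ] is indexed by differences of weights, a range too large to be cleared. Only the values
    that the next two passes can meet are reset: one pass looks up a difference, the other counts
    its negative. *)
Definition reset_cmd : cmd :=
  For (EV 6)
   (Let (EL WT (EV 20 *! EV 6 +! EV 18) -! EL WT (EV 20 *! EV 6 +! EV 17))
   (Sto FRQ (EV 22) (EC 0) ;; Sto FRQ (EC 0 -! EV 22) (EC 0))).

(** A value enters column [k] of [HVY] at the moment its count passes from [tau] to [tau + 1], hence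
    exactly once. Its occurrences are kept in row [v] of [LST]. *)
Definition count_cmd : cmd :=
  For (EV 6)
   (If (EL ADJ (EV 18 *! EV 6 +! EV 20))
     (Let (EL WT (EV 20 *! EV 6 +! EV 17) -! EL WT (EV 20 *! EV 6 +! EV 18))
     (Let (EL FRQ (EV 22))
     (Sto LST (EV 22 *! EV 6 +! EV 23) (EV 20) ;;
      Sto FRQ (EV 22) (EV 23 +! EC 1) ;;
      If (EV 23 =! EV 7)
        (Sto HVY (EL TMP (EC 1) *! EV 6 +! EV 18) (EV 22) ;;
         Sto TMP (EC 1) (EL TMP (EC 1) +! EC 1))
        Skip)))
     Skip).

(** An infrequent value has at most [tau] occurrences, so this takes time O(N * tau) for each
    [k]. *)
Definition light_cmd : cmd :=
  For (EV 6)
   (Let (EL WT (EV 20 *! EV 6 +! EV 18) -! EL WT (EV 20 *! EV 6 +! EV 17))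
   (If (EL ADJ (EV 20 *! EV 6 +! EV 18) *! (EL FRQ (EV 22) <! EV 7 +! EC 1))
     (For (EL FRQ (EV 22))
       (Let (EV 20 *! EV 6 +! EL LST (EV 22 *! EV 6 +! EV 23))
       (Sto EQP (EV 25) (EL EQP (EV 25) +! EC 1))))
     Skip)).

Definition eqk_cmd : cmd :=
  reset_cmd ;; Sto TMP (EC 1) (EC 0) ;; count_cmd ;; Sto HCN (EV 18) (EL TMP (EC 1)) ;; light_cmd.

(** Round [s] uses for every [k] the [s]-th frequent value of that [k]: column [k] of one 0/1 matrix
    and row [k] of the other mark the entries equal to it. One product thus treats all [k] at once,
    and the number of products is the largest number of frequent values, not their total. *)
Definition heavy_cmd : cmd :=
  For (EV 10) (Sto MA (EV 20)
    (EL ADJ (EV 20) *! (EV 18 <! EL HCN (EV 20 %! EV 6)) *!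
     ((EL WT (EV 20) -! EL WT (EV 20 /! EV 6 *! EV 6 +! EV 17)) =!
      EL HVY (EV 18 *! EV 6 +! EV 20 %! EV 6)))) ;;
  For (EV 10) (Sto MB (EV 20)
    (EL ADJ (EV 20) *! (EV 18 <! EL HCN (EV 20 /! EV 6)) *!
     ((EL WT (EV 20 %! EV 6 *! EV 6 +! EV 17) -! EL WT (EV 20 %! EV 6 *! EV 6 +! EV 20 /! EV 6)) =!
      EL HVY (EV 18 *! EV 6 +! EV 20 /! EV 6)))) ;;
  mm_cmd ;;
  For (EV 10) (Sto EQP (EV 20) (EL EQP (EV 20) +! EL MC (EV 20))).

Definition eq_cmd : cmd :=
  For (EV 10) (Sto EQP (EV 18) (EC 0)) ;; For (EV 6) eqk_cmd ;; For (EV 8) heavy_cmd.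

(** * Correctness of the equality product *)

Section EqProd.
Variables (P : program) (w0 : nat) (Y Bm : Z).
Notation WP := (wp P w0 Y Bm).
Variables g0 g1 g2 L V g5 N tau D g9 N2 g11 g12 g13 g14 g15 g16 k0 : Z.
Notation genv := [g0; g1; g2; L; V; g5; N; tau; D; g9; N2; g11; g12; g13; g14; g15; g16; k0].
Hypothesis HL : 0 <= L.
Hypothesis HN : N = 2 ^ L.
Hypothesis HV : V = 7 ^ L.
Hypothesis HYN : 8 * N * N * N <= Y.
Hypothesis HN2 : N2 = N * N.
Hypothesis HD : N = D * tau.
Hypothesis Htau : 0 < tau.
Hypothesis Hk0 : 0 <= k0 < N.

Variables (A W : Z -> Z) (Wm : Z).
Hypothesis HA : forall e, 0 <= e < N * N -> A e = 0 \/ A e = 1.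
Hypothesis HW : forall e, 0 <= e < N * N -> Z.abs (W e) <= Wm.
Hypothesis HWm : 2 * Wm <= Y.

Let HN0 : 0 < N.
Proof. rewrite HN. apply Z.pow_pos_nonneg; lia. Qed.

Let HYN1 : 8 * N <= Y.
Proof. nia. Qed.

(* Edges [(i, k)] and [(k, j)] match relative to [k0] when [X i k = - X j k]. *)
Definition X (i k : Z) : Z := W (i * N + k) - W (i * N + k0).

Section Fixed_k.
Variable k : Z.
Hypothesis Hk : 0 <= k < N.
Notation env := [g0; g1; g2; L; V; g5; N; tau; D; g9; N2; g11; g12; g13; g14; g15; g16; k0; k; N].

(** The values that have been reset for the present [k]; elsewhere [FRQ] and [LST] may hold
    leftovers, so all claims about them are restricted to these. *)
Definition relv (v : Z) := exists i, 0 <= i < N /\ (v = X i k \/ v = - X i k).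

Definition hit (v j : Z) : Z := A (k * N + j) * b2z (- X j k =? v).
Definition cnt (v m : Z) : Z := zs m (hit v).

Lemma hit_range v j : 0 <= j < N -> 0 <= hit v j <= 1.
Proof.
  intros Hj. unfold hit. destruct (HA (k * N + j) ltac:(nia)) as [-> | ->];
    pose proof (b2z_range (- X j k =? v)); lia.
Qed.

Lemma cnt_range v m : 0 <= m <= N -> 0 <= cnt v m <= m.
Proof.
  intros Hm. unfold cnt. split.
  - apply zs_nonneg. intros; apply hit_range; lia.
  - etransitivity; [apply (zs_le _ _ (fun _ => 1))|rewrite zs_const; lia].
    intros; apply hit_range; lia.
Qed.

Lemma X_bound i : 0 <= i < N -> Z.abs (X i k) <= Y.
Proof.
  intros Hi. unfold X. pose proof (HW (i * N + k) ltac:(nia)).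
  pose proof (HW (i * N + k0) ltac:(nia)). lia.
Qed.

Lemma reset_ok (Q : heap -> Z -> Prop) h t : h WT = W ->
  (forall h' t', (forall k', k' <> FRQ -> h' k' = h k') ->
    (forall v, relv v -> h' FRQ v = 0) -> t' <= t + 100 * N + 100 -> Q h' t') ->
  WP reset_cmd Q env h t.
Proof.
  intros EW HQ. unfold reset_cmd.
  apply (wp_for _ _ _ _ N (fun i h' t' => (forall k', k' <> FRQ -> h' k' = h k') /\
    (forall i', 0 <= i' < i -> h' FRQ (X i' k) = 0 /\ h' FRQ (- X i' k) = 0) /\
    t' <= t + 50 + i * 100)); [reflexivity|lia| | |].
  - repeat split; auto; try lia. cs; lia.
  - intros i h1 t1 Hi (F1 & F2 & F3). cbn [app].
    wlet (X i k); [rewrite F1, EW by discriminate; reflexivity|apply X_bound; lia|].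
    wseq. wsto (X i k) 0; [reflexivity|reflexivity|lia|].
    wsto (- X i k) 0; [lia|reflexivity|lia|].
    split; [|split].
    + intros k' Hk'. rewrite !updh_arr; auto.
    + intros i' Hi'. rewrite !updh_at. split.
      * destruct (_ =? _); auto. destruct (Z.eqb_spec (X i' k) (X i k)); auto.
        destruct (Z.eq_dec i' i) as [->|]; [lia|]. apply F2; lia.
      * destruct (Z.eqb_spec (- X i' k) (- X i k)); auto. destruct (_ =? _); auto.
        destruct (Z.eq_dec i' i) as [->|]; [lia|]. apply F2; lia.
    + lia.
  - intros h' t' (F1 & F2 & F3). apply HQ; auto; [|lia].
    intros v (i & Hi & [-> | ->]); apply F2; auto.
Qed.

(* [hv] enumerates without repetition the values occurring more than [tau] times among the
   first [m] vertices. *)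
Definition colm (m c : Z) (hv : Z -> Z) :=
  0 <= c /\ (forall s s', 0 <= s < c -> 0 <= s' < c -> hv s = hv s' -> s = s') /\
  (forall s, 0 <= s < c -> relv (hv s) /\ tau < cnt (hv s) m) /\
  (forall v, relv v -> tau < cnt v m -> exists s, 0 <= s < c /\ hv s = v).

(* Summing an arbitrary [g] over the stored list states that the list enumerates the
   occurrences of [v] without mentioning their order. *)
Definition lstm (m : Z) (lst : Z -> Z) :=
  forall v, relv v -> (forall g, zs (cnt v m) (fun p => g (lst (v * N + p))) =
                                zs m (fun j => hit v j * g j)) /\
    (forall p, 0 <= p < cnt v m -> 0 <= lst (v * N + p) < N).

(** Double counting: a vertex hits at most one of the distinct values [hv s], and each of these is
    hit more than [tau] times. With [N = D * tau] at most [D] values are frequent. *)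
Lemma colm_le m c hv : 0 <= m <= N -> colm m c hv -> c * (tau + 1) <= m.
Proof.
  intros Hm (H0 & Hinj & Hc & _).
  assert (H1 : zs c (fun s => cnt (hv s) m) <= m).
  { unfold cnt. rewrite zs_exchange.
    rewrite <- (Z.mul_1_r m) at 2. rewrite <- zs_const by lia. apply zs_le.
    intros j Hj. clear Hc.
    assert (Hone : forall c', 0 <= c' <= c -> zs c' (fun s => hit (hv s) j) <= 1).
    { intros c' Hc'. pattern c'. apply (zs_ind _ c'); [lia|rewrite zs_0; lia|].
      intros s Hs IH. rewrite zs_succ by lia.
      pose proof (hit_range (hv s) j ltac:(lia)).
      destruct (Z.eqb_spec (- X j k) (hv s)) as [E|E].
      2:{ unfold hit at 2. rewrite (proj2 (Z.eqb_neq _ _) E). cbn [b2z]. lia. }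
      rewrite (zs_zero s); [lia|]. intros s' Hs'. unfold hit.
      destruct (Z.eqb_spec (- X j k) (hv s')) as [E'|E']; cbn [b2z]; [|lia].
      rewrite E in E'. apply Hinj in E'; lia. }
    apply Hone. lia. }
  enough (c * (tau + 1) <= zs c (fun s => cnt (hv s) m)) by lia.
  rewrite <- zs_const by lia. apply zs_le. intros s Hs. specialize (Hc s Hs). lia.
Qed.

Lemma count_ok (Q : heap -> Z -> Prop) h t : h WT = W -> h ADJ = A ->
  (forall v, relv v -> h FRQ v = 0) -> h TMP 1 = 0 ->
  (forall h' t',
    (forall k', k' <> FRQ -> k' <> LST -> k' <> TMP -> k' <> HVY -> h' k' = h k') ->
    (forall v, relv v -> h' FRQ v = cnt v N) -> lstm N (h' LST) ->
    colm N (h' TMP 1) (fun s => h' HVY (s * N + k)) ->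
    (forall s k', 0 <= k' < N -> k' <> k -> h' HVY (s * N + k') = h HVY (s * N + k')) ->
    t' <= t + 300 * N + 100 -> Q h' t') ->
  WP count_cmd Q env h t.
Proof.
  intros EW EA HF0 HT0 HQ. unfold count_cmd.
  apply (wp_for _ _ _ _ N (fun m h' t' =>
    (forall k', k' <> FRQ -> k' <> LST -> k' <> TMP -> k' <> HVY -> h' k' = h k') /\
    (forall v, relv v -> h' FRQ v = cnt v m) /\ lstm m (h' LST) /\
    colm m (h' TMP 1) (fun s => h' HVY (s * N + k)) /\
    (forall s k', 0 <= k' < N -> k' <> k -> h' HVY (s * N + k') = h HVY (s * N + k')) /\
    t' <= t + 50 + m * 300)); [reflexivity|lia| | |].
  - split; [auto|]. split; [intros; rewrite HF0; auto|].
    split; [|split; [|split; [auto|cs; lia]]].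
    + intros v Hv. split; [intros; reflexivity|]. unfold cnt; rewrite zs_0; intros; lia.
    + rewrite HT0. split; [lia|]. split; [intros; lia|]. split; [intros; lia|].
      intros v _. unfold cnt. rewrite zs_0. lia.
  - intros m h1 t1 Hm (F1 & F2 & F3 & F4 & F5 & F6). cbn [app].
    assert (HfA : ev [g0; g1; g2; L; V; g5; N; tau; D; g9; N2; g11; g12; g13; g14; g15; g16; k0; k; N; m; N]
       h1 (EL ADJ (EV 18 *! EV 6 +! EV 20)) = A (k * N + m))
      by (evs; rewrite F1, EA by discriminate; reflexivity).
    set (v := - X m k).
    assert (Hv : relv v) by (exists m; auto).
    assert (Hvb : Z.abs v <= Y) by (unfold v; rewrite Z.abs_opp; apply X_bound; auto).
    pose proof (cnt_range v m ltac:(lia)) as Hcr.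
    apply wp_if; rewrite HfA; intros HAm.
    + assert (HA1 : A (k * N + m) = 1) by (destruct (HA (k * N + m) ltac:(nia)); lia).
      assert (Ecnt : forall v', cnt v' (m + 1) = cnt v' m + b2z (v =? v')).
      { intros v'. unfold cnt. rewrite zs_succ by lia. unfold hit at 2. rewrite HA1.
        fold v. lia. }
      wlet v; [rewrite F1, EW by discriminate; unfold v, X; ring|auto|].
      wlet (cnt v m); [rewrite F2; auto|lia|].
      wseq. wsto (v * N + cnt v m) m; [reflexivity|reflexivity|lia|].
      wseq. wsto v (cnt v m + 1); [reflexivity|reflexivity|lia|].
      set (h2 := updh (updh h1 LST (v * N + cnt v m) m) FRQ v (cnt v m + 1)).
      assert (E2 : forall k', k' <> FRQ -> k' <> LST -> h2 k' = h1 k').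
      { intros k' H1 H2. unfold h2. rewrite !updh_arr; auto. }
      assert (EF : forall v', relv v' -> h2 FRQ v' = cnt v' (m + 1)).
      { intros v' Hv'. unfold h2. rewrite updh_at, Ecnt, (Z.eqb_sym v).
        destruct (Z.eqb_spec v' v) as [->|Hne]; cbn [b2z]; [reflexivity|].
        rewrite updh_arr, F2 by (auto; discriminate). lia. }
      assert (EL2 : h2 LST = updh h1 LST (v * N + cnt v m) m LST)
        by (unfold h2; apply updh_arr; discriminate).
      assert (Hlst : lstm (m + 1) (h2 LST)).
      { intros v' Hv'. rewrite EL2. destruct (F3 v' Hv') as [G1 G2].
        pose proof (cnt_range v' m ltac:(lia)) as Hcr'.
        assert (Old : forall p, 0 <= p < cnt v' m ->
          updh h1 LST (v * N + cnt v m) m LST (v' * N + p) = h1 LST (v' * N + p)).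
        { intros p Hp. apply updh_idx. intros Heq.
          destruct (dm_inj v' p v (cnt v m) N ltac:(lia) ltac:(lia) Heq) as [E1 E3]. rewrite E1 in Hp. lia. }
        rewrite Ecnt. destruct (Z.eqb_spec v v') as [<-|Hne]; cbn [b2z].
        - split.
          + intros g. rewrite !zs_succ by lia. rewrite updh_same. unfold hit at 2.
            rewrite HA1. fold v. rewrite Z.eqb_refl. cbn [b2z].
            rewrite <- G1. rewrite (zs_ext _ _ (fun p => g (h1 LST (v * N + p)))); [lia|].
            intros p Hp. now rewrite Old.
          + intros p Hp. destruct (Z.eq_dec p (cnt v m)) as [->|Hp'].
            * rewrite updh_same. lia.
            * rewrite Old by lia. apply G2. lia.
        - rewrite Z.add_0_r. split.
          + intros g. rewrite zs_succ by lia. unfold hit at 2. fold v.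
            rewrite (proj2 (Z.eqb_neq v v') Hne). cbn [b2z].
            rewrite <- G1. rewrite (zs_ext _ _ (fun p => g (h1 LST (v' * N + p)))); [lia|].
            intros p Hp. now rewrite Old.
          + intros p Hp. rewrite Old by lia. apply G2. lia. }
      destruct F4 as (C0 & C1 & C2 & C3).
      pose proof (colm_le m _ _ ltac:(lia) (conj C0 (conj C1 (conj C2 C3)))) as Hcle.
      assert (HcN : h1 TMP 1 <= N) by nia.
      assert (ET : h2 TMP = h1 TMP) by (apply E2; discriminate).
      assert (EH : h2 HVY = h1 HVY) by (apply E2; discriminate).
      apply wp_if; evs; intros Heq.
      * destruct (Z.eqb_spec (cnt v m) tau) as [Ht|Ht]; [|lia]. clear Heq.
        wseq. wsto (h1 TMP 1 * N + k) v; [rewrite ET; reflexivity|reflexivity|auto|].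
        wsto 1 (h1 TMP 1 + 1);
          [reflexivity|rewrite updh_arr by discriminate; rewrite ET; reflexivity|lia|].
        (* The listed values already occur more than [tau] times, while [v] occurs exactly [tau]
           times so far. *)
        assert (Hnew : forall s, 0 <= s < h1 TMP 1 -> h1 HVY (s * N + k) <> v).
        { intros s Hs E. destruct (C2 s Hs) as [_ C]. rewrite E in C. lia. }
        set (h3 := updh (updh h2 HVY (h1 TMP 1 * N + k) v) TMP 1 (h1 TMP 1 + 1)).
        assert (EH3 : forall j, h3 HVY j = if j =? h1 TMP 1 * N + k then v else h1 HVY j).
        { intros j. unfold h3. rewrite updh_arr by discriminate. rewrite updh_at.
          now rewrite EH. }
        assert (EHs : forall s, h3 HVY (s * N + k) = if s =? h1 TMP 1 then v else h1 HVY (s * N + k)).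
        { intros s. rewrite EH3. destruct (Z.eqb_spec s (h1 TMP 1)) as [->|Hne].
          - now rewrite Z.eqb_refl.
          - rewrite (proj2 (Z.eqb_neq _ _)); auto. intros E. apply Hne.
            destruct (dm_inj _ _ _ _ N Hk Hk E). auto. }
        assert (ET3 : h3 TMP 1 = h1 TMP 1 + 1) by (unfold h3; apply updh_same).
        assert (E3 : forall k', k' <> FRQ -> k' <> LST -> k' <> TMP -> k' <> HVY -> h3 k' = h1 k').
        { intros k' ? ? ? ?. unfold h3. rewrite !updh_arr by auto. apply E2; auto. }
        assert (E3' : forall k', k' <> TMP -> k' <> HVY -> h3 k' = h2 k').
        { intros k' ? ?. unfold h3. rewrite !updh_arr by auto. auto. }
        split; [|split; [|split; [|split; [|split]]]].
        -- intros k' ? ? ? ?. rewrite E3, F1; auto.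
        -- intros v' Hv'. rewrite E3' by discriminate. auto.
        -- rewrite E3' by discriminate. auto.
        -- rewrite ET3. split; [lia|]. split; [|split].
           ++ intros s s' Hs Hs'. rewrite !EHs.
              destruct (Z.eqb_spec s (h1 TMP 1)), (Z.eqb_spec s' (h1 TMP 1)); try lia.
              ** intros E. exfalso. apply (Hnew s'); auto; lia.
              ** intros E. exfalso. apply (Hnew s); auto; lia.
              ** intros E. apply C1; auto; lia.
           ++ intros s Hs. rewrite !EHs. destruct (Z.eqb_spec s (h1 TMP 1)).
              ** split; auto. rewrite Ecnt, Z.eqb_refl. cbn [b2z]. lia.
              ** destruct (C2 s ltac:(lia)) as [J1 J2]. split; auto. rewrite Ecnt.
                 pose proof (b2z_range (v =? h1 HVY (s * N + k))). lia.
           ++ intros v' Hv'. rewrite Ecnt. destruct (Z.eqb_spec v v') as [<-|Hne]; cbn [b2z].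
              ** intros _. exists (h1 TMP 1). split; [lia|]. rewrite EHs, Z.eqb_refl. auto.
              ** intros Hc. destruct (C3 v' Hv' ltac:(lia)) as (s & Hs & Es).
                 exists s. split; [lia|]. rewrite EHs.
                 rewrite (proj2 (Z.eqb_neq _ _)) by lia. auto.
        -- intros s k' Hk' Hne. rewrite EH3. rewrite (proj2 (Z.eqb_neq _ _)); auto.
           intros E. destruct (dm_inj _ _ _ _ N Hk' Hk E). auto.
        -- lia.
      * destruct (Z.eqb_spec (cnt v m) tau) as [Ht|Ht]; [lia|]. clear Heq.
        cbn [wp].
        split; [|split; [|split; [|split; [|split]]]].
        -- intros k' ? ? ? ?. rewrite E2, F1; auto.
        -- auto.
        -- auto.
        -- rewrite ET, EH. split; [lia|]. split; [auto|]. split.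
           ++ intros s Hs. destruct (C2 s ltac:(lia)) as [J1 J2]. split; auto. rewrite Ecnt.
              pose proof (b2z_range (v =? h1 HVY (s * N + k))). lia.
           ++ intros v' Hv'. rewrite Ecnt. intros Hc. apply C3; auto.
              destruct (Z.eqb_spec v v') as [<-|Hne]; cbn [b2z] in Hc; lia.
        -- rewrite EH. auto.
        -- cs; lia.
    + assert (Ecnt : forall v', cnt v' (m + 1) = cnt v' m).
      { intros v'. unfold cnt. rewrite zs_succ by lia. unfold hit at 2. rewrite HAm. lia. }
      cbn [wp].
      split; [|split; [|split; [|split; [|split]]]]; auto.
      * intros v' Hv'. rewrite Ecnt. auto.
      * intros v' Hv'. rewrite Ecnt. destruct (F3 v' Hv') as [G1 G2]. split; auto.
        intros g. rewrite G1, zs_succ by lia. unfold hit at 3. rewrite HAm. lia.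
      * destruct F4 as (C0 & C1 & C2 & C3). split; [auto|]. split; [auto|]. split.
        -- intros s Hs. rewrite Ecnt. auto.
        -- intros v' Hv'. rewrite Ecnt. auto.
      * cs; lia.
  - intros h' t' (F1 & F2 & F3 & F4 & F5 & F6). apply HQ; auto; lia.
Qed.

Definition lit (i j : Z) : Z :=
  A (i * N + k) * b2z (cnt (X i k) N <? tau + 1) * hit (X i k) j.

Lemma lit_range i j : 0 <= i < N -> 0 <= j < N -> 0 <= lit i j <= 1.
Proof.
  intros Hi Hj. unfold lit. destruct (HA (i * N + k) ltac:(nia)) as [-> | ->];
    pose proof (hit_range (X i k) j Hj); destruct (_ <? _); cbn [b2z]; lia.
Qed.

Lemma light_ok (Q : heap -> Z -> Prop) h t E : h WT = W -> h ADJ = A ->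
  (forall v, relv v -> h FRQ v = cnt v N) -> lstm N (h LST) ->
  (forall i j, 0 <= i < N -> 0 <= j < N -> h EQP (i * N + j) = E i j /\ 0 <= E i j <= N) ->
  (forall h' t', (forall k', k' <> EQP -> h' k' = h k') ->
    (forall i j, 0 <= i < N -> 0 <= j < N -> h' EQP (i * N + j) = E i j + lit i j) ->
    t' <= t + N * (100 * tau + 200) + 100 -> Q h' t') ->
  WP light_cmd Q env h t.
Proof.
  intros EW EA HF Hl HE HQ. unfold light_cmd.
  apply (wp_for _ _ _ _ N (fun m h' t' => (forall k', k' <> EQP -> h' k' = h k') /\
    (forall i j, 0 <= i < N -> 0 <= j < N ->
       h' EQP (i * N + j) = E i j + (if i <? m then lit i j else 0)) /\
    t' <= t + 50 + m * (100 * tau + 200))); [reflexivity|lia| | |].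
  - split; [auto|]. split; [|cs; lia]. intros i j Hi Hj.
    rewrite (proj2 (Z.ltb_ge i 0)) by lia. rewrite (proj1 (HE i j Hi Hj)). lia.
  - intros m h1 t1 Hm (F1 & F2 & F3). cbn [app].
    set (v := X m k). assert (Hv : relv v) by (exists m; auto).
    pose proof (cnt_range v N ltac:(lia)) as Hcr.
    wlet v; [rewrite F1, EW by discriminate; reflexivity|apply X_bound; auto|].
    assert (Hstep : forall i j, 0 <= i < N -> 0 <= j < N ->
      (if i <? m + 1 then lit i j else 0) = (if i <? m then lit i j else 0) +
         b2z (i =? m) * lit m j).
    { intros i j Hi Hj. destruct (Z.ltb_spec i m), (Z.ltb_spec i (m + 1)),
        (Z.eqb_spec i m); subst; cbn [b2z]; try lia. }
    apply wp_if; evs; rewrite !F1, EA, HF by (auto; discriminate); intros Hc.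
    + destruct (Z.ltb_spec (cnt v N) (tau + 1)) as [Hlt|]; [|lia].
      assert (HA1 : A (m * N + k) = 1) by (destruct (HA (m * N + k) ltac:(nia)); lia).
      destruct (Hl v Hv) as [G1 G2].
      apply (wp_for _ _ _ _ (cnt v N) (fun p h' t' => (forall k', k' <> EQP -> h' k' = h k') /\
        (forall i j, 0 <= i < N -> 0 <= j < N ->
          h' EQP (i * N + j) = h1 EQP (i * N + j) +
            b2z (i =? m) * zs p (fun p => b2z (h LST (v * N + p) =? j))) /\
        t' <= t1 + 110 + p * 100)).
      * evs. rewrite F1, HF by (auto; discriminate). reflexivity.
      * lia.
      * split; [auto|]. split; [|cs; lia]. intros. rewrite zs_0. lia.
      * intros p h2 t2 Hp (J1 & J2 & J3). cbn [app].
        specialize (G2 p Hp). set (j0 := h LST (v * N + p)) in *.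
        wlet (m * N + j0); [rewrite J1 by discriminate; reflexivity|nia|].
        wsto (m * N + j0) (h2 EQP (m * N + j0) + 1); [reflexivity|reflexivity| |].
        { rewrite J2, F2 by lia. pose proof (HE m j0 ltac:(lia) ltac:(lia)) as [_ HE'].
          rewrite (proj2 (Z.ltb_ge m m)) by lia. rewrite Z.eqb_refl. cbn [b2z].
          assert (Hz : Z.abs (zs p (fun p => b2z (h LST (v * N + p) =? j0))) <= p * 1).
          { apply zs_abs; [lia|]. intros p' _. destruct (_ =? _); cbn; lia. }
          lia. }
        split; [|split].
        -- intros. rewrite updh_arr; auto.
        -- intros i j Hi Hj. rewrite updh_at, zs_succ by lia. fold j0.
           destruct (Z.eqb_spec (i * N + j) (m * N + j0)) as [Heq|Hne].
           ++ destruct (dm_inj _ _ _ _ N Hj G2 Heq) as [-> ->]. rewrite J2 by lia.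
              rewrite !Z.eqb_refl. cbn [b2z]. lia.
           ++ rewrite J2 by lia. destruct (Z.eqb_spec i m) as [->|]; cbn [b2z]; [|lia].
              rewrite (proj2 (Z.eqb_neq j0 j)); [cbn [b2z]; lia|]. intros ->. lia.
        -- lia.
      * intros h2 t2 (J1 & J2 & J3). split; [|split].
        -- intros. rewrite J1; auto.
        -- intros i j Hi Hj. rewrite Hstep, J2, F2 by auto.
           (* The list property with the indicator of [j] as test function turns the number of
              increments at [j] into [hit v j]. *)
           rewrite (G1 (fun x => b2z (x =? j))).
           rewrite (zs_ext _ _ (fun j' => b2z (j' =? j) * hit v j')) by (intros; lia).
           rewrite zs_delta by auto. unfold lit at 3. rewrite HA1. fold v.
           rewrite (proj2 (Z.ltb_lt _ _) Hlt). cbn [b2z]. lia.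
        -- nia.
    + cbn [wp]. split; [auto|]. split; [|cs; nia].
      intros i j Hi Hj. rewrite Hstep, F2 by auto. unfold lit at 3. fold v.
      destruct (Z.ltb_spec (cnt v N) (tau + 1)); cbn [b2z]; [|lia].
      replace (A (m * N + k)) with 0 by lia. lia.
  - intros h' t' (F1 & F2 & F3). apply HQ; auto; [|nia].
    intros i j Hi Hj. rewrite F2, (proj2 (Z.ltb_lt i N)) by lia. reflexivity.
Qed.

Lemma eqk_ok (Q : heap -> Z -> Prop) h t E : h WT = W -> h ADJ = A ->
  (forall i j, 0 <= i < N -> 0 <= j < N -> h EQP (i * N + j) = E i j /\ 0 <= E i j <= N) ->
  (forall h' t', (forall k', ~ In k' [EQP; FRQ; LST; TMP; HVY; HCN] -> h' k' = h k') ->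
    (forall i j, 0 <= i < N -> 0 <= j < N -> h' EQP (i * N + j) = E i j + lit i j) ->
    colm N (h' HCN k) (fun s => h' HVY (s * N + k)) ->
    (forall s k', 0 <= k' < N -> k' <> k -> h' HVY (s * N + k') = h HVY (s * N + k')) ->
    (forall k', k' <> k -> h' HCN k' = h HCN k') ->
    t' <= t + N * (100 * tau + 1100) -> Q h' t') ->
  WP eqk_cmd Q env h t.
Proof.
  intros EW EA HE HQ. unfold eqk_cmd.
  wseq. apply reset_ok; auto. intros h1 t1 F1 F2 F3.
  wseq. wsto 1 0; [reflexivity|reflexivity|lia|].
  wseq. apply count_ok.
  { rewrite updh_arr, F1 by discriminate. auto. }
  { rewrite updh_arr, F1 by discriminate. auto. }
  { intros v Hv. rewrite updh_arr by discriminate. auto. }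
  { apply updh_same. }
  intros h2 t2 G1 G2 G3 G4 G5 G6.
  pose proof (colm_le N _ _ ltac:(lia) G4) as Hcle.
  assert (HcN : 0 <= h2 TMP 1 <= N) by (destruct G4; nia).
  wseq. wsto k (h2 TMP 1); [reflexivity|reflexivity|lia|].
  set (h3 := updh h2 HCN k (h2 TMP 1)).
  assert (E3 : forall k', ~ In k' [FRQ; LST; TMP; HVY; HCN] -> h3 k' = h k').
  { intros k' Hin. cbn [In] in Hin. unfold h3. rewrite updh_arr by lia.
    rewrite G1 by lia. rewrite updh_arr by lia. apply F1; lia. }
  apply (light_ok _ _ _ E).
  { rewrite E3; auto. cbn [In]. lia. }
  { rewrite E3; auto. cbn [In]. lia. }
  { intros v Hv. unfold h3. rewrite updh_arr by discriminate. auto. }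
  { unfold h3. rewrite updh_arr by discriminate. auto. }
  { rewrite E3; auto. cbn [In]. lia. }
  intros h4 t4 J1 J2 J3. apply HQ.
  - intros k' Hin. cbn [In] in Hin. rewrite J1, E3; auto; cbn [In]; lia.
  - auto.
  - rewrite !J1 by discriminate. unfold h3. rewrite updh_same, updh_arr by discriminate. auto.
  - intros s k' Hk' Hne. rewrite J1 by discriminate. unfold h3. rewrite updh_arr by discriminate.
    rewrite G5 by auto. rewrite updh_arr, F1 by discriminate. auto.
  - intros k' Hne. rewrite J1 by discriminate. unfold h3. rewrite updh_idx by auto.
    rewrite G1 by discriminate. rewrite updh_arr, F1 by discriminate. auto.
  - lia.
Qed.

End Fixed_k.

Definition mav (hc hv : Z -> Z) (s i k : Z) : Z :=
  A (i * N + k) * b2z (s <? hc k) * b2z (X i k =? hv (s * N + k)).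
Definition mbv (hc hv : Z -> Z) (s k j : Z) : Z :=
  A (k * N + j) * b2z (s <? hc k) * b2z (- X j k =? hv (s * N + k)).

Lemma mav_abs hc hv s i k : 0 <= i < N -> 0 <= k < N -> Z.abs (mav hc hv s i k) <= 1.
Proof.
  intros Hi Hk. unfold mav. destruct (HA (i * N + k) ltac:(nia)) as [-> | ->];
    destruct (s <? _), (X i k =? _); cbn; lia.
Qed.

Lemma mbv_abs hc hv s k j : 0 <= k < N -> 0 <= j < N -> Z.abs (mbv hc hv s k j) <= 1.
Proof.
  intros Hi Hk. unfold mbv. destruct (HA (k * N + j) ltac:(nia)) as [-> | ->];
    destruct (s <? _), (- X j k =? _); cbn; lia.
Qed.

(** If [X i k] is infrequent, no listed value equals it and [lit] supplies the term. If it is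
    frequent, [lit] vanishes and exactly one [s < D] lists it. *)
Lemma heavy_sum hc hv i k j : 0 <= i < N -> 0 <= k < N -> 0 <= j < N ->
  colm k N (hc k) (fun s => hv (s * N + k)) ->
  lit k i j + zs D (fun s => mav hc hv s i k * mbv hc hv s k j) =
  A (i * N + k) * A (k * N + j) * b2z (X i k =? - X j k).
Proof.
  intros Hi Hk Hj Hcol. pose proof (colm_le k Hk N _ _ ltac:(lia) Hcol) as Hle.
  destruct Hcol as (C0 & C1 & C2 & C3).
  assert (HcD : hc k <= D) by nia.
  assert (Hr : relv k (X i k)) by (exists i; auto).
  unfold lit. destruct (Z.ltb_spec (cnt k (X i k) N) (tau + 1)) as [Hlt|Hge]; cbn [b2z].
  - rewrite zs_zero.
    + unfold hit. rewrite (Z.eqb_sym (- X j k)). lia.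
    + intros s Hs. unfold mav. destruct (Z.ltb_spec s (hc k)); cbn [b2z]; [|lia].
      destruct (Z.eqb_spec (X i k) (hv (s * N + k))) as [E|E]; cbn [b2z]; [|lia].
      destruct (C2 s ltac:(lia)) as [_ C]. cbn beta in C. rewrite <- E in C. lia.
  - destruct (C3 (X i k) Hr ltac:(lia)) as (s0 & Hs0 & Es0). cbn beta in Es0.
    rewrite (zs_ext _ _ (fun s => b2z (s =? s0) *
      (A (i * N + k) * A (k * N + j) * b2z (X i k =? - X j k)))).
    + rewrite zs_delta by lia. lia.
    + intros s Hs. unfold mav, mbv. destruct (Z.eqb_spec s s0) as [->|Hne]; cbn [b2z].
      * rewrite (proj2 (Z.ltb_lt s0 (hc k))) by lia. rewrite Es0, Z.eqb_refl.
        rewrite (Z.eqb_sym (- X j k)). cbn [b2z]. lia.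
      * destruct (Z.ltb_spec s (hc k)); cbn [b2z]; [|lia].
        destruct (Z.eqb_spec (X i k) (hv (s * N + k))) as [E|E]; cbn [b2z]; [|lia].
        exfalso. apply Hne. apply C1; auto; lia.
Qed.

Definition eqp (i j : Z) : Z :=
  zs N (fun k => A (i * N + k) * A (k * N + j) * b2z (X i k =? - X j k)).

Lemma heavy_ok (Q : heap -> Z -> Prop) h t s : h WT = W -> h ADJ = A -> tables L h ->
  (forall i j, 0 <= i < N -> 0 <= j < N -> 0 <= Z.abs (h EQP (i * N + j)) <= N * N + N) ->
  (forall h' t', (forall k', ~ In k' [EQP; MA; MB; MC] -> h' k' = h k') ->
    (forall i j, 0 <= i < N -> 0 <= j < N -> h' EQP (i * N + j) = h EQP (i * N + j) +
       zs N (fun k => mav (h HCN) (h HVY) s i k * mbv (h HCN) (h HVY) s k j)) ->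
    t' <= t + 3000 * (L + 1) * V -> Q h' t') ->
  WP heavy_cmd Q [g0; g1; g2; L; V; g5; N; tau; D; g9; N2; g11; g12; g13; g14; g15; g16; k0; s; D] h t.
Proof.
  intros EW EA Htab HE HQ. unfold heavy_cmd.
  assert (HN2V : N * N <= V).
  { pose proof (pow_level L 0 ltac:(lia)) as Hp. rewrite Z.sub_0_r, <- HN, <- HV in Hp. lia. }
  assert (HYN2 : N * N <= Y) by nia.
  wseq. apply (wp_map _ _ _ _ (N * N) MA (fun e => e)
    (fun e => mav (h HCN) (h HVY) s (e / N) (e mod N)) 150); [evs; auto|lia|lia|auto| |].
  { intros e h1 t1 He F1 F2. cbn [app].
    destruct (dm_range e N N He HN0) as (D1 & D2 & D3).
    wsto e (mav (h HCN) (h HVY) s (e / N) (e mod N)).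
    - reflexivity.
    - rewrite !F1, EW, EA by discriminate. unfold mav, X. rewrite <- D3. reflexivity.
    - pose proof (mav_abs (h HCN) (h HVY) s (e / N) (e mod N) D1 D2). lia.
    - split; [|split; [|split]].
      + intros; apply updh_arr; auto.
      + apply updh_same.
      + intros; apply updh_idx; auto.
      + lia. }
  intros h1 t1 F1 F2 _ F4. cbn beta in F2.
  wseq. apply (wp_map _ _ _ _ (N * N) MB (fun e => e)
    (fun e => mbv (h HCN) (h HVY) s (e / N) (e mod N)) 150); [evs; auto|lia|lia|auto| |].
  { intros e h2 t2 He G1 G2. cbn [app].
    destruct (dm_range e N N He HN0) as (D1 & D2 & D3).
    wsto e (mbv (h HCN) (h HVY) s (e / N) (e mod N)).
    - reflexivity.
    - rewrite !G1, !F1, EW, EA by discriminate. unfold mbv, X. rewrite <- D3.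
      rewrite Z.opp_sub_distr, Z.add_opp_l. reflexivity.
    - pose proof (mbv_abs (h HCN) (h HVY) s (e / N) (e mod N) D1 D2). lia.
    - split; [|split; [|split]].
      + intros; apply updh_arr; auto.
      + apply updh_same.
      + intros; apply updh_idx; auto.
      + lia. }
  intros h2 t2 G1 G2 _ G4. cbn beta in G2.
  assert (EMA : forall i k, 0 <= i < N -> 0 <= k < N ->
     h2 MA (i * N + k) = mav (h HCN) (h HVY) s i k).
  { intros i k Hi Hk. rewrite G1, F2 by (discriminate || nia). now rewrite dm_div, dm_mod. }
  assert (EMB : forall k j, 0 <= k < N -> 0 <= j < N ->
     h2 MB (k * N + j) = mbv (h HCN) (h HVY) s k j).
  { intros k j Hi Hk. rewrite G2 by nia. now rewrite dm_div, dm_mod. }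
  wseq. apply (mm_ok _ _ _ _ _ _ _ L V _ N); auto.
  { intros x Hx. rewrite !G1, !F1 by discriminate. apply Htab; auto. }
  { intros e He. destruct (dm_range e N N He HN0) as (D1 & D2 & D3). rewrite D3, EMA by auto.
    apply mav_abs; auto. }
  { intros e He. destruct (dm_range e N N He HN0) as (D1 & D2 & D3). rewrite D3, EMB by auto.
    apply mbv_abs; auto. }
  intros h3 t3 K1 K2 K3.
  assert (EMC : forall i j, 0 <= i < N -> 0 <= j < N -> h3 MC (i * N + j) =
    zs N (fun k => mav (h HCN) (h HVY) s i k * mbv (h HCN) (h HVY) s k j)).
  { intros i j Hi Hj. rewrite K2 by auto. apply zs_ext. intros k Hk. now rewrite EMA, EMB. }
  assert (EQ3 : h3 EQP = h EQP) by (rewrite K1, G1, F1 by discriminate; auto).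
  apply (wp_map _ _ _ _ (N * N) EQP (fun e => e) (fun e => h EQP e + h3 MC e) 100);
    [evs; auto|lia|lia|auto| |].
  { intros e h4 t4 He J1 J2. cbn [app].
    destruct (dm_range e N N He HN0) as (D1 & D2 & D3).
    wsto e (h EQP e + h3 MC e).
    - reflexivity.
    - rewrite (J1 MC) by discriminate. rewrite J2, EQ3 by (intros; lia). reflexivity.
    - rewrite D3, EMC by auto. pose proof (HE _ _ D1 D2) as He'.
      assert (Hz : Z.abs (zs N (fun k => mav (h HCN) (h HVY) s (e / N) k *
         mbv (h HCN) (h HVY) s k (e mod N))) <= N * 1).
      { apply zs_abs; [lia|]. intros k Hk.
        pose proof (mav_abs (h HCN) (h HVY) s (e / N) k D1 Hk).
        pose proof (mbv_abs (h HCN) (h HVY) s k (e mod N) Hk D2).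
        rewrite Z.abs_mul. nia. }
      nia.
    - split; [|split; [|split]].
      + intros; apply updh_arr; auto.
      + apply updh_same.
      + intros; apply updh_idx; auto.
      + lia. }
  intros h4 t4 J1 J2 _ J4. cbn beta in J2. apply HQ.
  - intros k' Hin. cbn [In] in Hin. rewrite J1, K1, G1, F1 by lia. auto.
  - intros i j Hi Hj. rewrite J2, EMC by (auto; nia). reflexivity.
  - revert F4 G4 J4. cs. nia.
Qed.

Lemma eq_ok (Q : heap -> Z -> Prop) h t : h WT = W -> h ADJ = A -> tables L h ->
  (forall h' t', (forall k', ~ In k' [EQP; FRQ; LST; TMP; HVY; HCN; MA; MB; MC] -> h' k' = h k') ->
    (forall i j, 0 <= i < N -> 0 <= j < N -> h' EQP (i * N + j) = eqp i j) ->
    t' <= t + N * N * (100 * tau + 1300) + 3010 * D * (L + 1) * V -> Q h' t') ->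
  WP eq_cmd Q genv h t.
Proof.
  intros EW EA Htab HQ. unfold eq_cmd.
  assert (HVp : 0 < V) by (rewrite HV; apply Z.pow_pos_nonneg; lia).
  assert (HYN2 : N * N <= Y) by nia.
  assert (HD0 : 0 < D) by nia. assert (HDN : D <= N) by nia.
  wseq. apply (wp_map _ _ _ _ (N * N) EQP (fun e => e) (fun e => 0) 30);
    [evs; auto|lia|lia|auto| |].
  { intros e h4 t4 He J1 J2. cbn [app]. wsto e 0; [reflexivity|reflexivity|lia|].
    split; [|split; [|split]].
    - intros; apply updh_arr; auto.
    - apply updh_same.
    - intros; apply updh_idx; auto.
    - lia. }
  intros h0 t0 F1 F2 _ F4. cbn beta in F2.
  wseq. apply (wp_for _ _ _ _ N (fun m h' t' =>
    (forall k', ~ In k' [EQP; FRQ; LST; TMP; HVY; HCN] -> h' k' = h k') /\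
    (forall i j, 0 <= i < N -> 0 <= j < N -> h' EQP (i * N + j) = zs m (fun k => lit k i j)) /\
    (forall k, 0 <= k < m -> colm k N (h' HCN k) (fun s => h' HVY (s * N + k))) /\
    t' <= t0 + 20 + m * (N * (100 * tau + 1110)))); [reflexivity|lia| | |].
  { split; [|split; [|split]].
    - intros k' Hin. cbn [In] in Hin. apply F1. lia.
    - intros. rewrite F2 by nia. now rewrite zs_0.
    - intros; lia.
    - cs. lia. }
  { intros k h1 t1 Hk (G1 & G2 & G3 & G4). cbn [app].
    apply (eqk_ok k Hk _ _ _ (fun i j => zs k (fun k => lit k i j))).
    - rewrite G1; auto. cbn [In]; lia.
    - rewrite G1; auto. cbn [In]; lia.
    - intros i j Hi Hj. split; [auto|].
      assert (0 <= zs k (fun k => lit k i j) <= k * 1); [|lia]. split.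
      + apply zs_nonneg. intros; apply lit_range; lia.
      + rewrite <- zs_const by lia. apply zs_le. intros; apply lit_range; lia.
    - intros h2 t2 K1 K2 K3 K4 K5 K6. split; [|split; [|split]].
      + intros k' Hin. rewrite K1, G1; auto.
      + intros i j Hi Hj. rewrite K2, zs_succ by lia. reflexivity.
      + intros k' Hk'. destruct (Z.eq_dec k' k) as [->|Hne]; [exact K3|].
        specialize (G3 k' ltac:(lia)). destruct G3 as (C0 & C1 & C2 & C3).
        rewrite K5 by auto. split; [auto|]. split; [|split].
        * intros s s' Hs Hs'. rewrite !K4 by lia. apply C1; auto.
        * intros s Hs. rewrite !K4 by lia. apply C2; auto.
        * intros v Hv Hc. destruct (C3 v Hv Hc) as (s & Hs & Es). exists s.
          rewrite K4 by lia. auto.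
      + nia. }
  intros h1 t1 (G1 & G2 & G3 & G4).
  set (mm := fun s i j => zs N (fun k => mav (h1 HCN) (h1 HVY) s i k * mbv (h1 HCN) (h1 HVY) s k j)).
  assert (Hmm : forall s i j, 0 <= i < N -> 0 <= j < N -> Z.abs (mm s i j) <= N * 1).
  { intros s i j Hi Hj. apply zs_abs; [lia|]. intros k Hk.
    pose proof (mav_abs (h1 HCN) (h1 HVY) s i k Hi Hk).
    pose proof (mbv_abs (h1 HCN) (h1 HVY) s k j Hk Hj).
    rewrite Z.abs_mul. nia. }
  apply (wp_for _ _ _ _ D (fun m h' t' =>
    (forall k', ~ In k' [EQP; MA; MB; MC] -> h' k' = h1 k') /\
    (forall i j, 0 <= i < N -> 0 <= j < N -> h' EQP (i * N + j) =
       h1 EQP (i * N + j) + zs m (fun s => mm s i j)) /\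
    t' <= t1 + 20 + m * (3006 * (L + 1) * V))); [reflexivity|lia| | |].
  { split; [auto|]. split; [|cs; lia]. intros. rewrite zs_0. lia. }
  { intros s h2 t2 Hs (K1 & K2 & K3). cbn [app].
    apply heavy_ok.
    - rewrite K1, G1; auto; cbn [In]; lia.
    - rewrite K1, G1; auto; cbn [In]; lia.
    - intros x Hx. rewrite !K1, !G1 by (cbn [In]; lia). apply Htab; auto.
    - intros i j Hi Hj. rewrite K2, G2 by auto.
      assert (0 <= zs N (fun k => lit k i j) <= N * 1).
      { split.
        + apply zs_nonneg. intros; apply lit_range; lia.
        + rewrite <- zs_const by lia. apply zs_le. intros; apply lit_range; lia. }
      assert (Z.abs (zs s (fun s => mm s i j)) <= s * (N * 1)).
      { apply zs_abs; [lia|]. intros; apply Hmm; auto. }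
      nia.
    - intros h3 t3 M1 M2 M3. split; [|split].
      + intros k' Hin. rewrite M1, K1; auto.
      + intros i j Hi Hj. rewrite M2, K2, zs_succ by lia.
        rewrite !K1 by (cbn [In]; lia). unfold mm at 3. lia.
      + nia. }
  intros h2 t2 (K1 & K2 & K3). apply HQ.
  - intros k' Hin. cbn [In] in Hin. rewrite K1, G1; auto; cbn [In]; lia.
  - intros i j Hi Hj. rewrite K2, G2 by auto. unfold mm, eqp. rewrite zs_exchange, <- zs_add.
    apply zs_ext. intros k Hk. apply heavy_sum; auto.
  - revert F4. cs. nia.
Qed.

End EqProd.

(** * Oracle calls *)

Definition vmap (x : nat) : exp :=
  (EV x /! EV 2 =! EC 0) *! EV 20 +! (EV x /! EV 2 =! EC 1) *! EV 21
  +! (EV x /! EV 2 =! EC 2) *! EV 22 +! EV x %! EV 2.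

(** An instance on [3 * b] vertices has [18 * BB] input cells, adjacency at even and weight at odd
    positions. The leading factor removes all edges inside a part. *)
Definition fill_cmd : cmd :=
  For (EC 18 *! EV 12)
   (Let (EV 23 /! EC 2 /! (EC 3 *! EV 2))
   (Let ((EV 23 /! EC 2) %! (EC 3 *! EV 2))
   (Let (vmap 25)
   (Let (vmap 26)
   (Sto ORC ((EC 2 +! EV 23) *! EV 11 +! EV 17)
     ((EC 1 -! (EV 25 /! EV 2 =! EV 26 /! EV 2)) *!
      ((EC 1 -! EV 23 %! EC 2) *! EL ADJ (EV 27 *! EV 6 +! EV 28) +!
       EV 23 %! EC 2 *! EL WT (EV 27 *! EV 6 +! EV 28)))))))).

(** Only answers for pairs between the first and the second part are read. The factor [ADJ] masks
    the others, since the oracle output is specified on edges only. *)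
Definition read_cmd : cmd :=
  For (EV 12)
   (Sto FLG (EV 15 *! EV 12 +! EV 23)
     (EL ADJ ((EV 20 +! EV 23 /! EV 2) *! EV 6 +! (EV 21 +! EV 23 %! EV 2)) *!
      EL ORC ((EC 2 +! EC 18 *! EV 12 +! (EV 23 /! EV 2 *! (EC 3 *! EV 2) +! (EV 2 +! EV 23 %! EV 2)))
              *! EV 11 +! EV 17))).

Definition call_cmd : cmd :=
  Let (EV 13 *! EV 5 *! EV 5 +! EV 15)
  (Let (EC (-128) *! EV 11)
  (Let (EC 64 -! EC 128 *! (EV 17 +! EC 1))
  (Let (EV 15 /! EV 5 *! EV 2)
  (Let (EV 15 %! EV 5 *! EV 2)
  (Let (EV 13 *! EV 2)
  (Sto ORC (EV 17) (EC 3 *! EV 2) ;; Sto ORC (EV 11 +! EV 17) (EV 1) ;;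
   fill_cmd ;; Orc 18 19 ;; read_cmd)))))).

Definition flags_cmd : cmd := For (EV 5 *! EV 5) call_cmd.

(** * Correctness of the oracle calls *)

Section Flags.
Variables (P : program) (w0 : nat) (Y Bm : Z).
Notation WP := (wp P w0 Y Bm).
Variables (n t : Z) (bn : nat).
Let b := Z.of_nat bn.
Variables (L V NB N tau D H N2 S BB G : Z).
Notation genv := [n; t; b; L; V; NB; N; tau; D; H; N2; S; BB; G; NB].
Hypothesis Hb : 0 < b.
Hypothesis HNB : 0 < NB.
Hypothesis HN : N = b * NB.
Hypothesis HBB : BB = b * b.
Hypothesis HG : 0 <= G < NB.
Hypothesis HYN : 8 * N * N * N <= Y.
Hypothesis HYB : 20 * BB <= Y.
Hypothesis HS : NB * NB * NB < S.
Hypothesis HSY : 256 * S <= Y.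
Hypothesis HBS : (Bm + 2) * S <= Y.

Variables (A W : Z -> Z) (Wm : Z) (K : nat) (Tm : Z).
Hypothesis HA : forall e, 0 <= e < N * N -> A e = 0 \/ A e = 1.
Hypothesis HW : forall e, 0 <= e < N * N -> Z.abs (W e) <= Wm.
Hypothesis HW0 : forall e, 0 <= e < N * N -> A e = 0 -> W e = 0.
Hypothesis HAs : forall i j, 0 <= i < N -> 0 <= j < N -> A (i * N + j) = A (j * N + i).
Hypothesis HWs : forall i j, 0 <= i < N -> 0 <= j < N -> W (i * N + j) = W (j * N + i).
Hypothesis HWm : Wm <= Z.of_nat ((3 * bn) ^ K).
Hypothesis Ht : Z.abs t <= Z.of_nat ((3 * bn) ^ K).
Hypothesis HBm : 3 * b <= Bm /\ Z.abs t <= Bm /\ Wm <= Bm.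
Hypothesis Horc : forall adj wt, valid_instance K (3 * bn) t adj wt ->
  exists T M', exec w0 P T 0 (init_mem (3 * bn) t adj wt) = Some M' /\ Z.of_nat T <= Tm /\
    forall i j, (i < 3 * bn)%nat -> (j < 3 * bn)%nat -> adj i j = true ->
      M' (out_addr (3 * bn) i j) = detect_answer (3 * bn) t adj wt i j.

Let HNp : 0 < N.
Proof. rewrite HN. clear - Hb HNB. nia. Qed.

Let HYN1 : 8 * N <= Y.
Proof. clear - HNp HYN. nia. Qed.

Let HBBp : 0 < BB.
Proof. rewrite HBB. clear - Hb. nia. Qed.

Let HbB : b <= BB.
Proof. rewrite HBB. clear - Hb. nia. Qed.

Let HNN : NB * NB <= Y.
Proof.
  clear - HS HSY HNB. assert (NB * NB * 1 <= NB * NB * NB) by (apply Z.mul_le_mono_nonneg_l; nia). lia.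
Qed.

Let HBmY : Bm <= Y.
Proof.
  destruct HBm as [H1 _]. assert (0 < NB * NB * NB) by (clear - HNB; nia).
  clear - HBS H1 HS Hb H0. apply Z.le_trans with ((Bm + 2) * 1); [lia|].
  etransitivity; [apply Z.mul_le_mono_nonneg_l; [lia|]|exact HBS]. lia.
Qed.

Definition clo (i j k : Z) : Z :=
  A (i * N + k) * A (j * N + k) * b2z (W (i * N + j) + W (i * N + k) + W (j * N + k) =? t).

Definition gcount (g i j : Z) : Z := zs b (fun k => clo i j (g * b + k)).

Definition flag (g i j : Z) : Z := A (i * N + j) * b2z (0 <? gcount g i j).

Section One_call.
Variable c : Z.
Hypothesis Hc : 0 <= c < NB * NB.
Let i0 := c / NB * b.
Let j0 := c mod NB * b.
Let k0 := G * b.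

(* The oracle instance is tripartite on two blocks of endpoints and one group of third
   vertices, each of size [b]; [vm] maps its vertices to those of the input graph. *)
Definition vm (u : Z) : Z :=
  (if u / b =? 0 then 1 else 0) * i0 + (if u / b =? 1 then 1 else 0) * j0
  + (if u / b =? 2 then 1 else 0) * k0 + u mod b.

(** Without edges inside a part, a triangle on an edge between parts 0 and 1 has its third vertex in
    part 2. This also holds when several parts are copies of the same block of vertices. *)
Definition oadj (u v : nat) : bool :=
  negb (Z.of_nat u / b =? Z.of_nat v / b) &&
  (A (vm (Z.of_nat u) * N + vm (Z.of_nat v)) =? 1).
Definition owt (u v : nat) : Z := W (vm (Z.of_nat u) * N + vm (Z.of_nat v)).

Lemma blk_range g x : 0 <= g < NB -> 0 <= x < b -> 0 <= g * b + x < N.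
Proof. intros. rewrite HN. pose proof (dm_lt g x NB b). lia. Qed.

Lemma vm_part p x : 0 <= p < 3 -> 0 <= x < b ->
  vm (p * b + x) = (if p =? 0 then i0 else if p =? 1 then j0 else k0) + x.
Proof.
  intros Hp Hx. unfold vm. rewrite dm_div, dm_mod by lia.
  assert (p = 0 \/ p = 1 \/ p = 2) as [-> | [-> | ->]] by lia; cbn [Z.eqb Pos.eqb]; lia.
Qed.

Lemma vm_range u : 0 <= u < 3 * b -> 0 <= vm u < N.
Proof.
  intros Hu. destruct (dm_range u 3 b Hu Hb) as (H1 & H2 & H3).
  rewrite H3, vm_part by auto.
  destruct (dm_range c NB NB Hc HNB) as (C1 & C2 & C3).
  destruct (_ =? 0); [apply blk_range; auto|]. destruct (_ =? 1); apply blk_range; auto.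
Qed.

Lemma inst_valid : valid_instance K (3 * bn) t oadj owt.
Proof.
  assert (HR : forall i, (i < 3 * bn)%nat -> 0 <= vm (Z.of_nat i) < N)
    by (intros; apply vm_range; lia).
  split; [|split; [|split; [|split]]]; auto.
  - intros i j Hi Hj. unfold oadj. rewrite (Z.eqb_sym (Z.of_nat j / b)).
    rewrite (HAs (vm (Z.of_nat j))) by auto. reflexivity.
  - intros i Hi. unfold oadj. now rewrite Z.eqb_refl.
  - intros i j Hi Hj. unfold owt. apply HWs; auto.
  - intros i j Hi Hj _. unfold owt. pose proof (HW _ (dm_lt _ _ _ _ (HR i Hi) (HR j Hj))). lia.
Qed.

Lemma detect_spec x y : 0 <= x < b -> 0 <= y < b ->
  oadj (Z.to_nat x) (Z.to_nat (b + y)) = (A ((i0 + x) * N + (j0 + y)) =? 1) /\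
  detect_answer (3 * bn) t oadj owt (Z.to_nat x) (Z.to_nat (b + y)) =
  b2z (0 <? gcount G (i0 + x) (j0 + y)).
Proof.
  intros Hx Hy.
  assert (E1 : vm (Z.of_nat (Z.to_nat x)) = i0 + x).
  { rewrite Z2Nat.id by lia. replace x with (0 * b + x) at 1 by lia. now rewrite vm_part by lia. }
  assert (E2 : vm (Z.of_nat (Z.to_nat (b + y))) = j0 + y).
  { rewrite Z2Nat.id by lia. replace (b + y) with (1 * b + y) by lia. now rewrite vm_part by lia. }
  assert (D1 : Z.of_nat (Z.to_nat x) / b = 0) by (rewrite Z2Nat.id by lia; apply Z.div_small; lia).
  assert (D2 : Z.of_nat (Z.to_nat (b + y)) / b = 1).
  { rewrite Z2Nat.id by lia. replace (b + y) with (1 * b + y) by lia. now rewrite dm_div by lia. }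
  destruct (dm_range c NB NB Hc HNB) as (C1 & C2 & C3).
  pose proof (blk_range _ _ C1 Hx) as Ri. pose proof (blk_range _ _ C2 Hy) as Rj.
  fold i0 in Ri. fold j0 in Rj.
  split.
  { unfold oadj. rewrite E1, E2, D1, D2. reflexivity. }
  assert (Hclo : forall k, 0 <= k < b ->
    closes (3 * bn) t oadj owt (Z.to_nat x) (Z.to_nat (b + y)) (Z.to_nat (2 * b + k)) =
    (clo (i0 + x) (j0 + y) (G * b + k) =? 1)).
  { intros k Hk. unfold closes, oadj, owt.
    assert (E3 : vm (Z.of_nat (Z.to_nat (2 * b + k))) = G * b + k).
    { rewrite Z2Nat.id by lia. now rewrite vm_part by lia. }
    assert (D3 : Z.of_nat (Z.to_nat (2 * b + k)) / b = 2).
    { rewrite Z2Nat.id by lia. now rewrite dm_div by lia. }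
    rewrite E1, E2, E3, D1, D2, D3. cbn [Z.eqb Pos.eqb negb andb]. unfold clo.
    pose proof (blk_range _ _ HG Hk) as Rk.
    destruct (HA _ (dm_lt _ _ _ _ Ri Rk)) as [-> | ->]; [reflexivity|].
    destruct (HA _ (dm_lt _ _ _ _ Rj Rk)) as [-> | ->]; [reflexivity|].
    destruct (_ =? t); reflexivity. }
  assert (Hclr : forall k, 0 <= k < b -> 0 <= clo (i0 + x) (j0 + y) (G * b + k) <= 1).
  { intros k Hk. pose proof (blk_range _ _ HG Hk) as Rk. unfold clo.
    destruct (HA _ (dm_lt _ _ _ _ Ri Rk)) as [-> | ->];
    destruct (HA _ (dm_lt _ _ _ _ Rj Rk)) as [-> | ->];
    destruct (_ =? t); cbn; lia. }
  unfold detect_answer.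
  destruct (existsb _ _) eqn:Hex.
  - apply existsb_exists in Hex. destruct Hex as (k & Hk & Hcl). apply in_seq in Hk.
    destruct (dm_range (Z.of_nat k) 3 b ltac:(lia) Hb) as (K1 & K2 & K3).
    assert (Hp : Z.of_nat k / b = 2).
    { unfold closes, oadj in Hcl. rewrite D1, D2 in Hcl.
      apply andb_true_iff in Hcl. destruct Hcl as [Hcl _].
      apply andb_true_iff in Hcl. destruct Hcl as [Q1 Q2].
      apply andb_true_iff in Q1. apply andb_true_iff in Q2. destruct Q1 as [Q1 _], Q2 as [Q2 _].
      apply negb_true_iff, Z.eqb_neq in Q1. apply negb_true_iff, Z.eqb_neq in Q2. lia. }
    rewrite Hp in K3.
    assert (Ek : k = Z.to_nat (2 * b + Z.of_nat k mod b)) by lia.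
    rewrite Ek, Hclo in Hcl by auto. apply Z.eqb_eq in Hcl.
    rewrite (proj2 (Z.ltb_lt 0 _)); [reflexivity|]. unfold gcount.
    assert (Hd : zs b (fun k' => b2z (k' =? Z.of_nat k mod b) * 1) <=
       zs b (fun k' => clo (i0 + x) (j0 + y) (G * b + k'))).
    { apply zs_le. intros k' Hk'. destruct (Z.eqb_spec k' (Z.of_nat k mod b)) as [->|]; cbn [b2z].
      - lia.
      - specialize (Hclr k' Hk'). lia. }
    rewrite zs_delta in Hd by auto. lia.
  - rewrite (proj2 (Z.ltb_ge 0 _)); [reflexivity|]. unfold gcount.
    rewrite zs_zero; [lia|]. intros k Hk.
    destruct (Z.eq_dec (clo (i0 + x) (j0 + y) (G * b + k)) 1) as [E|E].
    + exfalso. assert (Hin : In (Z.to_nat (2 * b + k)) (seq 0 (3 * bn))) by (apply in_seq; lia).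
      assert (Hall := existsb_exists (closes (3 * bn) t oadj owt (Z.to_nat x) (Z.to_nat (b + y)))
        (seq 0 (3 * bn))).
      rewrite Hex in Hall. apply (fun p => diff_false_true (proj2 Hall p)).
      exists (Z.to_nat (2 * b + k)). split; auto. rewrite Hclo by auto. now apply Z.eqb_eq.
    + specialize (Hclr k Hk). lia.
Qed.

Definition cellv (x : Z) : Z :=
  let u := x / 2 / (3 * b) in
  let v := (x / 2) mod (3 * b) in
  (1 - (if u / b =? v / b then 1 else 0)) *
  ((1 - x mod 2) * A (vm u * N + vm v) + x mod 2 * W (vm u * N + vm v)).

Lemma cell_uv x : 0 <= x < 18 * BB ->
  0 <= x / 2 / (3 * b) < 3 * b /\ 0 <= (x / 2) mod (3 * b) < 3 * b.
Proof.
  intros Hx. destruct (dm_range x (9 * BB) 2 ltac:(lia) ltac:(lia)) as (X1 & _ & _).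
  destruct (dm_range (x / 2) (3 * b) (3 * b) ltac:(nia) ltac:(lia)) as (U1 & U2 & _). auto.
Qed.

Lemma cellv_abs x : 0 <= x < 18 * BB -> Z.abs (cellv x) <= Bm.
Proof.
  intros Hx. destruct (cell_uv x Hx) as [U1 U2]. unfold cellv.
  pose proof (vm_range _ U1) as V1. pose proof (vm_range _ U2) as V2.
  set (e := vm (x / 2 / (3 * b)) * N + vm ((x / 2) mod (3 * b))).
  assert (He : 0 <= e < N * N) by (unfold e; apply dm_lt; assumption).
  pose proof (HW e He). destruct (HA e He) as [-> | ->];
    pose proof (Z.mod_pos_bound x 2 ltac:(lia));
    assert (x mod 2 = 0 \/ x mod 2 = 1) as [-> | ->] by lia; destruct (_ =? _); lia.
Qed.

(** The oracle run is specified on [init_mem] as a function on all of [Z], so agreement on the input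
    cells is not enough: negative addresses and those past the input have to be zero as well. *)
Lemma init_mem_eq (f : Z -> Z) : f 0 = 3 * b -> f 1 = t ->
  (forall x, 0 <= x < 18 * BB -> f (2 + x) = cellv x) ->
  (forall z, z < 0 \/ 2 + 18 * BB <= z -> f z = 0) ->
  f = init_mem (3 * bn) t oadj owt.
Proof.
  intros F0 F1 F2 F3. apply functional_extensionality. intros a. unfold init_mem.
  assert (E3 : Z.of_nat (3 * bn) = 3 * b) by lia. rewrite !E3.
  replace (2 * (3 * b) * (3 * b)) with (18 * BB) by (rewrite HBB; ring).
  destruct (Z.eqb_spec a 0) as [->|H0]; [auto|]. destruct (Z.eqb_spec a 1) as [->|H1]; [auto|].
  destruct (Z.leb_spec 2 a), (Z.ltb_spec a (2 + 18 * BB)); cbn [andb]; try (apply F3; lia).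
  replace a with (2 + (a - 2)) at 1 by lia. rewrite F2 by lia.
  set (x := a - 2). assert (Hx : 0 <= x < 18 * BB) by lia.
  destruct (cell_uv x Hx) as [U1 U2]. unfold cellv.
  pose proof (vm_range _ U1) as V1. pose proof (vm_range _ U2) as V2.
  unfold oadj, owt. rewrite !Z2Nat.id by lia.
  set (e := vm (x / 2 / (3 * b)) * N + vm ((x / 2) mod (3 * b))).
  assert (He : 0 <= e < N * N) by (unfold e; apply dm_lt; assumption).
  pose proof (HW0 e He) as HW0e.
  pose proof (Z.mod_pos_bound x 2 ltac:(lia)).
  assert (x mod 2 = 0 \/ x mod 2 = 1) as [-> | ->] by lia;
  destruct (HA e He) as [Ee | Ee]; rewrite Ee; destruct (_ / b =? _); cbn [negb andb Z.eqb Pos.eqb]; try lia;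
    rewrite ?HW0e by auto; lia.
Qed.

(** The memories of all calls numbered [m] or higher are zero. Here [z] ranges over all integers,
    because an oracle program may address any cell. *)
Definition fresh (h : heap) (m : Z) :=
  forall z q, m <= q < NB * NB * NB -> h ORC (z * S + q) = 0.

Lemma idx_inj z q z' q' : 0 <= q < S -> 0 <= q' < S -> z * S + q = z' * S + q' -> z = z' /\ q = q'.
Proof. apply dm_inj. Qed.

Lemma call_ok (Q : heap -> Z -> Prop) h s : h ADJ = A -> h WT = W ->
  fresh h (G * NB * NB + c) ->
  (forall h' s', (forall k, k <> ORC -> k <> FLG -> h' k = h k) ->
    (forall x, 0 <= x < BB -> h' FLG (c * BB + x) = flag G (i0 + x / b) (j0 + x mod b)) ->
    (forall y, 0 <= y < c * BB -> h' FLG y = h FLG y) ->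
    fresh h' (G * NB * NB + c + 1) ->
    s' <= s + 15000 * BB + 13 * Tm + 500 -> Q h' s') ->
  WP call_cmd Q (genv ++ [c; NB * NB]) h s.
Proof.
  intros EA EW Hfr HQ. unfold call_cmd. cbn [app].
  destruct (dm_range c NB NB Hc HNB) as (C1 & C2 & C3).
  set (q := G * NB * NB + c).
  assert (Hq : 0 <= q < NB * NB * NB) by (unfold q; pose proof (dm_lt G c NB (NB * NB) HG Hc); lia).
  assert (Hi0 : 0 <= i0 < N) by (pose proof (blk_range _ 0 C1 ltac:(lia)); lia).
  assert (Hj0 : 0 <= j0 < N) by (pose proof (blk_range _ 0 C2 ltac:(lia)); lia).
  assert (Hk0' : 0 <= k0 < N) by (pose proof (blk_range _ 0 HG ltac:(lia)); lia).
  wlet q; [reflexivity|lia|].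
  wlet (-128 * S); [reflexivity|lia|].
  wlet (64 - 128 * (q + 1)); [reflexivity|lia|].
  wlet i0; [reflexivity|lia|]. wlet j0; [reflexivity|lia|]. wlet k0; [reflexivity|lia|].
  wseq. wsto q (3 * b); [reflexivity|reflexivity|lia|].
  wseq. wsto (S + q) t; [reflexivity|reflexivity|lia|].
  set (h1 := updh (updh h ORC q (3 * b)) ORC (S + q) t).
  assert (E1 : forall k, k <> ORC -> h1 k = h k) by (intros; unfold h1; rewrite !updh_arr; auto).
  assert (E1z : forall z q', 0 <= q' < S -> h1 ORC (z * S + q') =
    if q' =? q then (if z =? 0 then 3 * b else if z =? 1 then t else h ORC (z * S + q')) else h ORC (z * S + q')).
  { intros z q' Hq'. unfold h1. rewrite !updh_at.
    destruct (Z.eqb_spec q' q) as [->|Hne].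
    - destruct (Z.eqb_spec (z * S + q) (S + q)) as [E|E].
      + assert (z = 1) as ->
          by (replace (S + q) with (1 * S + q) in E by lia; apply idx_inj in E; lia). reflexivity.
      + destruct (Z.eqb_spec (z * S + q) q) as [E'|E'].
        * assert (z = 0) as ->
            by (replace q with (0 * S + q) in E' at 2 by lia; apply idx_inj in E'; lia). reflexivity.
        * destruct (Z.eqb_spec z 0) as [->|]; [lia|]. destruct (Z.eqb_spec z 1) as [->|]; [lia|]. reflexivity.
    - destruct (Z.eqb_spec (z * S + q') (S + q)) as [E|E].
      { replace (S + q) with (1 * S + q) in E by lia. apply idx_inj in E; lia. }
      destruct (Z.eqb_spec (z * S + q') q) as [E'|E']; auto.
      replace q with (0 * S + q) in E' by lia. apply idx_inj in E'; lia. }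
  wseq. unfold fill_cmd.
  apply (wp_map _ _ _ _ (18 * BB) ORC (fun x => (2 + x) * S + q) cellv 700).
  { reflexivity. }
  { lia. }
  { lia. }
  { intros x x' Hx Hx' E. apply idx_inj in E; lia. }
  { intros x h2 t2 Hx F1 F2. cbn [app].
    destruct (cell_uv x Hx) as [U1 U2].
    wlet (x / 2 / (3 * b)); [reflexivity|lia|].
    wlet ((x / 2) mod (3 * b)); [reflexivity|lia|].
    pose proof (vm_range _ U1) as V1. pose proof (vm_range _ U2) as V2.
    unfold vmap.
    wlet (vm (x / 2 / (3 * b))); [reflexivity|lia|].
    wlet (vm ((x / 2) mod (3 * b))); [reflexivity|lia|].
    wsto ((2 + x) * S + q) (cellv x).
    - reflexivity.
    - rewrite !F1, !E1, EA, EW by discriminate. reflexivity.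
    - pose proof (cellv_abs x Hx). lia.
    - split; [|split; [|split]].
      + intros; apply updh_arr; auto.
      + apply updh_same.
      + intros; apply updh_idx; auto.
      + lia. }
  intros h2 t2 F1 F2 F3 F4. cbn beta in F2.
  assert (Einit : (fun z => h2 ORC (z * S + q)) = init_mem (3 * bn) t oadj owt).
  { assert (Hout : forall z, z < 2 \/ 2 + 18 * BB <= z -> h2 ORC (z * S + q) =
      (if z =? 0 then 3 * b else if z =? 1 then t else 0)).
    { intros z Hz. rewrite F3.
      - rewrite E1z, Z.eqb_refl by lia. rewrite Hfr by lia. reflexivity.
      - intros x Hx E. apply idx_inj in E; lia. }
    apply init_mem_eq.
    - rewrite Hout by lia. reflexivity.
    - rewrite Hout by lia. reflexivity.
    - intros x Hx. apply F2. auto.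
    - intros z Hz. rewrite Hout by lia.
      destruct (Z.eqb_spec z 0); [lia|]. destruct (Z.eqb_spec z 1); [lia|]. reflexivity. }
  destruct (Horc _ _ inst_valid) as (T & M' & Hex & HT & Hans).
  wseq. cbn [wp].
  exists S, q, T, M'. split; [reflexivity|]. split; [reflexivity|]. split; [lia|].
  split; [assumption|]. split; [|split].
  { intros z.
    destruct (Z.lt_ge_cases z 2) as [Hz|Hz]; [|destruct (Z.lt_ge_cases z (2 + 18 * BB)) as [Hz'|Hz']].
    - rewrite F3 by (intros x Hx E; apply idx_inj in E; lia).
      rewrite E1z, Z.eqb_refl by lia. rewrite Hfr by lia.
      destruct (z =? 0); [lia|]. destruct (z =? 1); lia.
    - replace z with (2 + (z - 2)) by lia. rewrite F2 by lia. apply cellv_abs. lia.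
    - rewrite F3 by (intros x Hx E; apply idx_inj in E; lia).
      rewrite E1z, Z.eqb_refl by lia. rewrite Hfr by lia.
      destruct (z =? 0); [lia|]. destruct (z =? 1); lia. }
  { rewrite Einit. exact Hex. }
  intros h3 G1 G2 G3. unfold read_cmd.
  apply (wp_map _ _ _ _ BB FLG (fun x => c * BB + x)
     (fun x => flag G (i0 + x / b) (j0 + x mod b)) 200).
  { reflexivity. }
  { lia. }
  { lia. }
  { intros; lia. }
  { intros x h4 t4 Hx K1 K2. cbn [app].
    destruct (dm_range x b b ltac:(lia) Hb) as (X1 & X2 & X3).
    pose proof (blk_range _ _ C1 X1) as Ri. pose proof (blk_range _ _ C2 X2) as Rj.
    fold i0 in Ri. fold j0 in Rj.
    destruct (detect_spec _ _ X1 X2) as [Ho Hd].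
    assert (Eaddr : 2 + 18 * BB + (x / b * (3 * b) + (b + x mod b)) =
      out_addr (3 * bn) (Z.to_nat (x / b)) (Z.to_nat (b + x mod b))).
    { unfold out_addr. rewrite HBB.
      replace (Z.of_nat (Z.to_nat (x / b) * (3 * bn) + Z.to_nat (b + x mod b)))
        with (x / b * (3 * b) + (b + x mod b)) by (rewrite Nat2Z.inj_add, Nat2Z.inj_mul, !Z2Nat.id by lia; f_equal; f_equal; lia).
      replace (Z.of_nat (3 * bn)) with (3 * b) by lia. ring. }
    wsto (c * BB + x) (flag G (i0 + x / b) (j0 + x mod b)).
    - reflexivity.
    - rewrite !K1 by discriminate. rewrite G2, Eaddr.
      rewrite G1, F1, E1, EA by discriminate. unfold flag.
      destruct (HA _ (dm_lt _ _ _ _ Ri Rj)) as [E|E]; rewrite E; [reflexivity|].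
      rewrite E in Ho. rewrite Hans, Hd; auto; lia.
    - unfold flag. destruct (HA _ (dm_lt _ _ _ _ Ri Rj)) as [E|E]; rewrite E;
        destruct (_ <? _); cbn [b2z]; lia.
    - split; [|split; [|split]].
      + intros; apply updh_arr; auto.
      + apply updh_same.
      + intros; apply updh_idx; auto.
      + lia. }
  intros h4 t4 K1 K2 K3 K4. apply HQ.
  - intros k Hk1 Hk2. rewrite K1, G1, F1, E1; auto.
  - auto.
  - intros y Hy. rewrite K3 by (intros; lia). rewrite G1, F1, E1 by discriminate. reflexivity.
  - intros z q' Hq'. rewrite K1 by discriminate. rewrite G3.
    2:{ rewrite dm_mod by lia. unfold q. lia. }
    rewrite F3 by (intros x Hx E; apply idx_inj in E; unfold q in *; lia).
    rewrite E1z by lia. rewrite (proj2 (Z.eqb_neq q' q)) by (unfold q; lia).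
    apply Hfr. unfold q in *. lia.
  - revert F4 K4. cs. lia.
Qed.

End One_call.

Lemma flags_ok (Q : heap -> Z -> Prop) h s : h ADJ = A -> h WT = W -> fresh h (G * NB * NB) ->
  (forall h' s', (forall k, k <> ORC -> k <> FLG -> h' k = h k) ->
    (forall c x, 0 <= c < NB * NB -> 0 <= x < BB ->
       h' FLG (c * BB + x) = flag G (c / NB * b + x / b) (c mod NB * b + x mod b)) ->
    fresh h' ((G + 1) * NB * NB) ->
    s' <= s + NB * NB * (15000 * BB + 13 * Tm + 510) + 100 -> Q h' s') ->
  WP flags_cmd Q genv h s.
Proof.
  intros EA EW Hfr HQ. unfold flags_cmd.
  apply (wp_for _ _ _ _ (NB * NB) (fun m h' s' => (forall k, k <> ORC -> k <> FLG -> h' k = h k) /\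
    (forall c x, 0 <= c < m -> 0 <= x < BB ->
       h' FLG (c * BB + x) = flag G (c / NB * b + x / b) (c mod NB * b + x mod b)) /\
    fresh h' (G * NB * NB + m) /\ s' <= s + 50 + m * (15000 * BB + 13 * Tm + 510))).
  - reflexivity.
  - lia.
  - split; [auto|]. split; [intros; lia|]. split; [now rewrite Z.add_0_r|cs; lia].
  - intros c h1 s1 Hc (F1 & F2 & F3 & F4).
    apply (call_ok c Hc); auto.
    { rewrite F1; auto; discriminate. }
    { rewrite F1; auto; discriminate. }
    intros h2 s2 K1 K2 K3 K4 K5. split; [|split; [|split]].
    + intros k H1 H2. rewrite K1, F1; auto.
    + intros c' x Hc' Hx. destruct (Z.eq_dec c' c) as [->|]; [apply K2; auto|].
      rewrite K3 by (pose proof (dm_lt c' x c BB ltac:(lia) Hx); lia). apply F2; auto; lia.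
    + now rewrite Z.add_assoc.
    + lia.
  - intros h1 s1 (F1 & F2 & F3 & F4). apply HQ; auto; [|lia].
    replace ((G + 1) * NB * NB) with (G * NB * NB + NB * NB) by ring. auto.
Qed.

End Flags.

(** * Processing one group of third vertices *)

(** [FLG] is ordered by pairs of blocks and then by positions within them, as the calls produced it;
    the index expression translates from the row order of edges. *)
Definition mark_cmd : cmd :=
  For (EV 10) (Sto FRE (EV 15) ((EL DONE (EV 15) =! EC 0) *!
    EL FLG ((EV 15 /! EV 6 /! EV 2 *! EV 5 +! EV 15 %! EV 6 /! EV 2) *! EV 12 +!
            ((EV 15 /! EV 6) %! EV 2 *! EV 2 +! EV 15 %! EV 6 %! EV 2)))).

Definition tally_cmd : cmd :=
  Sto TMP (EC 0) (EC 0) ;;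
  For (EV 10) (Sto TMP (EC 0) (EL TMP (EC 0) +! EL FRE (EV 15))).

Definition few_cmd : cmd :=
  For (EV 10) (If (EL FRE (EV 15))
   (Let (EV 15 /! EV 6)
   (Let (EV 15 %! EV 6)
   (For (EV 2)
    (Let (EV 13 *! EV 2 +! EV 19)
    (If (EL ADJ (EV 17 *! EV 6 +! EV 21) *! EL ADJ (EV 18 *! EV 6 +! EV 21) *!
         ((EL WT (EV 15) +! EL WT (EV 17 *! EV 6 +! EV 21) +! EL WT (EV 18 *! EV 6 +! EV 21)) =! EV 1))
      (Sto ANS (EV 15) (EL ANS (EV 15) +! EC 1)) Skip))))) Skip).

Definition settle_cmd : cmd :=
  For (EV 10) (If ((EL DONE (EV 18) =! EC 0) *! EL ADJ (EV 18) *!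
      (EL ADJ (EV 18 /! EV 6 *! EV 6 +! EV 17) *! EL ADJ (EV 18 %! EV 6 *! EV 6 +! EV 17) *!
       ((EL WT (EV 18) +! EL WT (EV 18 /! EV 6 *! EV 6 +! EV 17) +!
         EL WT (EV 18 %! EV 6 *! EV 6 +! EV 17)) =! EV 1)))
    (Sto DONE (EV 18) (EC 1) ;; Sto ANS (EV 18) (EL EQP (EV 18))) Skip).

Definition many_cmd : cmd :=
  For (EV 2) (Let (EV 13 *! EV 2 +! EV 15) (eq_cmd ;; settle_cmd)).

Definition group_cmd : cmd :=
  flags_cmd ;; mark_cmd ;; tally_cmd ;; If (EL TMP (EC 0) <! EV 9) few_cmd many_cmd.

(** * Correctness and amortized cost of one group *)

Section Group.
Variables (P : program) (w0 : nat) (Y Bm : Z).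
Notation WP := (wp P w0 Y Bm).
Variables (n t : Z) (bn : nat).
Let b := Z.of_nat bn.
Variables (L V NB N tau D H N2 S BB G : Z).
Notation genv := [n; t; b; L; V; NB; N; tau; D; H; N2; S; BB; G; NB].
Hypothesis Hb : 0 < b.
Hypothesis HNB : 0 < NB.
Hypothesis HN : N = b * NB.
Hypothesis HBB : BB = b * b.
Hypothesis HG : 0 <= G < NB.
Hypothesis HYN : 8 * N * N * N <= Y.
Hypothesis HYB : 20 * BB <= Y.
Hypothesis HS : NB * NB * NB < S.
Hypothesis HSY : 256 * S <= Y.
Hypothesis HBS : (Bm + 2) * S <= Y.
Hypothesis HL : 0 <= L.
Hypothesis HNL : N = 2 ^ L.
Hypothesis HV : V = 7 ^ L.
Hypothesis HN2 : N2 = N * N.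
Hypothesis HD : N = D * tau.
Hypothesis Htau : 0 < tau.
Hypothesis HH : 0 <= H.

Variables (A W : Z -> Z) (Wm : Z) (K : nat) (Tm : Z).
Hypothesis HA : forall e, 0 <= e < N * N -> A e = 0 \/ A e = 1.
Hypothesis HW : forall e, 0 <= e < N * N -> Z.abs (W e) <= Wm.
Hypothesis HW0 : forall e, 0 <= e < N * N -> A e = 0 -> W e = 0.
Hypothesis HAs : forall i j, 0 <= i < N -> 0 <= j < N -> A (i * N + j) = A (j * N + i).
Hypothesis HWs : forall i j, 0 <= i < N -> 0 <= j < N -> W (i * N + j) = W (j * N + i).
Hypothesis HWm : Wm <= Z.of_nat ((3 * bn) ^ K).
Hypothesis HWY : 2 * Wm <= Y.
Hypothesis Ht : Z.abs t <= Z.of_nat ((3 * bn) ^ K).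
Hypothesis HBm : 3 * b <= Bm /\ Z.abs t <= Bm /\ Wm <= Bm.
Hypothesis Horc : forall adj wt, valid_instance K (3 * bn) t adj wt ->
  exists T M', exec w0 P T 0 (init_mem (3 * bn) t adj wt) = Some M' /\ Z.of_nat T <= Tm /\
    forall i j, (i < 3 * bn)%nat -> (j < 3 * bn)%nat -> adj i j = true ->
      M' (out_addr (3 * bn) i j) = detect_answer (3 * bn) t adj wt i j.

Let HNp : 0 < N.
Proof. rewrite HN. clear - Hb HNB. nia. Qed.

Let HYN1 : 8 * N <= Y.
Proof. clear - HNp HYN. nia. Qed.

Let HYN2 : N * N <= Y.
Proof. clear - HNp HYN. assert (N * N * 1 <= N * N * N) by (apply Z.mul_le_mono_nonneg_l; nia). lia. Qed.

Let HbN : b <= N.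
Proof. rewrite HN. clear - Hb HNB. nia. Qed.

Definition cl (e k : Z) : Z := clo t N A W (e / N) (e mod N) k.

Lemma cl_range e k : 0 <= e < N * N -> 0 <= k < N -> 0 <= cl e k <= 1.
Proof.
  intros He Hk. destruct (dm_range e N N He HNp) as (D1 & D2 & D3). unfold cl, clo.
  destruct (HA _ (dm_lt _ _ _ _ D1 Hk)) as [-> | ->];
  destruct (HA _ (dm_lt _ _ _ _ D2 Hk)) as [-> | ->];
  destruct (_ =? t); cbn; lia.
Qed.

Lemma grp_range k : 0 <= k < b -> 0 <= G * b + k < N.
Proof. intros Hk. rewrite HN. pose proof (dm_lt G k NB b HG Hk). lia. Qed.

Definition gc (e : Z) : Z := zs b (fun k => cl e (G * b + k)).

Lemma gc_range e : 0 <= e < N * N -> 0 <= gc e <= b.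
Proof.
  intros He. unfold gc. split.
  - apply zs_nonneg. intros k Hk. apply cl_range; auto. apply grp_range; auto.
  - etransitivity; [apply (zs_le _ _ (fun _ => 1))|rewrite zs_const; lia].
    intros k Hk. apply cl_range; auto. apply grp_range; auto.
Qed.

Definition tot (e : Z) : Z := zs N (cl e).
Definition part (g e : Z) : Z := zs (g * b) (cl e).

Lemma part_succ e : part (G + 1) e = part G e + gc e.
Proof.
  unfold part, gc. replace ((G + 1) * b) with (G * b + b) by ring.
  rewrite zs_split by nia. reflexivity.
Qed.

Lemma part_range g e : 0 <= e < N * N -> 0 <= g * b <= N -> 0 <= part g e <= N.
Proof.
  intros He Hg. unfold part. split.
  - apply zs_nonneg. intros k Hk. apply cl_range; auto; lia.
  - etransitivity; [apply (zs_le _ _ (fun _ => 1))|rewrite zs_const; lia].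
    intros k Hk. apply cl_range; auto; lia.
Qed.

(* An edge is settled as soon as some group with many flagged edges contains a witness of it;
   until then its answer counts the witnesses in the groups processed so far. *)
Definition good (g : Z) (dn an : Z -> Z) :=
  forall e, 0 <= e < N * N -> (dn e = 0 \/ dn e = 1) /\
    (A e = 1 -> (dn e = 1 -> an e = tot e) /\ (dn e = 0 -> an e = part g e)).

Definition frv (dn : Z -> Z) (e : Z) : Z := (if dn e =? 0 then 1 else 0) * (A e * b2z (0 <? gc e)).

Lemma frv_range dn e : 0 <= e < N * N -> 0 <= frv dn e <= 1.
Proof.
  intros He. unfold frv. destruct (HA e He) as [-> | ->]; destruct (dn e =? 0), (0 <? gc e); cbn; lia.
Qed.

(* Fredman's trick: relative to a known witness [k0], the exact weight condition on [k]
   becomes an equality between a quantity of [(i,k)] and a quantity of [(j,k)]. *)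
Lemma fredman e k0 : 0 <= e < N * N -> 0 <= k0 < N -> cl e k0 = 1 ->
  eqp N k0 A W (e / N) (e mod N) = tot e.
Proof.
  intros He Hk0 Hw. destruct (dm_range e N N He HNp) as (D1 & D2 & D3).
  unfold eqp, tot. apply zs_ext. intros k Hk. unfold cl, clo.
  rewrite (HAs k) by auto. f_equal. f_equal.
  unfold cl, clo in Hw.
  destruct (Z.eqb_spec (W (e / N * N + e mod N) + W (e / N * N + k0) + W (e mod N * N + k0)) t) as [E|E];
    [|cbn [b2z] in Hw; lia].
  unfold X. apply Bool.eq_iff_eq_true. rewrite !Z.eqb_eq. lia.
Qed.

Lemma mark_ok (Q : heap -> Z -> Prop) h s :
  (forall c x, 0 <= c < NB * NB -> 0 <= x < BB ->
     h FLG (c * BB + x) = flag t bn N A W G (c / NB * b + x / b) (c mod NB * b + x mod b)) ->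
  (forall h' s', (forall k, k <> FRE -> h' k = h k) ->
    (forall e, 0 <= e < N * N -> h' FRE e = frv (h DONE) e) ->
    s' <= s + 200 * N2 + 50 -> Q h' s') ->
  WP mark_cmd Q genv h s.
Proof.
  intros HF HQ. unfold mark_cmd.
  apply (wp_map _ _ _ _ N2 FRE (fun e => e) (frv (h DONE)) 190); [reflexivity|lia|lia|auto| |].
  - intros e h1 s1 He F1 F2. cbn [app]. rewrite HN2 in He.
    destruct (dm_range e N N He HNp) as (D1 & D2 & D3).
    wsto e (frv (h DONE) e).
    + reflexivity.
    + rewrite !F1 by discriminate.
      assert (B1 : 0 <= e / N < NB * b) by lia. assert (B2 : 0 <= e mod N < NB * b) by lia.
      destruct (dm_range _ _ _ B1 Hb) as (I1 & I2 & I3).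
      destruct (dm_range _ _ _ B2 Hb) as (J1 & J2 & J3).
      rewrite HF.
      * rewrite !dm_div, !dm_mod by auto. rewrite <- I3, <- J3. unfold flag, frv. rewrite <- D3.
        reflexivity.
      * apply dm_lt; auto.
      * rewrite HBB. apply dm_lt; auto.
    + pose proof (frv_range (h DONE) e He). lia.
    + split; [|split; [|split]].
      * intros; apply updh_arr; auto.
      * apply updh_same.
      * intros; apply updh_idx; auto.
      * lia.
  - intros h' s' F1 F2 _ F4. apply HQ; auto; [|revert F4; cs; lia].
    intros e He. apply F2. lia.
Qed.

Lemma tally_ok (Q : heap -> Z -> Prop) h s f :
  (forall e, 0 <= e < N * N -> h FRE e = f e /\ 0 <= f e <= 1) ->
  (forall h' s', (forall k, k <> TMP -> h' k = h k) -> h' TMP 0 = zs N2 f ->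
    s' <= s + 50 * N2 + 50 -> Q h' s') ->
  WP tally_cmd Q genv h s.
Proof.
  intros HF HQ. unfold tally_cmd. wseq. wsto 0 0; [reflexivity|reflexivity|lia|].
  apply (wp_for _ _ _ _ N2 (fun m h' s' => (forall k, k <> TMP -> h' k = h k) /\
    h' TMP 0 = zs m f /\ s' <= s + 30 + m * 50)); [reflexivity|lia| | |].
  - split; [intros; apply updh_arr; auto|]. split; [apply updh_same|cs; lia].
  - intros m h1 s1 Hm (F1 & F2 & F3). cbn [app].
    destruct (HF m ltac:(lia)) as [E1 E2].
    wsto 0 (zs (m + 1) f).
    + reflexivity.
    + rewrite F2, F1, E1 by discriminate. now rewrite zs_succ by lia.
    + assert (Z.abs (zs (m + 1) f) <= (m + 1) * 1); [|lia].
      apply zs_abs; [lia|]. intros i Hi. destruct (HF i ltac:(lia)). lia.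
    + split; [intros; rewrite updh_arr; auto|]. split; [apply updh_same|lia].
  - intros h' s' (F1 & F2 & F3). apply HQ; auto; lia.
Qed.

Lemma few_ok (Q : heap -> Z -> Prop) h s f :
  h ADJ = A -> h WT = W ->
  (forall e, 0 <= e < N * N -> h FRE e = f e /\ 0 <= f e <= 1) ->
  (forall e, 0 <= e < N * N -> f e = 1 -> 0 <= h ANS e <= N) ->
  (forall h' s', (forall k, k <> ANS -> h' k = h k) ->
    (forall e, 0 <= e < N * N -> h' ANS e = h ANS e + f e * gc e) ->
    s' <= s + 200 * N2 + 300 * b * zs N2 f + 50 -> Q h' s') ->
  WP few_cmd Q genv h s.
Proof.
  intros EA EW HF Hans HQ. unfold few_cmd.
  apply (wp_for _ _ _ _ N2 (fun m h' s' => (forall k, k <> ANS -> h' k = h k) /\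
    (forall e, 0 <= e < N * N -> h' ANS e = h ANS e + (if e <? m then f e * gc e else 0)) /\
    s' <= s + 30 + m * 200 + 300 * b * zs m f)); [reflexivity|lia| | |].
  - split; [auto|]. split; [|rewrite zs_0; cs; lia].
    intros e He. rewrite (proj2 (Z.ltb_ge e 0)) by lia. lia.
  - intros m h1 s1 Hm (F1 & F2 & F3). cbn [app]. rewrite HN2 in Hm.
    destruct (HF m Hm) as [E1 E2].
    destruct (dm_range m N N Hm HNp) as (D1 & D2 & D3).
    assert (Hstep : forall e, (if e <? m + 1 then f e * gc e else 0) =
       (if e <? m then f e * gc e else 0) + b2z (e =? m) * (f m * gc m)).
    { intros e. destruct (Z.ltb_spec e m), (Z.ltb_spec e (m + 1)), (Z.eqb_spec e m); subst; cbn [b2z]; lia. }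
    apply wp_if; evs; rewrite F1, E1 by discriminate; intros Hf.
    + assert (Hf1 : f m = 1) by lia.
      wlet (m / N); [reflexivity|lia|]. wlet (m mod N); [reflexivity|lia|].
      apply (wp_for _ _ _ _ b (fun k h' s' => (forall k, k <> ANS -> h' k = h k) /\
        (forall e, 0 <= e < N * N -> h' ANS e = h1 ANS e +
           b2z (e =? m) * zs k (fun k => cl m (G * b + k))) /\
        s' <= s1 + 100 + k * 220)); [reflexivity|lia| | |].
      * split; [auto|]. split; [|cs; lia]. intros. rewrite zs_0. lia.
      * intros k h2 s2 Hk (K1 & K2 & K3). cbn [app].
        pose proof (grp_range k Hk) as Hkk.
        wlet (G * b + k); [reflexivity|lia|].
        assert (Hcl : A (m / N * N + (G * b + k)) * A (m mod N * N + (G * b + k)) *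
          (if W m + W (m / N * N + (G * b + k)) + W (m mod N * N + (G * b + k)) =? t then 1 else 0) =
          cl m (G * b + k)) by (unfold cl, clo; rewrite <- D3; reflexivity).
        pose proof (cl_range m (G * b + k) Hm Hkk) as Hcr.
        apply wp_if; evs; rewrite !K1, EA, EW by discriminate; rewrite Hcl; intros Hz.
        -- wsto m (h2 ANS m + 1); [reflexivity|reflexivity| |].
           { rewrite K2, F2 by auto. rewrite (proj2 (Z.ltb_ge m m)) by lia.
             rewrite Z.eqb_refl. cbn [b2z]. specialize (Hans m Hm Hf1).
             assert (Z.abs (zs k (fun k => cl m (G * b + k))) <= k * 1); [|lia].
             apply zs_abs; [lia|]. intros k' Hk'.
             pose proof (cl_range m (G * b + k') Hm (grp_range k' ltac:(lia))). lia. }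
           split; [intros; rewrite updh_arr; auto|]. split; [|lia].
           intros e He. rewrite updh_at, zs_succ by lia.
           destruct (Z.eqb_spec e m) as [->|Hne]; cbn [b2z].
           ++ rewrite K2, Z.eqb_refl by auto. cbn [b2z]. lia.
           ++ rewrite K2, (proj2 (Z.eqb_neq e m)) by auto. cbn [b2z]. lia.
        -- cbn [wp]. split; [auto|]. split; [|cs; lia].
           intros e He. rewrite K2, zs_succ by (auto; lia). rewrite Hz. lia.
      * intros h2 s2 (K1 & K2 & K3). split; [auto|]. split.
        -- intros e He. rewrite Hstep, K2, F2 by auto. fold (gc m). rewrite Hf1. lia.
        -- rewrite zs_succ by lia. rewrite Hf1. lia.
    + cbn [wp]. split; [auto|]. split.
      * intros e He. rewrite Hstep, F2 by auto. rewrite Hf. lia.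
      * rewrite zs_succ by lia. rewrite Hf. cs. lia.
  - intros h' s' (F1 & F2 & F3). apply HQ; auto; [|lia].
    intros e He. rewrite F2, (proj2 (Z.ltb_lt e N2)) by lia. reflexivity.
Qed.

Lemma settle_ok (Q : heap -> Z -> Prop) h s k :
  h ADJ = A -> h WT = W -> 0 <= k < b ->
  (forall i j, 0 <= i < N -> 0 <= j < N -> h EQP (i * N + j) = eqp N (G * b + k) A W i j) ->
  (forall e, 0 <= e < N * N -> h DONE e = 0 \/ h DONE e = 1) ->
  (forall h' s', (forall k', k' <> ANS -> k' <> DONE -> h' k' = h k') ->
    (forall e, 0 <= e < N * N ->
      (h' DONE e = h DONE e /\ h' ANS e = h ANS e /\
       (A e = 1 -> h DONE e = 0 -> cl e (G * b + k) = 0)) \/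
      (h' DONE e = 1 /\ h DONE e = 0 /\ h' ANS e = tot e)) ->
    s' <= s + 300 * N2 + 50 -> Q h' s') ->
  WP settle_cmd Q (genv ++ [k; b; G * b + k]) h s.
Proof.
  intros EA EW Hk HE HDn HQ. unfold settle_cmd. cbn [app].
  pose proof (grp_range k Hk) as Hkk. set (k0 := G * b + k) in *.
  apply (wp_for _ _ _ _ N2 (fun m h' s' => (forall k', k' <> ANS -> k' <> DONE -> h' k' = h k') /\
    (forall e, m <= e -> h' DONE e = h DONE e /\ h' ANS e = h ANS e) /\
    (forall e, 0 <= e < m ->
      (h' DONE e = h DONE e /\ h' ANS e = h ANS e /\
       (A e = 1 -> h DONE e = 0 -> cl e k0 = 0)) \/
      (h' DONE e = 1 /\ h DONE e = 0 /\ h' ANS e = tot e)) /\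
    s' <= s + 30 + m * 300)); [reflexivity|lia| | |].
  - split; [auto|]. split; [auto|]. split; [intros; lia|cs; lia].
  - intros m h1 s1 Hm (F1 & F2 & F3 & F4). cbn [app]. rewrite HN2 in Hm.
    destruct (dm_range m N N Hm HNp) as (D1 & D2 & D3).
    destruct (F2 m ltac:(lia)) as [E1 E2].
    assert (Hcl : A (m / N * N + k0) * A (m mod N * N + k0) *
      (if W m + W (m / N * N + k0) + W (m mod N * N + k0) =? t then 1 else 0) =
      cl m k0) by (unfold cl, clo; rewrite <- D3; reflexivity).
    pose proof (cl_range m k0 Hm Hkk) as Hcr.
    apply wp_if; evs; rewrite E1, !F1, EA, EW by discriminate; rewrite Hcl; intros Hz.
    + assert (Hd0 : h DONE m = 0) by (destruct (Z.eqb_spec (h DONE m) 0); lia).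
      assert (Hc1 : cl m k0 = 1) by (destruct (Z.eq_dec (cl m k0) 0) as [E|E]; [rewrite E in Hz|]; lia).
      assert (HE' : h EQP m = tot m).
      { rewrite D3 at 1. rewrite HE by auto. apply fredman; auto. }
      (* As [N = NB * b], the full count is the partial count over all [NB] groups and inherits its
         bound. *)
      pose proof (part_range NB m Hm ltac:(lia)) as Hp.
      unfold part in Hp. rewrite Z.mul_comm, <- HN in Hp. fold (tot m) in Hp.
      wseq. wsto m 1; [reflexivity|reflexivity|lia|].
      wsto m (tot m); [reflexivity| |lia|].
      { rewrite updh_arr, F1 by discriminate. auto. }
      split; [|split; [|split]].
      * intros k' H1 H2. rewrite !updh_arr by auto. auto.
      * intros e He. rewrite updh_arr by discriminate. rewrite !updh_idx by lia.
        rewrite updh_arr by discriminate. apply F2. lia.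
      * intros e He. destruct (Z.eq_dec e m) as [->|Hne].
        -- right. rewrite updh_arr by discriminate. rewrite !updh_same. auto.
        -- rewrite updh_arr by discriminate. rewrite !updh_idx by lia.
           rewrite updh_arr by discriminate. apply F3. lia.
      * lia.
    + cbn [wp]. split; [auto|]. split; [intros; apply F2; lia|]. split; [|cs; lia].
      intros e He. destruct (Z.eq_dec e m) as [->|Hne]; [|apply F3; lia].
      left. split; [auto|]. split; [auto|]. intros HA1 Hd0. rewrite HA1, Hd0 in Hz. cbn [Z.eqb] in Hz. lia.
  - intros h' s' (F1 & F2 & F3 & F4). apply HQ; auto; [|lia]. intros e He. apply F3. lia.
Qed.

(** Every vertex of the group has served as pivot, so an edge that is still unsettled has no witness
    in the group. Its partial count is therefore correct for the next group without any change. *)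
Lemma many_ok (Q : heap -> Z -> Prop) h s :
  h ADJ = A -> h WT = W -> tables L h ->
  (forall e, 0 <= e < N * N -> h DONE e = 0 \/ h DONE e = 1) ->
  (forall h' s', (forall k', ~ In k' [ANS; DONE; EQP; FRQ; LST; TMP; HVY; HCN; MA; MB; MC] -> h' k' = h k') ->
    (forall e, 0 <= e < N * N ->
      (h' DONE e = h DONE e /\ h' ANS e = h ANS e /\ (A e = 1 -> h DONE e = 0 -> gc e = 0)) \/
      (h' DONE e = 1 /\ h DONE e = 0 /\ h' ANS e = tot e)) ->
    s' <= s + b * (N * N * (100 * tau + 1700) + 3010 * D * (L + 1) * V + 100) + 50 -> Q h' s') ->
  WP many_cmd Q genv h s.
Proof.
  intros EA EW Htab HDn HQ. unfold many_cmd.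
  apply (wp_for _ _ _ _ b (fun m h' s' =>
    (forall k', ~ In k' [ANS; DONE; EQP; FRQ; LST; TMP; HVY; HCN; MA; MB; MC] -> h' k' = h k') /\
    (forall e, 0 <= e < N * N ->
      (h' DONE e = h DONE e /\ h' ANS e = h ANS e /\
       (A e = 1 -> h DONE e = 0 -> zs m (fun k => cl e (G * b + k)) = 0)) \/
      (h' DONE e = 1 /\ h DONE e = 0 /\ h' ANS e = tot e)) /\
    s' <= s + 30 + m * (N * N * (100 * tau + 1700) + 3010 * D * (L + 1) * V + 100)));
    [reflexivity|lia| | |].
  - split; [auto|]. split; [intros; left; auto|cs; lia].
  - intros k h1 s1 Hk (F1 & F2 & F3). cbn [app].
    pose proof (grp_range k Hk) as Hkk.
    wlet (G * b + k); [reflexivity|lia|]. wseq.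
    apply (eq_ok P w0 Y Bm n t b L V NB N tau D H N2 S BB G NB k b (G * b + k) HL HNL HV HYN HN2 HD Htau Hkk
      A W Wm HA HW HWY).
    { rewrite F1; auto. cbn [In]; lia. }
    { rewrite F1; auto. cbn [In]; lia. }
    { intros x Hx. rewrite !F1 by (cbn [In]; lia). apply Htab; auto. }
    intros h2 s2 K1 K2 K3.
    assert (ED : h2 DONE = h1 DONE) by (apply K1; cbn [In]; lia).
    assert (EN : h2 ANS = h1 ANS) by (apply K1; cbn [In]; lia).
    apply (settle_ok _ _ _ k); auto.
    { rewrite K1, F1; auto; cbn [In]; lia. }
    { rewrite K1, F1; auto; cbn [In]; lia. }
    { intros e He. rewrite ED. destruct (F2 e He) as [(J1 & _)|(J1 & _)]; rewrite J1; auto. }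
    intros h3 s3 M1 M2 M3. split; [|split].
    + intros k' Hin. cbn [In] in Hin. rewrite M1, K1, F1; auto; cbn [In]; lia.
    + intros e He. rewrite ED, EN in M2.
      destruct (F2 e He) as [(J1 & J2 & J3)|(J1 & J2 & J3)]; destruct (M2 e He) as [(R1 & R2 & R3)|(R1 & R2 & R3)].
      * left. split; [congruence|]. split; [congruence|]. intros HA1 Hd. rewrite zs_succ by lia.
        rewrite J3, R3 by congruence. reflexivity.
      * right. split; [auto|]. split; congruence.
      * right. split; [congruence|]. split; congruence.
      * lia.
    + lia.
  - intros h' s' (F1 & F2 & F3). apply HQ; auto. lia.
Qed.

Definition nd (h : heap) : Z := zs N2 (h DONE).

(** The alternative in the time bound prepares the amortization, with the number [nd] of settled
    edges as potential: a group is cheap or raises the potential by at least [H]. *)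
Lemma group_ok (Q : heap -> Z -> Prop) h s :
  h ADJ = A -> h WT = W -> tables L h -> fresh NB S h (G * NB * NB) ->
  good G (h DONE) (h ANS) ->
  (forall h' s', h' ADJ = A -> h' WT = W -> h' TP2 = h TP2 -> h' TP7 = h TP7 ->
    fresh NB S h' ((G + 1) * NB * NB) -> good (G + 1) (h' DONE) (h' ANS) ->
    nd h <= nd h' ->
    s' <= s + NB * NB * (15000 * BB + 13 * Tm + 510) + 500 * N2 + 300 * b * H + 500 \/
    (nd h + H <= nd h' /\
     s' <= s + NB * NB * (15000 * BB + 13 * Tm + 510) + 500 * N2 + 500
           + b * (N * N * (100 * tau + 1700) + 3010 * D * (L + 1) * V + 100)) -> Q h' s') ->
  WP group_cmd Q genv h s.
Proof.
  intros EA EW Htab Hfr Hgood HQ. unfold group_cmd. wseq.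
  apply (flags_ok P w0 Y Bm n t bn L V NB N tau D H N2 S BB G Hb HNB HN HBB HG HYN HYB HS HSY HBS
    A W Wm K Tm); auto.
  intros h1 s1 F1 F2 F3 F4. wseq. apply mark_ok; auto.
  intros h2 s2 K1 K2 K3. wseq.
  rewrite (F1 DONE) in K2 by discriminate.
  apply (tally_ok _ _ _ (frv (h DONE))).
  { intros e He. split; [auto|]. apply frv_range; auto. }
  intros h3 s3 M1 M2 M3.
  assert (E3 : forall k, ~ In k [ORC; FLG; FRE; TMP] -> h3 k = h k).
  { intros k Hin. cbn [In] in Hin. rewrite M1, K1, F1; auto; intuition. }
  assert (EA3 : h3 ADJ = A) by (rewrite E3; auto; cbn [In]; unfold ORC; lia).
  assert (EW3 : h3 WT = W) by (rewrite E3; auto; cbn [In]; unfold ORC; lia).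
  assert (ED3 : h3 DONE = h DONE) by (apply E3; cbn [In]; unfold ORC; lia).
  assert (EN3 : h3 ANS = h ANS) by (apply E3; cbn [In]; unfold ORC; lia).
  assert (ET3 : h3 TP2 = h TP2 /\ h3 TP7 = h TP7)
    by (split; apply E3; cbn [In]; unfold ORC; lia).
  destruct ET3 as [ET2 ET7].
  assert (Hfr3 : fresh NB S h3 ((G + 1) * NB * NB)).
  { intros z q Hq. rewrite M1, K1 by discriminate. apply F3; auto. }
  assert (Hnz : 0 <= zs N2 (frv (h DONE))).
  { apply zs_nonneg. intros; apply frv_range; lia. }
  apply wp_if; evs; rewrite M2; intros Hif.
  - destruct (Z.ltb_spec (zs N2 (frv (h DONE))) H) as [Hlt|]; [|lia].
    apply (few_ok _ _ _ (frv (h DONE))); auto.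
    { intros e He. rewrite M1 by discriminate. split; [auto|]. apply frv_range; auto. }
    { intros e He Hf. rewrite EN3. destruct (Hgood e He) as [Hd He'].
      assert (HA1 : A e = 1) by (unfold frv in Hf; destruct (HA e He) as [E|E]; rewrite E in *; lia).
      assert (Hd0 : h DONE e = 0) by (unfold frv in Hf; destruct (Z.eqb_spec (h DONE e) 0); lia).
      rewrite (proj2 (He' HA1) Hd0). apply part_range; auto.
      pose proof (grp_range 0 ltac:(lia)). lia. }
    intros h4 s4 R1 R2 R3.
    apply HQ.
    + rewrite R1; auto; discriminate.
    + rewrite R1; auto; discriminate.
    + rewrite R1; auto; discriminate.
    + rewrite R1; auto; discriminate.
    + intros z q Hq. rewrite R1 by discriminate. apply Hfr3; auto.
    + intros e He. rewrite R1, ED3, R2, EN3 by (auto; discriminate).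
      destruct (Hgood e He) as [Hd He']. split; [auto|]. intros HA1.
      destruct (He' HA1) as [G1 G2]. unfold frv. rewrite HA1. split; intros Hdd; rewrite Hdd.
      * rewrite G1 by auto. cbn [Z.eqb]. lia.
      * rewrite G2, part_succ by auto. cbn [Z.eqb].
        pose proof (gc_range e He). destruct (Z.ltb_spec 0 (gc e)); cbn [b2z]; lia.
    + unfold nd. rewrite R1, ED3 by discriminate. lia.
    + left. revert R3. cs. intros R3.
      assert (300 * b * zs N2 (frv (h DONE)) <= 300 * b * H)
        by (apply Z.mul_le_mono_nonneg_l; lia). lia.
  - destruct (Z.ltb_spec (zs N2 (frv (h DONE))) H) as [|Hge]; [lia|].
    apply many_ok; auto.
    { intros x Hx. rewrite ET2, ET7. apply Htab; auto. }
    { intros e He. rewrite ED3. apply Hgood; auto. }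
    intros h4 s4 R1 R2 R3. rewrite ED3, EN3 in R2.
    (* Each flagged edge was unsettled and has a witness in the group, so one of the pivots has
       settled it. *)
    assert (Hinc : nd h + zs N2 (frv (h DONE)) <= nd h4).
    { unfold nd. rewrite <- zs_add. apply zs_le. intros e He. rewrite HN2 in He.
      destruct (R2 e He) as [(J1 & J2 & J3)|(J1 & J2 & J3)].
      - rewrite J1. enough (frv (h DONE) e = 0) by lia. unfold frv.
        destruct (HA e He) as [E|E]; rewrite E; [lia|].
        destruct (Z.eqb_spec (h DONE e) 0) as [Hd|]; [|lia].
        rewrite J3 by auto. cbn. lia.
      - rewrite J1, J2. pose proof (frv_range (h DONE) e He). lia. }
    apply HQ.
    + rewrite R1; auto. cbn [In]; lia.
    + rewrite R1; auto. cbn [In]; lia.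
    + rewrite R1; auto. cbn [In]; lia.
    + rewrite R1; auto. cbn [In]; lia.
    + intros z q Hq. rewrite R1 by (cbn [In]; unfold ORC; lia). apply Hfr3; auto.
    + intros e He. destruct (Hgood e He) as [Hd He'].
      destruct (R2 e He) as [(J1 & J2 & J3)|(J1 & J2 & J3)].
      * rewrite J1, J2. split; [auto|]. intros HA1. destruct (He' HA1) as [G1 G2]. split; auto.
        intros Hd0. rewrite G2, part_succ, J3 by auto. lia.
      * rewrite J1, J3. split; [auto|]. intros _. split; [auto|lia].
    + lia.
    + right. split; [lia|]. revert R3. cs. lia.
Qed.

End Group.

(** * The whole counting program *)

Fixpoint epow (k : nat) (e : exp) : exp :=
  match k with O => EC 1 | S k' => epow k' e *! e end.

(* [lia] would expand powers with literal exponents; this constant keeps them folded. *)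
Definition bp (b : Z) (k : nat) : Z := b ^ Z.of_nat k.

Lemma bp_add b j k : bp b (j + k) = bp b j * bp b k.
Proof. unfold bp. rewrite Nat2Z.inj_add, Z.pow_add_r by lia. reflexivity. Qed.

Lemma bp_1 b : bp b 1 = b.
Proof. apply Z.pow_1_r. Qed.

Lemma bp_pos b k : 0 < b -> 0 < bp b k.
Proof. intros. apply Z.pow_pos_nonneg; lia. Qed.

Lemma bp_le_base b c k : 0 <= b <= c -> bp b k <= bp c k.
Proof. intros. apply Z.pow_le_mono_l. lia. Qed.

Lemma bp_le_exp b j k : 0 < b -> (j <= k)%nat -> bp b j <= bp b k.
Proof. intros. apply Z.pow_le_mono_r; lia. Qed.

Lemma bp_2 a k : 0 <= a -> bp (2 ^ a) k = 2 ^ (Z.of_nat k * a).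
Proof. intros. unfold bp. rewrite <- Z.pow_mul_r by lia. f_equal. lia. Qed.

Lemma ev_epow l h k e : ev l h (epow k e) = bp (ev l h e) k.
Proof.
  unfold bp. induction k; cbn [epow ev eval_binop]; [reflexivity|].
  rewrite IHk, Nat2Z.inj_succ, Z.pow_succ_r by lia. ring.
Qed.

Lemma ecost_epow k e : ecost (epow k e) = 1 + Z.of_nat k * (ecost e + 1).
Proof.
  induction k; cbn [epow ecost]; [reflexivity|]. rewrite IHk, Nat2Z.inj_succ. ring.
Qed.

(** With bounded loops only, the search for the power of two takes [n] rounds and idles once
    [b ^ 49 >= n]. Each doubling of b adds 49 to the exponent of N = 2^L kept in the second cell. *)
Definition size_cmd : cmd :=
  Sto TMP (EC 0) (EC 1) ;; Sto TMP (EC 1) (EC 0) ;;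
  For (EV 0) (If (epow 49 (EL TMP (EC 0)) <! EV 0)
    (Sto TMP (EC 0) (EC 2 *! EL TMP (EC 0)) ;; Sto TMP (EC 1) (EL TMP (EC 1) +! EC 49)) Skip).

Definition table_cmd : cmd :=
  Sto TP2 (EC 0) (EC 1) ;; Sto TP7 (EC 0) (EC 1) ;;
  For (EL TMP (EC 1))
    (Sto TP2 (EV 2 +! EC 1) (EC 2 *! EL TP2 (EV 2)) ;;
     Sto TP7 (EV 2 +! EC 1) (EC 7 *! EL TP7 (EV 2))).

(** Input from cells below 64 is fetched from its saved copy. The address [2 + 2 * e] of an
    adjacency cell is even, so the weight cell after it lies on the same side of 64 and one test
    decides for both. *)
Definition input_cmd : cmd :=
  For (EV 0 *! EV 0)
   (Let (EC 2 +! EC 2 *! EV 13)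
   (Let (EV 13 /! EV 0 *! EV 6 +! EV 13 %! EV 0)
   (If (EV 15 <! EC 64)
     (Sto ADJ (EV 16) (EL SAVE (EV 15)) ;; Sto WT (EV 16) (EL SAVE (EV 15 +! EC 1)))
     (LetR (EV 15) (Sto ADJ (EV 16) (EV 17)) ;;
      LetR (EV 15 +! EC 1) (Sto WT (EV 16) (EV 17)))))).

(** Off the edges [ANS] is not controlled; the factor [ADJ] keeps the written value in range. The
    bound [n >= 6] puts the output past the register cells, as [2 + 2 * 36 >= 64]. *)
Definition output_cmd : cmd :=
  For (EV 0 *! EV 0)
    (StR (EC 2 +! EC 2 *! EV 0 *! EV 0 +! EV 13)
         (EL ADJ (EV 13 /! EV 0 *! EV 6 +! EV 13 %! EV 0) *!
          EL ANS (EV 13 /! EV 0 *! EV 6 +! EV 13 %! EV 0))).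

(** The stride [S] exceeds the number [NB ^ 3] of calls, which separates their memories. Its surplus
    [3 * n * n + 4] pushes the cells that stand for negative oracle addresses beyond the input,
    since negative array indices lie at nonnegative addresses. *)
Definition main_cmd : cmd :=
  size_cmd ;; table_cmd ;;
  Let (EL TMP (EC 0)) (Let (EL TMP (EC 1)) (Let (EL TP7 (EV 3))
  (Let (epow 48 (EV 2)) (Let (EV 2 *! EV 5) (Let (epow 46 (EV 2)) (Let (epow 3 (EV 2))
  (Let (EV 6 *! EV 5) (Let (EV 6 *! EV 6)
  (Let (EV 5 *! EV 5 *! EV 5 +! EC 3 *! EV 0 *! EV 0 +! EC 4) (Let (EV 2 *! EV 2)
  (input_cmd ;; For (EV 5) group_cmd ;; output_cmd))))))))))).

Definition rv (h : heap) (x : Z) : Z := h (x mod 128) (-1 - x / 128).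

Lemma rv_upd h a v x : rv (updh h (a mod 128) (-1 - a / 128) v) x = if x =? a then v else rv h x.
Proof.
  unfold rv, updh. destruct (Z.eqb_spec x a) as [->|Hne]; [now rewrite !Z.eqb_refl|].
  destruct (Z.eqb_spec (x mod 128) (a mod 128)) as [E|E]; [|reflexivity].
  destruct (Z.eqb_spec (-1 - x / 128) (-1 - a / 128)) as [E2|E2]; [|now rewrite E].
  pose proof (Z.div_mod x 128 ltac:(lia)). pose proof (Z.div_mod a 128 ltac:(lia)). lia.
Qed.

(** * Correctness and running time of the main program *)

Section Main.
Variables (P : program) (w0 : nat) (Y Bm : Z).
Notation WP := (wp P w0 Y Bm).
Variables (nn K : nat) (t : Z) (adj : nat -> nat -> bool) (wt : nat -> nat -> Z).
Hypothesis Hinst : valid_instance K nn t adj wt.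
Variables (bn : nat) (a : Z).
Let n := Z.of_nat nn.
Let b := Z.of_nat bn.
Hypothesis Ha : 0 <= a.
Hypothesis Hba : b = 2 ^ a.
Hypothesis Hnb : n <= bp b 49.
Hypothesis Hmin : a = 0 \/ bp (2 ^ (a - 1)) 49 < n.
Hypothesis Hn6 : 6 <= n.
Variables L V NB N tau D H N2 S BB Wm : Z.
Hypothesis HLe : L = 49 * a.
Hypothesis HVe : V = 7 ^ L.
Hypothesis HNBe : NB = bp b 48.
Hypothesis HNe : N = b * NB.
Hypothesis Htaue : tau = bp b 46.
Hypothesis HDe : D = bp b 3.
Hypothesis HHe : H = N * NB.
Hypothesis HN2e : N2 = N * N.
Hypothesis HSe : S = NB * NB * NB + 3 * n * n + 4.
Hypothesis HBBe : BB = b * b.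
Hypothesis HWme : Wm = Z.of_nat (nn ^ K).
Notation env := [n; t; b; L; V; NB; N; tau; D; H; N2; S; BB].
Hypothesis HYN : 8 * N * N * N <= Y.
Hypothesis HSY : 256 * S <= Y.
Hypothesis HBS : (Bm + 2) * S <= Y.
Hypothesis HWY : 2 * Wm <= Y.
Variables (K' : nat) (Tm : Z).
Hypothesis HWm : Wm <= Z.of_nat ((3 * bn) ^ K').
Hypothesis HBm : 3 * b <= Bm /\ Wm <= Bm.
Hypothesis HTm : 0 <= Tm.
Hypothesis Horc : forall adj wt, valid_instance K' (3 * bn) t adj wt ->
  exists T M', exec w0 P T 0 (init_mem (3 * bn) t adj wt) = Some M' /\ Z.of_nat T <= Tm /\
    forall i j, (i < 3 * bn)%nat -> (j < 3 * bn)%nat -> adj i j = true ->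
      M' (out_addr (3 * bn) i j) = detect_answer (3 * bn) t adj wt i j.

Lemma b_pos : 0 < b.
Proof. rewrite Hba. apply Z.pow_pos_nonneg; lia. Qed.

Lemma N_eq : N = bp b 49.
Proof. rewrite HNe, HNBe, (bp_add b 1 48 : bp b 49 = _), bp_1. reflexivity. Qed.

Lemma N_2L : N = 2 ^ L.
Proof. rewrite N_eq, Hba, bp_2, HLe by lia. reflexivity. Qed.

Lemma N_Dtau : N = D * tau.
Proof. rewrite N_eq, HDe, Htaue, (bp_add b 3 46 : bp b 49 = _). reflexivity. Qed.

Lemma n_le_N : n <= N.
Proof. rewrite N_eq. exact Hnb. Qed.

Lemma NB_pos : 0 < NB.
Proof. rewrite HNBe. apply bp_pos, b_pos. Qed.

Lemma a_lt_b : a < b.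
Proof. rewrite Hba. apply Z.pow_gt_lin_r; lia. Qed.

(** Guarantees that [n] rounds of the search for [b] are enough. *)
Lemma a_le_n : a <= n.
Proof.
  destruct Hmin as [->|Hm]; [lia|].
  destruct (Z.lt_ge_cases (a - 1) 0) as [H0|H0]; [lia|].
  assert (H1 : a - 1 < 2 ^ (a - 1)) by (apply Z.pow_gt_lin_r; lia).
  assert (H2 : bp (2 ^ (a - 1)) 1 <= bp (2 ^ (a - 1)) 49).
  { apply bp_le_exp; [apply Z.pow_pos_nonneg; lia|lia]. }
  rewrite bp_1 in H2. lia.
Qed.

Lemma N_pos' : 0 < N.
Proof. pose proof n_le_N. lia. Qed.

Lemma b_le_N : b <= N.
Proof. rewrite HNe. pose proof b_pos as H1. pose proof NB_pos as H2. clear - H1 H2. nia. Qed.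

Lemma Y_N : 8 * N * N <= Y.
Proof. pose proof N_pos' as Hp. clear - HYN Hp. nia. Qed.

Lemma Y_1 : 8 * N <= Y /\ 8 * (n * n) <= Y /\ 50 * a + 50 <= Y.
Proof.
  pose proof N_pos'. pose proof n_le_N. pose proof Y_N as HY. pose proof a_le_n.
  assert (H8 : N * 1 <= N * N) by (apply Z.mul_le_mono_nonneg_l; lia).
  assert (H9 : n * n <= N * N) by (apply Z.mul_le_mono_nonneg; lia).
  assert (H10 : n * 6 <= n * n) by (apply Z.mul_le_mono_nonneg_l; lia).
  assert (H11 : 0 < NB * NB * NB) by (pose proof NB_pos; apply Z.mul_pos_pos; [apply Z.mul_pos_pos|]; lia).
  lia.
Qed.

Lemma updh_neg h k i v k' i' : 0 <= i -> i' < 0 -> updh h k i v k' i' = h k' i'.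
Proof.
  intros Hi Hi'. unfold updh. destruct (Z.eqb_spec k' k) as [->|]; [|reflexivity].
  now rewrite (proj2 (Z.eqb_neq i' i)) by lia.
Qed.

Lemma size_ok (Q : heap -> Z -> Prop) h s :
  (forall h' s', (forall k, k <> TMP -> h' k = h k) ->
    (forall k i, i < 0 -> h' k i = h k i) -> h' TMP 0 = b -> h' TMP 1 = L ->
    s' <= s + 1000 * n + 100 -> Q h' s') ->
  WP size_cmd Q [n; t] h s.
Proof.
  intros HQ. unfold size_cmd.
  pose proof b_pos as Hb. pose proof n_le_N as HnN. pose proof b_le_N as HbN.
  destruct Y_1 as (HY1 & HY2 & HaY).
  wseq. wsto 0 1; [reflexivity|reflexivity|lia|].
  wseq. wsto 1 0; [reflexivity|reflexivity|lia|].
  apply (wp_for _ _ _ _ n (fun x h' s' => (forall k, k <> TMP -> h' k = h k) /\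
    (forall k i, i < 0 -> h' k i = h k i) /\
    (exists a', 0 <= a' <= a /\ h' TMP 0 = 2 ^ a' /\ h' TMP 1 = 49 * a' /\ (a' = a \/ x <= a')) /\
    s' <= s + 60 + 1000 * x)); [reflexivity|lia| | |].
  - split; [intros; rewrite !updh_arr; auto|].
    split; [intros; rewrite !updh_neg by lia; auto|]. split; [|cs; lia].
    exists 0. rewrite updh_same, updh_idx, updh_same by lia. repeat split; lia.
  - intros x h1 s1 Hx (F1 & FN & (a' & A1 & A2 & A3 & A4) & F3). cbn [app].
    (* By minimality of [a], the test succeeds exactly until [a] is reached. *)
    assert (Hc : bp (2 ^ a') 49 < n <-> a' < a).
    { split; intros Hlt.
      - destruct (Z.eq_dec a' a) as [->|]; [|lia]. rewrite <- Hba in Hlt. lia.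
      - destruct Hmin as [->|Hm]; [lia|]. eapply Z.le_lt_trans; [|exact Hm].
        apply bp_le_base. split; [apply Z.pow_nonneg; lia|].
        apply Z.pow_le_mono_r; lia. }
    apply wp_if; cbn [ev nth app eval_binop]; rewrite ev_epow; cbn [ev]; rewrite A2;
      cbn [ecost]; rewrite ecost_epow; cbn [ecost]; intros Hif.
    + destruct (Z.ltb_spec (bp (2 ^ a') 49) n) as [Hlt|]; [|lia].
      assert (Hlt' : a' < a) by (apply Hc; auto).
      assert (Hp : 2 * 2 ^ a' <= b).
      { rewrite Hba, <- Z.pow_succ_r by lia. apply Z.pow_le_mono_r; lia. }
      assert (Hp0 : 0 < 2 ^ a') by (apply Z.pow_pos_nonneg; lia).
      wseq. wsto 0 (2 * 2 ^ a'); [reflexivity|rewrite A2; reflexivity|lia|].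
      wsto 1 (49 * a' + 49); [reflexivity|rewrite updh_idx by lia; rewrite A3; reflexivity|lia|].
      split; [intros; rewrite !updh_arr; auto|].
      split; [intros; rewrite !updh_neg by lia; auto|]. split; [|lia].
      exists (a' + 1). rewrite updh_same, updh_idx, updh_same by lia.
      split; [lia|]. split; [rewrite <- Z.pow_succ_r by lia; reflexivity|]. split; lia.
    + destruct (Z.ltb_spec (bp (2 ^ a') 49) n) as [|Hge]; [lia|].
      cbn [wp]. split; [auto|]. split; [auto|]. split; [|lia].
      exists a'. repeat split; auto; try lia.
  - intros h' s' (F1 & FN & (a' & A1 & A2 & A3 & A4) & F3).
    assert (a' = a) as -> by (pose proof a_le_n; lia).
    apply HQ; auto; [rewrite A2; auto|lia|lia].
Qed.

Lemma table_ok (Q : heap -> Z -> Prop) h s : h TMP 1 = L ->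
  (forall h' s', (forall k, k <> TP2 -> k <> TP7 -> h' k = h k) ->
    (forall k i, i < 0 -> h' k i = h k i) -> tables L h' ->
    s' <= s + 100 * L + 100 -> Q h' s') ->
  V <= Y -> L + 7 <= Y -> WP table_cmd Q [n; t] h s.
Proof.
  intros HTL HQ HVY HLY. unfold table_cmd.
  assert (HL : 0 <= L) by lia.
  wseq. wsto 0 1; [reflexivity|reflexivity|lia|].
  wseq. wsto 0 1; [reflexivity|reflexivity|lia|].
  apply (wp_for _ _ _ _ L (fun x h' s' => (forall k, k <> TP2 -> k <> TP7 -> h' k = h k) /\
    (forall k i, i < 0 -> h' k i = h k i) /\
    (forall i, 0 <= i <= x -> h' TP2 i = 2 ^ i /\ h' TP7 i = 7 ^ i) /\
    s' <= s + 60 + 100 * x)); [evs; rewrite !updh_arr by discriminate; auto|lia| | |].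
  - split; [intros; rewrite !updh_arr; auto|].
    split; [intros; rewrite !updh_neg by lia; auto|]. split; [|cs; lia].
    intros i Hi. replace i with 0 by lia. rewrite updh_same, updh_arr, updh_same by discriminate. auto.
  - intros x h1 s1 Hx (F1 & FN & F2 & F3). cbn [app].
    destruct (F2 x ltac:(lia)) as [E2 E7].
    assert (B7 : 7 * 7 ^ x <= V).
    { rewrite HVe, <- Z.pow_succ_r by lia. apply Z.pow_le_mono_r; lia. }
    assert (B2 : 0 <= 2 ^ x <= 7 ^ x) by (split; [apply Z.pow_nonneg|apply Z.pow_le_mono_l]; lia).
    wseq. wsto (x + 1) (2 ^ (x + 1)).
    { reflexivity. }
    { rewrite E2. rewrite <- Z.pow_succ_r by lia. reflexivity. }
    { change (x + 1) with (Z.succ x). rewrite Z.pow_succ_r by lia. lia. }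
    wsto (x + 1) (7 ^ (x + 1)).
    { reflexivity. }
    { rewrite updh_arr, E7 by discriminate. rewrite <- Z.pow_succ_r by lia. reflexivity. }
    { change (x + 1) with (Z.succ x). rewrite Z.pow_succ_r by lia. lia. }
    split; [intros; rewrite !updh_arr; auto|].
    split; [intros; rewrite !updh_neg by lia; auto|]. split; [|lia].
    intros i Hi. rewrite updh_at, (updh_arr _ TP7), updh_at by discriminate.
    rewrite (updh_arr h1 TP2) by discriminate.
    destruct (Z.eqb_spec i (x + 1)) as [->|]; [auto|]. apply F2; lia.
  - intros h' s' (F1 & FN & F2 & F3). apply HQ; auto; lia.
Qed.

Definition A0 (e : Z) : Z :=
  if (e / N <? n) && (e mod N <? n) then
    (if adj (Z.to_nat (e / N)) (Z.to_nat (e mod N)) then 1 else 0) else 0.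
Definition W0 (e : Z) : Z :=
  if (e / N <? n) && (e mod N <? n) then
    (if adj (Z.to_nat (e / N)) (Z.to_nat (e mod N)) then
       wt (Z.to_nat (e / N)) (Z.to_nat (e mod N)) else 0) else 0.

Lemma A0_ij i j : 0 <= i < n -> 0 <= j < n ->
  A0 (i * N + j) = if adj (Z.to_nat i) (Z.to_nat j) then 1 else 0.
Proof.
  intros Hi Hj. pose proof n_le_N. unfold A0. rewrite dm_div, dm_mod by lia.
  now rewrite (proj2 (Z.ltb_lt i n)), (proj2 (Z.ltb_lt j n)) by lia.
Qed.

Lemma W0_ij i j : 0 <= i < n -> 0 <= j < n ->
  W0 (i * N + j) = if adj (Z.to_nat i) (Z.to_nat j) then wt (Z.to_nat i) (Z.to_nat j) else 0.
Proof.
  intros Hi Hj. pose proof n_le_N. unfold W0. rewrite dm_div, dm_mod by lia.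
  now rewrite (proj2 (Z.ltb_lt i n)), (proj2 (Z.ltb_lt j n)) by lia.
Qed.

Lemma A0_01 e : A0 e = 0 \/ A0 e = 1.
Proof. unfold A0. destruct (_ && _); auto. destruct (adj _ _); auto. Qed.

Lemma W0_0 e : A0 e = 0 -> W0 e = 0.
Proof. unfold A0, W0. destruct (_ && _); auto. destruct (adj _ _); auto. lia. Qed.

Lemma W0_bnd e : 0 <= e < N * N -> Z.abs (W0 e) <= Wm.
Proof.
  intros He. destruct (dm_range e N N He N_pos') as (D1 & D2 & D3).
  unfold W0. destruct (Z.ltb_spec (e / N) n), (Z.ltb_spec (e mod N) n); cbn [andb];
    try lia.
  destruct (adj _ _) eqn:E; [|lia].
  destruct Hinst as (_ & _ & _ & Hw & _). rewrite HWme. apply Hw; auto; lia.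
Qed.

Lemma A0_sym i j : 0 <= i < N -> 0 <= j < N -> A0 (i * N + j) = A0 (j * N + i).
Proof.
  intros Hi Hj. unfold A0. rewrite !dm_div, !dm_mod by lia. rewrite andb_comm.
  destruct (Z.ltb_spec j n), (Z.ltb_spec i n); cbn [andb]; auto.
  destruct Hinst as (Hs & _). rewrite Hs; auto; lia.
Qed.

Lemma W0_sym i j : 0 <= i < N -> 0 <= j < N -> W0 (i * N + j) = W0 (j * N + i).
Proof.
  intros Hi Hj. unfold W0. rewrite !dm_div, !dm_mod by lia. rewrite andb_comm.
  destruct (Z.ltb_spec j n), (Z.ltb_spec i n); cbn [andb]; auto.
  destruct Hinst as (Hs & _ & Hw & _). rewrite Hs, Hw by (lia). reflexivity.
Qed.

Lemma init_cells e : 0 <= e < n * n ->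
  init_mem nn t adj wt (2 + 2 * e) = A0 (e / n * N + e mod n) /\
  init_mem nn t adj wt (2 + 2 * e + 1) = W0 (e / n * N + e mod n).
Proof.
  intros He. destruct (dm_range e n n He ltac:(lia)) as (D1 & D2 & D3).
  rewrite A0_ij, W0_ij by auto. unfold init_mem. fold n.
  replace (2 + 2 * e =? 0) with false by lia. replace (2 + 2 * e =? 1) with false by lia.
  replace (2 + 2 * e + 1 =? 0) with false by lia. replace (2 + 2 * e + 1 =? 1) with false by lia.
  replace (2 <=? 2 + 2 * e) with true by lia. replace (2 <=? 2 + 2 * e + 1) with true by lia.
  replace (2 + 2 * e <? 2 + 2 * n * n) with true by lia.
  replace (2 + 2 * e + 1 <? 2 + 2 * n * n) with true by lia. cbn [andb].
  replace (2 + 2 * e - 2) with (e * 2 + 0) by lia.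
  replace (2 + 2 * e + 1 - 2) with (e * 2 + 1) by lia.
  rewrite !dm_div, !dm_mod by lia. cbn [Z.eqb]. auto.
Qed.

Lemma input_ok (Q : heap -> Z -> Prop) h s :
  (forall x, 0 <= x < 64 -> x < 2 + 2 * n * n -> h SAVE x = init_mem nn t adj wt x) ->
  (forall x, 64 <= x < 2 + 2 * n * n -> rv h x = init_mem nn t adj wt x) ->
  (forall i, 0 <= i < N * N -> h ADJ i = 0 /\ h WT i = 0) ->
  (forall h' s', (forall k, k <> ADJ -> k <> WT -> h' k = h k) ->
    (forall e, 0 <= e < N * N -> h' ADJ e = A0 e /\ h' WT e = W0 e) ->
    s' <= s + 200 * (n * n) + 100 -> Q h' s') ->
  WP input_cmd Q env h s.
Proof.
  intros HSv Hrv H0 HQ. unfold input_cmd.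
  pose proof n_le_N as HnN. pose proof N_pos' as HNp.
  pose proof Y_N as HYN1.
  assert (HnN2 : n * n <= N * N) by (apply Z.mul_le_mono_nonneg; lia).
  (* Entries that no later round writes are final; for the padding this is true from the start,
     because it consists of zeros. The negative indices have to stay untouched since the raw input
     lies there. *)
  apply (wp_for _ _ _ _ (n * n) (fun x h' s' => (forall k, k <> ADJ -> k <> WT -> h' k = h k) /\
    (forall k i, i < 0 -> h' k i = h k i) /\
    (forall i, 0 <= i < N * N -> (forall e, x <= e < n * n -> i <> e / n * N + e mod n) ->
       h' ADJ i = A0 i /\ h' WT i = W0 i) /\
    (forall i, 0 <= i < N * N -> (forall e, 0 <= e < x -> i <> e / n * N + e mod n) ->
       h' ADJ i = 0 /\ h' WT i = 0) /\
    s' <= s + 60 + x * 200)).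
  - reflexivity.
  - lia.
  - split; [auto|]. split; [auto|]. split; [|split; [auto|cs; lia]].
    intros i Hi Hne. destruct (dm_range i N N Hi HNp) as (D1 & D2 & D3).
    assert (E : i / N < n -> i mod N < n -> False).
    { intros I1 I2. apply (Hne (i / N * n + i mod N)).
      - apply dm_lt; lia.
      - rewrite dm_div, dm_mod by lia. auto. }
    unfold A0, W0. destruct (Z.ltb_spec (i / N) n), (Z.ltb_spec (i mod N) n); cbn [andb]; auto.
    exfalso; auto.
  - intros e h1 s1 He (F1 & F2 & F3 & F4 & F5). cbn [app].
    destruct (dm_range e n n He ltac:(lia)) as (D1 & D2 & D3).
    destruct (init_cells e He) as [IA IW].
    set (i := e / n * N + e mod n) in *.
    assert (Hi : 0 <= i < N * N) by (apply dm_lt; lia).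
    assert (Hinj : forall e', 0 <= e' < n * n -> i = e' / n * N + e' mod n -> e' = e).
    { intros e' He' E. destruct (dm_range e' n n He' ltac:(lia)) as (D1' & D2' & D3').
      unfold i in E. apply dm_inj in E; [|lia|lia]. destruct E as [E1 E2].
      rewrite D3, D3', E1, E2. reflexivity. }
    pose proof (W0_bnd i Hi) as HWb.
    assert (Hfin : forall h2 s2, (forall k, k <> ADJ -> k <> WT -> h2 k = h1 k) ->
      (forall j, h2 ADJ j = if j =? i then A0 i else h1 ADJ j) ->
      (forall j, h2 WT j = if j =? i then W0 i else h1 WT j) -> s2 <= s1 + 200 ->
      (forall k, k <> ADJ -> k <> WT -> h2 k = h k) /\
      (forall k i, i < 0 -> h2 k i = h k i) /\
      (forall j, 0 <= j < N * N -> (forall e', e + 1 <= e' < n * n -> j <> e' / n * N + e' mod n) ->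
         h2 ADJ j = A0 j /\ h2 WT j = W0 j) /\
      (forall j, 0 <= j < N * N -> (forall e', 0 <= e' < e + 1 -> j <> e' / n * N + e' mod n) ->
         h2 ADJ j = 0 /\ h2 WT j = 0) /\
      s2 <= s + 60 + (e + 1) * 200).
    { intros h2 s2 G1 G2 G3 G4. split; [|split; [|split; [|split]]].
      - intros k K1 K2. rewrite G1, F1; auto.
      - intros k j Hj. destruct (Z.eq_dec k ADJ) as [->|]; [|destruct (Z.eq_dec k WT) as [->|]].
        + rewrite G2, (proj2 (Z.eqb_neq j i)) by lia. auto.
        + rewrite G3, (proj2 (Z.eqb_neq j i)) by lia. auto.
        + rewrite G1 by auto. auto.
      - intros j Hj Hne. rewrite G2, G3. destruct (Z.eqb_spec j i) as [->|Hji]; [auto|].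
        apply F3; auto. intros e' He' E. destruct (Z.eq_dec e' e) as [->|]; [auto|].
        apply (Hne e'); auto; lia.
      - intros j Hj Hne. rewrite G2, G3. destruct (Z.eqb_spec j i) as [->|Hji].
        + exfalso. apply (Hne e); auto; lia.
        + apply F4; auto. intros e' He'. apply Hne. lia.
      - lia. }
    assert (HA01 : Z.abs (A0 i) <= Y) by (destruct (A0_01 i); lia).
    wlet (2 + 2 * e); [reflexivity|lia|].
    wlet i; [reflexivity|lia|].
    apply wp_if; evs; intros Hif.
    + destruct (Z.ltb_spec (2 + 2 * e) 64) as [Hlt|]; [|lia].
      wseq. wsto i (A0 i); [reflexivity| |lia|].
      { rewrite F1, HSv by (discriminate || lia). auto. }
      wsto i (W0 i); [reflexivity| |lia|].
      { rewrite updh_arr, F1, HSv by (discriminate || lia). auto. }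
      apply Hfin.
      * intros. rewrite !updh_arr; auto.
      * intros j. rewrite updh_arr by discriminate. apply updh_at.
      * intros j. rewrite updh_at. now rewrite updh_arr by discriminate.
      * lia.
    + destruct (Z.ltb_spec (2 + 2 * e) 64) as [|Hge]; [lia|].
      assert (Hraw : forall x, 64 <= x < 2 + 2 * n * n ->
        h1 (x mod 128) (-1 - x / 128) = init_mem nn t adj wt x).
      { intros x Hx. rewrite <- Hrv by auto. apply F2.
        assert (0 <= x / 128) by (apply Z.div_pos; lia). lia. }
      wseq. apply (wp_letr _ _ _ _ (2 + 2 * e)); [reflexivity|lia|]. cs. cbn [app].
      rewrite Hraw, IA by lia.
      wsto i (A0 i); [reflexivity|reflexivity|lia|].
      apply (wp_letr _ _ _ _ (2 + 2 * e + 1)); [reflexivity|lia|]. cs. cbn [app].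
      (* The raw address may belong to array [ADJ], but at a negative index, out of reach of the
         write at [i >= 0] just made. *)
      assert (E1 : updh h1 ADJ i (A0 i) ((2 + 2 * e + 1) mod 128) (-1 - (2 + 2 * e + 1) / 128) = W0 i).
      { assert (0 <= (2 + 2 * e + 1) / 128) by (apply Z.div_pos; lia).
        rewrite <- IW, <- Hraw by lia. unfold updh.
        destruct (Z.eqb_spec ((2 + 2 * e + 1) mod 128) ADJ) as [E|E]; [|reflexivity].
        rewrite (proj2 (Z.eqb_neq _ i)) by lia. now rewrite E. }
      rewrite E1.
      wsto i (W0 i); [reflexivity|reflexivity|lia|].
      apply Hfin.
      * intros. rewrite !updh_arr; auto.
      * intros j. rewrite updh_arr by discriminate. apply updh_at.
      * intros j. rewrite updh_at. now rewrite updh_arr by discriminate.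
      * lia.
  - intros h' s' (F1 & F2 & F3 & F4 & F5). apply HQ; auto; [|lia].
    intros e He. apply F3; auto. intros; lia.
Qed.

Lemma output_ok (Q : heap -> Z -> Prop) h s :
  (forall e, 0 <= e < n * n ->
     Z.abs (h ADJ (e / n * N + e mod n) * h ANS (e / n * N + e mod n)) <= Y) ->
  (forall h' s', (forall e, 0 <= e < n * n ->
       rv h' (2 + 2 * n * n + e) = h ADJ (e / n * N + e mod n) * h ANS (e / n * N + e mod n)) ->
    s' <= s + 150 * (n * n) + 100 -> Q h' s') ->
  WP output_cmd Q env h s.
Proof.
  intros Hb HQ. unfold output_cmd.
  pose proof n_le_N as HnN. pose proof N_pos' as HNp.
  pose proof Y_N as HYN1.
  assert (HnN2 : n * n <= N * N) by (apply Z.mul_le_mono_nonneg; lia).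
  assert (Hn36 : 36 <= n * n) by (clear - Hn6; nia).
  apply (wp_for _ _ _ _ (n * n) (fun x h' s' =>
    (forall k i, 0 <= i -> h' k i = h k i) /\
    (forall e, 0 <= e < x -> rv h' (2 + 2 * n * n + e) =
       h ADJ (e / n * N + e mod n) * h ANS (e / n * N + e mod n)) /\
    s' <= s + 60 + x * 150)); [reflexivity|lia| | |].
  - split; [auto|]. split; [intros; lia|cs; lia].
  - intros e h1 s1 He (F1 & F2 & F3). cbn [app].
    destruct (dm_range e n n He ltac:(lia)) as (D1 & D2 & D3).
    assert (Hi : 0 <= e / n * N + e mod n) by (clear - D1 D2 HNp; nia).
    apply (wp_str _ _ _ _ (2 + 2 * n * n + e)
      (h ADJ (e / n * N + e mod n) * h ANS (e / n * N + e mod n))).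
    + reflexivity.
    + evs. rewrite !F1 by auto. reflexivity.
    + lia.
    + apply Hb; auto.
    + split; [|split].
      * intros k i Hi'. unfold updh. assert (0 <= (2 + 2 * n * n + e) / 128) by (apply Z.div_pos; lia).
        destruct (Z.eqb_spec k ((2 + 2 * n * n + e) mod 128)) as [E|E]; [|auto].
        rewrite (proj2 (Z.eqb_neq i _)) by lia. rewrite <- E. auto.
      * intros e' He'. rewrite rv_upd. destruct (Z.eqb_spec (2 + 2 * n * n + e') (2 + 2 * n * n + e)).
        -- replace e' with e by lia. reflexivity.
        -- apply F2. lia.
      * cs. lia.
  - intros h' s' (F1 & F2 & F3). apply HQ; auto. lia.
Qed.

(* Cost of every group, and additional cost of a group with many flagged edges; each of the
   latter settles at least [H = N ^ 2 / b] edges, so there are at most [b] of them. *)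
Definition C1 : Z := NB * NB * (15000 * BB + 13 * Tm + 510) + 500 * N2 + 300 * b * H + 500.
Definition C2 : Z := b * (N * N * (100 * tau + 1700) + 3010 * D * (L + 1) * V + 100).

Lemma V_le_N3 : V <= N * N * N.
Proof.
  rewrite HVe, N_2L, <- !Z.pow_mul_l. apply Z.pow_le_mono_l. lia.
Qed.

Lemma D_pos : 0 < D /\ 0 < tau /\ 0 < V /\ 0 <= L.
Proof.
  pose proof b_pos. rewrite HDe, Htaue. repeat split; try (apply bp_pos; auto).
  - rewrite HVe. apply Z.pow_pos_nonneg; lia.
  - lia.
Qed.

Lemma loop_ok (Q : heap -> Z -> Prop) h s :
  (forall e, 0 <= e < N * N -> h ADJ e = A0 e /\ h WT e = W0 e) ->
  tables L h -> fresh NB S h 0 ->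
  (forall e, 0 <= e < N * N -> h DONE e = 0 /\ h ANS e = 0) ->
  (forall h' s', h' ADJ = h ADJ ->
    (forall e, 0 <= e < N * N -> h ADJ e = 1 -> h' ANS e = tot t N (h ADJ) (h WT) e) ->
    s' <= s + NB * (C1 + 6) + b * C2 + 100 -> Q h' s') ->
  WP (For (EV 5) group_cmd) Q env h s.
Proof.
  intros HAW Htab Hfr Hz HQ.
  pose proof b_pos as Hb. pose proof NB_pos as HNB. pose proof N_pos' as HNp.
  pose proof N_Dtau as HDt. destruct D_pos as (HD0 & Ht0 & HV0 & HL0).
  destruct Y_1 as (HY1 & HY2 & HY3). pose proof Y_N as HYN2. pose proof b_le_N as HbN.
  assert (HNBN : NB <= N) by (rewrite HNe; clear - Hb HNB; nia).
  assert (HH0 : 0 < H) by (rewrite HHe; clear - HNp HNB; nia).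
  assert (HC2 : 0 <= C2).
  { unfold C2. apply Z.mul_nonneg_nonneg; [lia|].
    assert (0 <= N * N * (100 * tau + 1700)) by (apply Z.mul_nonneg_nonneg; [clear - HNp; nia|lia]).
    assert (0 <= 3010 * D * (L + 1) * V) by (apply Z.mul_nonneg_nonneg; [|lia]; apply Z.mul_nonneg_nonneg; lia).
    lia. }
  assert (HBBY : 20 * BB <= Y).
  { rewrite HBBe. assert (NB * NB * NB >= b * b).
    { assert (b <= NB) by (rewrite HNBe; rewrite <- (bp_1 b) at 1; apply bp_le_exp; lia).
      assert (b * b <= NB * NB) by (apply Z.mul_le_mono_nonneg; lia).
      assert (NB * NB * 1 <= NB * NB * NB) by (apply Z.mul_le_mono_nonneg_l; [clear - HNB; nia|lia]). lia. }
    assert (0 <= n * n) by (clear - Hn6; nia). lia. }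
  assert (HWm0 : 0 <= Wm) by lia.
  assert (HSN : NB * NB * NB < S) by (assert (0 <= n * n) by (clear - Hn6; nia); lia).
  assert (Htt : Z.abs t <= Wm) by (rewrite HWme; apply Hinst).
  (* The witness [hg] is the number of expensive groups so far, each of which has contributed [H]
     settled edges. *)
  apply (wp_for _ _ _ _ NB (fun g h' s' => h' ADJ = h ADJ /\ h' WT = h WT /\
    h' TP2 = h TP2 /\ h' TP7 = h TP7 /\ fresh NB S h' (g * NB * NB) /\
    good t bn N (h ADJ) (h WT) g (h' DONE) (h' ANS) /\
    (exists hg, 0 <= hg /\ hg * H <= nd N2 h' /\ s' <= s + 20 + g * (C1 + 6) + hg * C2))).
  - reflexivity.
  - lia.
  - repeat split; auto; try (intros; lia).
    + left. apply Hz; auto.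
    + rewrite (proj1 (Hz _ ltac:(eassumption))). lia.
    + intros _. rewrite (proj2 (Hz _ ltac:(eassumption))). unfold part. rewrite Z.mul_0_l, zs_0. reflexivity.
    + exists 0. split; [lia|]. split; [|cs; lia]. unfold nd. rewrite zs_zero; [lia|].
      intros e He. apply Hz. lia.
  - intros g h1 s1 Hg (F1 & F2 & F3 & F4 & F5 & F6 & (hg & G1 & G2 & G3)). cbn [app].
    apply (group_ok P w0 Y Bm n t bn L V NB N tau D H N2 S BB g Hb HNB HNe HBBe Hg HYN HBBY HSN HSY HBS
      HL0 N_2L HVe HN2e HDt Ht0 ltac:(lia) (h ADJ) (h WT) Wm K' Tm); auto; try lia.
    { intros e He. rewrite (proj1 (HAW e He)). apply A0_01. }
    { intros e He. rewrite (proj2 (HAW e He)). apply W0_bnd; auto. }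
    { intros e He. rewrite (proj1 (HAW e He)), (proj2 (HAW e He)). apply W0_0. }
    { intros i j Hi Hj. rewrite !(fun e He => proj1 (HAW e He)) by (apply dm_lt; auto).
      apply A0_sym; auto. }
    { intros i j Hi Hj. rewrite !(fun e He => proj2 (HAW e He)) by (apply dm_lt; auto).
      apply W0_sym; auto. }
    { intros x Hx. rewrite F3, F4. apply Htab; auto. }
    intros h2 s2 K1 K2 K3 K4 K5 K6 K7 K8.
    split; [auto|]. split; [auto|]. split; [congruence|]. split; [congruence|].
    split; [auto|]. split; [auto|].
    assert (HbH : 0 <= 300 * b * H) by (clear - Hb HH0; nia).
    destruct K8 as [K8|[K8 K9]].
    + exists hg. split; [auto|]. split; [lia|]. unfold C1 in *. lia.
    + exists (hg + 1). split; [lia|]. split; [lia|].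
      change (Z.of_nat bn) with b in K9. unfold C1, C2 in *. lia.
  - intros h1 s1 (F1 & F2 & F3 & F4 & F5 & F6 & (hg & G1 & G2 & G3)). apply HQ; auto.
    + intros e He HA1. destruct (F6 e He) as [Hd He']. destruct (He' HA1) as [J1 J2].
      destruct Hd as [Hd|Hd]; [|auto]. rewrite J2 by auto. unfold part, tot.
      f_equal. rewrite HNe. fold b. ring.
    + assert (Hnd : nd N2 h1 <= N2 * 1).
      { unfold nd. rewrite <- zs_const by (rewrite HN2e; clear - HNp; nia). apply zs_le.
        intros e He. rewrite HN2e in He. destruct (F6 e He) as [[E|E] _]; rewrite E; lia. }
      assert (Hhg : hg <= b).
      { assert (E : N2 = b * H) by (rewrite HN2e, HHe; rewrite HNe at 2; ring).
        apply (Z.mul_le_mono_pos_r _ _ H HH0). lia. }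
      assert (hg * C2 <= b * C2) by (apply Z.mul_le_mono_nonneg_r; auto). lia.
Qed.

Lemma filter_count (f : nat -> bool) m :
  Z.of_nat (length (filter f (seq 0 m))) = zs (Z.of_nat m) (fun k => b2z (f (Z.to_nat k))).
Proof.
  induction m; [reflexivity|].
  rewrite seq_S, filter_app, length_app, Nat2Z.inj_add, IHm, Nat2Z.inj_succ.
  unfold Z.succ. rewrite zs_succ by lia. rewrite Nat2Z.id. f_equal. cbn [filter Nat.add].
  destruct (f m); reflexivity.
Qed.

Lemma count_spec A W i j :
  (forall e, 0 <= e < N * N -> A e = A0 e /\ W e = W0 e) ->
  (i < nn)%nat -> (j < nn)%nat -> adj i j = true ->
  tot t N A W (Z.of_nat i * N + Z.of_nat j) = count_answer nn t adj wt i j.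
Proof.
  intros HAW Hi Hj Hij. pose proof n_le_N as HnN.
  unfold count_answer. rewrite filter_count. fold n. unfold tot.
  replace N with (n + (N - n)) at 1 by lia. rewrite zs_split by lia.
  assert (Hr : forall x, 0 <= x < n -> 0 <= x < N) by lia.
  rewrite (zs_zero (N - n)).
  - rewrite Z.add_0_r. apply zs_ext. intros k Hk. unfold cl, clo.
    rewrite dm_div, dm_mod by lia.
    rewrite !(fun e He => proj1 (HAW e He)), !(fun e He => proj2 (HAW e He)) by (apply dm_lt; lia).
    rewrite !A0_ij, !W0_ij by lia. rewrite !Nat2Z.id, Hij. unfold closes.
    destruct (adj i (Z.to_nat k)), (adj j (Z.to_nat k)); cbn [andb b2z]; try lia.
  - intros k Hk. unfold cl, clo. rewrite dm_div, dm_mod by lia.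
    rewrite (proj1 (HAW (Z.of_nat i * N + (n + k)) ltac:(apply dm_lt; lia))).
    unfold A0 at 1. rewrite dm_div, dm_mod by lia.
    rewrite (proj2 (Z.ltb_ge (n + k) n)) by lia. rewrite andb_false_r. lia.
Qed.

(** All terms other than the oracle time are compared with [U = N * N * NB], which is N^3/b; the
    numerical constants are generous. *)
Lemma time_bound : NB * (C1 + 6) + b * C2 + 3000 * (n * n) + 10000 * L + 10000 <=
  1000000 * (N * N * NB) + 13 * (NB * NB * NB * Tm).
Proof.
  pose proof b_pos as Hb. pose proof NB_pos as HNB. pose proof N_pos' as HNp. pose proof n_le_N as HnN.
  destruct D_pos as (HD0 & Ht0 & HV0 & HL0). pose proof a_lt_b as Hab. pose proof a_le_n as Han.
  set (U := N * N * NB).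
  assert (HN2U : N * N <= U).
  { unfold U. rewrite <- (Z.mul_1_r (N * N)) at 1. apply Z.mul_le_mono_nonneg_l; [clear - HNp; nia|lia]. }
  assert (HNN : N <= N * N) by (clear - HNp; nia).
  assert (Hnn : n * n <= N * N) by (apply Z.mul_le_mono_nonneg; lia).
  assert (E1 : NB * NB * NB * BB = U) by (unfold U; rewrite HBBe, HNe; ring).
  assert (HBB0 : 1 <= BB) by (rewrite HBBe; clear - Hb; nia).
  assert (E2 : NB * NB * NB <= U).
  { rewrite <- E1. rewrite <- (Z.mul_1_r (NB * NB * NB)) at 1. apply Z.mul_le_mono_nonneg_l; [|lia].
    apply Z.mul_nonneg_nonneg; [|lia]. clear - HNB; nia. }
  assert (E3 : NB * (b * H) = U) by (unfold U; rewrite HHe; rewrite HNe at 2; rewrite HNe; ring).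
  assert (E4 : NB * N2 = U) by (unfold U; rewrite HN2e; ring).
  assert (Eb : b * b * tau = NB).
  { rewrite HNBe, Htaue, (bp_add b 2 46 : bp b 48 = _), (bp_add b 1 1 : bp b 2 = _), bp_1. reflexivity. }
  assert (Hb2 : b * b <= NB) by (rewrite <- Eb; clear - Hb Ht0; nia).
  (* At most b expensive groups with b pivots each: [b * b * tau = NB] is what the frequency
     threshold N/b^3 is chosen for. *)
  assert (E5 : b * (b * (N * N * (100 * tau + 1700))) <= 1800 * U).
  { replace (b * (b * (N * N * (100 * tau + 1700)))) with
      (100 * (N * N * (b * b * tau)) + 1700 * (N * N * (b * b))) by ring.
    rewrite Eb. fold U.
    assert (N * N * (b * b) <= U) by (unfold U; apply Z.mul_le_mono_nonneg_l; [clear - HNp; nia|lia]). lia. }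
  (* With [L = 49 * a] and [b = 2 ^ a], the inequality [H7] is the [a]-th power of 7^49 * 2^7 <=
     8^49, which is checked by computation. *)
  assert (E6 : V * bp b 6 <= U).
  { assert (H7 : V * bp b 7 <= N * N * N).
    { rewrite N_2L, <- !Z.pow_mul_l, HVe, Hba, bp_2, HLe by lia.
      rewrite !Z.pow_mul_r by lia. rewrite <- Z.pow_mul_l. apply Z.pow_le_mono_l.
      split; [vm_compute; discriminate|]. vm_compute. discriminate. }
    rewrite (bp_add b 6 1 : bp b 7 = _), bp_1 in H7.
    replace (N * N * N) with (U * b) in H7 by (unfold U; rewrite HNe at 3; ring).
    clear - H7 Hb. nia. }
  (* Six factors b: expensive groups, pivots, three for the [D] products, and one for the levels,
     since [L + 1 <= 50 * b]. *)
  assert (E7 : b * (b * (3010 * D * (L + 1) * V)) <= 150500 * U).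
  { assert (HL50 : L + 1 <= 50 * b) by lia.
    replace (b * (b * (3010 * D * (L + 1) * V))) with (3010 * (b * b * D * V * (L + 1))) by ring.
    assert (E8 : b * b * D * V * (50 * b) = 50 * (V * bp b 6)).
    { rewrite HDe, (bp_add b 3 3 : bp b 6 = _).
      replace (bp b 3) with (b * (b * b)) at 2; [ring|].
      rewrite (bp_add b 1 2 : bp b 3 = _), (bp_add b 1 1 : bp b 2 = _), bp_1. reflexivity. }
    assert (b * b * D * V * (L + 1) <= b * b * D * V * (50 * b)).
    { apply Z.mul_le_mono_nonneg_l; [|lia]. repeat (apply Z.mul_nonneg_nonneg; try lia). }
    lia. }
  assert (E9 : NB * (C1 + 6) <= 17000 * U + 13 * (NB * NB * NB * Tm)).
  { unfold C1. replace (NB * (NB * NB * (15000 * BB + 13 * Tm + 510) + 500 * N2 + 300 * b * H + 500 + 6))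
      with (15000 * (NB * NB * NB * BB) + 13 * (NB * NB * NB * Tm) + 510 * (NB * NB * NB)
        + 500 * (NB * N2) + 300 * (NB * (b * H)) + 506 * NB) by ring.
    assert (NB <= N) by (rewrite HNe; clear - Hb HNB; nia). lia. }
  assert (E10 : b * C2 <= 160000 * U).
  { unfold C2. replace (b * (b * (N * N * (100 * tau + 1700) + 3010 * D * (L + 1) * V + 100)))
      with (b * (b * (N * N * (100 * tau + 1700))) + b * (b * (3010 * D * (L + 1) * V)) + 100 * (b * b))
      by ring.
    assert (NB <= N) by (rewrite HNe; clear - Hb HNB; nia). lia. }
  lia.
Qed.

Lemma main_ok (Q : heap -> Z -> Prop) h s :
  (forall k i, 0 <= i -> k <> SAVE -> h k i = 0) ->
  (forall x, 0 <= x < 64 -> h SAVE x = init_mem nn t adj wt x) ->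
  (forall x, 64 <= x -> rv h x = init_mem nn t adj wt x) ->
  (forall h' s', (forall i j, (i < nn)%nat -> (j < nn)%nat -> adj i j = true ->
       rv h' (out_addr nn i j) = count_answer nn t adj wt i j) ->
    s' <= s + 1000000 * (N * N * NB) + 13 * (NB * NB * NB * Tm) -> Q h' s') ->
  WP main_cmd Q [n; t] h s.
Proof.
  intros Hz Hsv Hrv HQ. unfold main_cmd.
  pose proof b_pos as Hb. pose proof NB_pos as HNB. pose proof N_pos' as HNp. pose proof n_le_N as HnN.
  destruct D_pos as (HD0 & Ht0 & HV0 & HL0). destruct Y_1 as (HY1 & HY2 & HY3).
  pose proof Y_N as HYN2. pose proof b_le_N as HbN. pose proof V_le_N3 as HVN.
  pose proof N_Dtau as HDt.
  assert (HNBN : NB <= N) by (rewrite HNe; clear - Hb HNB; nia).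
  assert (HVY : V <= Y).
  { assert (0 <= N * N * N) by (apply Z.mul_nonneg_nonneg; [clear - HNp; nia|lia]). lia. }
  assert (HtN : tau <= N /\ D <= N) by (rewrite HDt; clear - HD0 Ht0; nia).
  assert (HHN : 0 <= H <= N * N).
  { rewrite HHe. split; [clear - HNp HNB; nia|]. apply Z.mul_le_mono_nonneg_l; lia. }
  assert (Hnn0 : 36 <= n * n) by (clear - Hn6; nia).
  assert (HNB3 : 0 < NB * NB * NB) by (apply Z.mul_pos_pos; [apply Z.mul_pos_pos|]; lia).
  assert (HBB0 : 0 <= BB <= N * N).
  { rewrite HBBe. split; [clear - Hb; nia|]. apply Z.mul_le_mono_nonneg; lia. }
  wseq. apply size_ok. intros h1 s1 F1 FN F2 F3 F4.
  wseq. apply table_ok; auto; [|lia]. intros h2 s2 G1 GN G2 G3.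
  wlet b; [rewrite G1 by discriminate; auto|lia|].
  wlet L; [rewrite G1 by discriminate; auto|lia|].
  wlet V; [rewrite HVe; apply G2; lia|lia|].
  wlet NB; [rewrite ev_epow; auto|lia|].
  wlet N; [auto|lia|].
  wlet tau; [rewrite ev_epow; auto|lia|].
  wlet D; [rewrite ev_epow; auto|lia|].
  wlet H; [auto|lia|].
  wlet N2; [auto|lia|].
  wlet S; [auto|lia|].
  wlet BB; [auto|lia|].
  rewrite !ecost_epow. cbn [ecost].
  assert (E2 : forall k, k <> TMP -> k <> TP2 -> k <> TP7 -> h2 k = h k).
  { intros k K1 K2 K3. rewrite G1, F1; auto. }
  wseq. apply input_ok.
  { intros x Hx _. rewrite E2 by discriminate. auto. }
  { intros x Hx. rewrite <- Hrv by lia. unfold rv.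
    assert (H0 : 0 <= x / 128) by (apply Z.div_pos; lia).
    rewrite GN, FN by lia. reflexivity. }
  { intros i Hi. rewrite !E2 by discriminate. split; apply Hz; try lia; discriminate. }
  intros h3 s3 J1 J2 J3. wseq.
  apply loop_ok; auto.
  { intros x Hx. rewrite !J1 by discriminate. apply G2; auto. }
  { intros z q Hq. rewrite J1, E2 by discriminate.
    destruct (Z.lt_ge_cases z 0) as [Hz0|Hz0].
    (* Cells for negative oracle addresses share the address range of the input; the surplus in [S]
       places them past its end, where memory is still zero. *)
    - assert (Hi : z * S + q <= - (n * n + 4)).
      { assert (z * S <= -1 * S) by (apply Z.mul_le_mono_nonneg_r; lia). lia. }
      set (i := z * S + q) in *.
      assert (Hx : 64 <= ORC - 128 * (i + 1)) by (unfold ORC; lia).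
      specialize (Hrv _ Hx). unfold rv in Hrv.
      replace (ORC - 128 * (i + 1)) with ((-1 - i) * 128 + ORC) in Hrv by lia.
      rewrite dm_mod, dm_div in Hrv by (unfold ORC; lia).
      replace (-1 - (-1 - i)) with i in Hrv by lia. rewrite Hrv. unfold init_mem. fold n.
      replace ((-1 - i) * 128 + ORC =? 0) with false by (unfold ORC; lia).
      replace ((-1 - i) * 128 + ORC =? 1) with false by (unfold ORC; lia).
      replace ((-1 - i) * 128 + ORC <? 2 + 2 * n * n) with false by (unfold ORC; lia).
      rewrite andb_false_r. reflexivity.
    - apply Hz; [|discriminate]. assert (0 <= z * S) by (apply Z.mul_nonneg_nonneg; lia). lia. }
  { intros e He. rewrite !J1, !E2 by discriminate. split; apply Hz; try lia; discriminate. }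
  intros h4 s4 R1 R2 R3. apply output_ok.
  - intros e He. destruct (dm_range e n n He ltac:(lia)) as (D1 & D2 & D3).
    assert (Hi : 0 <= e / n * N + e mod n < N * N) by (apply dm_lt; lia).
    rewrite R1. destruct (J2 _ Hi) as [EA EW]. destruct (A0_01 (e / n * N + e mod n)) as [E|E].
    + rewrite EA, E. lia.
    + rewrite R2 by congruence. rewrite EA, E.
      assert (Htot : Z.abs (tot t N (h3 ADJ) (h3 WT) (e / n * N + e mod n)) <= N * 1); [|lia].
      apply zs_abs; [lia|]. intros k Hk. unfold cl, clo. rewrite dm_div, dm_mod by lia.
      rewrite !(fun e He => proj1 (J2 e He)) by (apply dm_lt; lia).
      destruct (A0_01 (e / n * N + k)) as [-> | ->], (A0_01 (e mod n * N + k)) as [-> | ->];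
        destruct (_ =? t); cbn [b2z]; lia.
  - intros h5 s5 T1 T2. apply HQ.
    + intros i j Hi Hj Hij.
      assert (He : 0 <= Z.of_nat i * n + Z.of_nat j < n * n) by (apply dm_lt; lia).
      assert (Hi2 : 0 <= Z.of_nat i * N + Z.of_nat j < N * N) by (apply dm_lt; lia).
      unfold out_addr. fold n. rewrite Nat2Z.inj_add, Nat2Z.inj_mul. fold n.
      rewrite T1 by auto. rewrite dm_div, dm_mod by lia. rewrite R1.
      assert (E : h3 ADJ (Z.of_nat i * N + Z.of_nat j) = 1).
      { rewrite (proj1 (J2 _ Hi2)), A0_ij by lia. now rewrite !Nat2Z.id, Hij. }
      rewrite E, R2 by auto. rewrite Z.mul_1_l. apply count_spec; auto.
    + pose proof time_bound as HT. assert (n * 1 <= n * n) by (apply Z.mul_le_mono_nonneg_l; lia). lia.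
Qed.

End Main.

(** * Freeing the register cells *)

(* Cells below 64 serve as registers but initially hold input; they are first copied to the
   array [SAVE].  Cell 2 is free for this purpose: it holds the diagonal entry (0,0), which is 0. *)
Definition save_addr (x : nat) : Z := 67 - 128 * (Z.of_nat x + 1).

Definition saving (l : list nat) : list instr :=
  flat_map (fun x => [IConst 2 (save_addr x); IStore 2 x]) l.

Definition cells : list nat := 0%nat :: 1%nat :: seq 3 61.

(** The copies go to negative addresses, so cells still to be saved stay intact. The last clause
    bounds what remains in the scratch cell 2, possibly an address of size at most 128 * 64. *)
Lemma saving_ok w prog (Hw : 10000 <= 2 ^ Z.of_nat w) : forall l pc M,
  (forall x, In x l -> (x < 64)%nat /\ x <> 2%nat) -> code prog pc (saving l) ->
  exists M', reach w prog (2 * length l) pc M (pc + 2 * length l) M' /\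
    (forall x, 0 <= x -> x <> 2 -> M' x = M x) /\
    (forall x, In x l -> M' (save_addr x) = M (Z.of_nat x)) /\
    (forall x, x < 0 -> (forall y, In y l -> x <> save_addr y) -> M' x = M x) /\
    (M' 2 = M 2 \/ Z.abs (M' 2) <= 10000).
Proof.
  induction l as [|x l IH]; intros pc M Hl Hc.
  - exists M. split; [apply reach_refl; cbn; lia|]. repeat split; auto. easy.
  - cbn [saving flat_map app code] in Hc. destruct Hc as [Hc1 [Hc2 Hc3]].
    destruct (Hl x (or_introl eq_refl)) as [Hx Hx2].
    assert (Hb : Z.abs (save_addr x) < 10000) by (unfold save_addr; lia).
    assert (Hneg : forall y, save_addr y < 0) by (intros; unfold save_addr; lia).
    destruct (r_const w prog pc M _ _ Hc1) as (M1 & R1 & E1 & F1); [lia|].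
    destruct (r_store w prog _ M1 _ _ _ (M (Z.of_nat x)) Hc2 E1) as (M2 & R2 & E2 & F2).
    { apply F1. lia. }
    destruct (IH (S (S pc)) M2) as (M' & R3 & J1 & J2 & J3 & J4); auto.
    { intros y Hy. apply Hl. now right. }
    exists M'. pose proof (Hneg x) as Hnx. split; [|split; [|split; [|split]]].
    + replace (2 * length (x :: l))%nat with (1 + (1 + 2 * length l))%nat by (cbn [length]; lia).
      eapply reach_trans; [exact R1|]. eapply reach_trans; [exact R2|].
      now replace (pc + (1 + (1 + 2 * length l)))%nat with (S (S pc) + 2 * length l)%nat by lia.
    + intros y Hy Hy2. rewrite J1, F2, F1 by lia. reflexivity.
    + intros y [->|Hy].
      * destruct (in_dec Nat.eq_dec y l) as [Hin|Hin].
        -- rewrite J2 by auto. rewrite F2, F1 by lia. reflexivity.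
        -- rewrite J3; auto. intros z Hz E. apply Hin. replace y with z; auto.
           unfold save_addr in E. lia.
      * rewrite J2 by auto. destruct (Hl y (or_intror Hy)). rewrite F2, F1 by lia. reflexivity.
    + intros y Hy Hne. rewrite J3; auto.
      * rewrite F2, F1; auto; [lia|]. apply Hne. now left.
      * intros z Hz. apply Hne. now right.
    + right. destruct J4 as [J4|J4]; [|auto]. rewrite J4, F2 by lia.
      change 2 with (Z.of_nat 2). rewrite E1. lia.
Qed.

Definition prelude : list instr := saving cells.

Definition full_prog (P : program) : program :=
  prelude ++ comp P 2 (length prelude) main_cmd.

Lemma code_self l1 l2 l3 : code (l1 ++ l2 ++ l3) (length l1) l2.
Proof.
  revert l1; induction l2 as [|i l2 IH]; intros l1; cbn [code]; [exact I|]. split.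
  - rewrite nth_error_app2, Nat.sub_diag by lia. reflexivity.
  - specialize (IH (l1 ++ [i])). rewrite length_app, Nat.add_1_r in IH.
    now rewrite <- app_assoc in IH.
Qed.

Lemma code_prefix l1 l2 : code (l1 ++ l2) 0 l1.
Proof. exact (code_self [] l1 l2). Qed.

Lemma code_suffix l1 l2 : code (l1 ++ l2) (length l1) l2.
Proof. pose proof (code_self l1 l2 []) as Hc. now rewrite app_nil_r in Hc. Qed.

Lemma init_abs K n t adj wt x : valid_instance K n t adj wt -> (1 <= n)%nat ->
  Z.abs (init_mem n t adj wt x) <= Z.of_nat (n ^ K) + Z.of_nat n.
Proof.
  intros (_ & _ & _ & Hw & Ht) Hn. unfold init_mem.
  destruct (Z.eqb_spec x 0); [lia|]. destruct (Z.eqb_spec x 1); [lia|].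
  destruct (Z.leb_spec 2 x), (Z.ltb_spec x (2 + 2 * Z.of_nat n * Z.of_nat n)); cbn [andb]; try lia.
  destruct (dm_range (x - 2) (Z.of_nat n * Z.of_nat n) 2 ltac:(lia) ltac:(lia)) as (H1 & _ & _).
  destruct (dm_range ((x - 2) / 2) (Z.of_nat n) (Z.of_nat n) H1 ltac:(lia)) as (H2 & H3 & _).
  destruct (adj _ _) eqn:E; destruct (_ =? 0); try lia.
  apply Hw in E; lia.
Qed.

Lemma exec_end w prog k M pc M' : reach w prog k 0 M pc M' -> (length prog <= pc)%nat ->
  exec w prog (k + 1) 0 M = Some M'.
Proof.
  intros R Hpc. rewrite (R 1%nat). cbn [exec]. unfold step.
  now rewrite (proj2 (nth_error_None _ _) Hpc).
Qed.

Lemma prelude_length : length prelude = (2 * length cells)%nat.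
Proof. reflexivity. Qed.

Lemma cells_length : length cells = 63%nat.
Proof. reflexivity. Qed.

Lemma main_wf : wfc 2 main_cmd = true.
Proof. vm_compute. reflexivity. Qed.

Lemma in_cells x : In x cells <-> (x < 64)%nat /\ x <> 2%nat.
Proof. unfold cells. cbn [In]. rewrite in_seq. lia. Qed.

#[local] Opaque main_cmd comp cells.

Lemma init_neg nn t adj wt x : x < 0 -> init_mem nn t adj wt x = 0.
Proof.
  intros Hx. unfold init_mem.
  replace (x =? 0) with false by lia. replace (x =? 1) with false by lia.
  replace (2 <=? x) with false by lia. reflexivity.
Qed.

Lemma init_2 K nn t adj wt : valid_instance K nn t adj wt -> (1 <= nn)%nat ->
  init_mem nn t adj wt 2 = 0.
Proof.
  intros (_ & Hirr & _) Hn. unfold init_mem.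
  replace (2 =? 0) with false by lia. replace (2 =? 1) with false by lia.
  destruct (_ && _); [|reflexivity].
  replace ((2 - 2) / 2) with 0 by reflexivity. replace ((2 - 2) mod 2) with 0 by reflexivity.
  rewrite Z.div_0_l, Z.mod_0_l by lia. replace (Z.to_nat 0) with 0%nat by reflexivity.
  rewrite Hirr by lia. reflexivity.
Qed.

Definition heap_of (M : memory) : heap :=
  fun k i => if (0 <=? k) && (k <? 128) then M (k - 128 * (i + 1)) else 0.

Lemma rv_heap_of M x : rv (heap_of M) x = M x.
Proof.
  unfold rv, heap_of. pose proof (Z.mod_pos_bound x 128 ltac:(lia)).
  replace (0 <=? x mod 128) with true by lia. replace (x mod 128 <? 128) with true by lia.
  cbn [andb]. f_equal. pose proof (Z.div_mod x 128 ltac:(lia)). lia.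
Qed.

Section Saved.
Variables (nn K : nat) (t : Z) (adj : nat -> nat -> bool) (wt : nat -> nat -> Z).
Hypothesis Hinst : valid_instance K nn t adj wt.
Hypothesis Hn1 : (1 <= nn)%nat.
Variable M1 : memory.
Let init := init_mem nn t adj wt.
Hypothesis J1 : forall x, 0 <= x -> x <> 2 -> M1 x = init x.
Hypothesis J2 : forall x, In x cells -> M1 (save_addr x) = init (Z.of_nat x).
Hypothesis J3 : forall x, x < 0 -> (forall y, In y cells -> x <> save_addr y) -> M1 x = init x.
Hypothesis J4 : M1 2 = init 2 \/ Z.abs (M1 2) <= 10000.

Lemma saved_bound Y x : 10000 <= Y -> Z.of_nat (nn ^ K) + Z.of_nat nn <= Y -> Z.abs (M1 x) <= Y.
Proof.
  intros HY1 HY2.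
  assert (Hia : forall x, Z.abs (init x) <= Y).
  { intros y. pose proof (init_abs K nn t adj wt y Hinst Hn1) as Hi. fold init in Hi. lia. }
  destruct (Z.lt_ge_cases x 0) as [Hx|Hx].
  - destruct (in_dec Z.eq_dec x (map save_addr cells)) as [Hin|Hin].
    + apply in_map_iff in Hin. destruct Hin as (y & <- & Hy). rewrite J2 by auto. auto.
    + rewrite J3; auto. intros y Hy E. apply Hin. rewrite E. now apply in_map.
  - destruct (Z.eq_dec x 2) as [->|Hx2]; [|rewrite J1 by lia; auto].
    destruct J4 as [J|J]; [rewrite J; auto|lia].
Qed.

Lemma saved_zero k i : 0 <= i -> k <> 67 -> heap_of M1 k i = 0.
Proof.
  intros Hi Hk. unfold heap_of. destruct (Z.leb_spec 0 k), (Z.ltb_spec k 128); cbn [andb]; auto.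
  rewrite J3; [apply init_neg; lia|lia|]. intros y Hy. unfold save_addr. lia.
Qed.

Lemma saved_input x : 0 <= x < 64 -> heap_of M1 67 x = init x.
Proof.
  intros Hx. unfold heap_of. replace ((0 <=? 67) && (67 <? 128)) with true by reflexivity.
  destruct (Z.eq_dec x 2) as [->|Hx2].
  - unfold init. rewrite (init_2 K) by auto. replace (67 - 128 * (2 + 1)) with (save_addr 2) by reflexivity.
    rewrite J3; [apply init_neg; unfold save_addr; lia|unfold save_addr; lia|].
    intros y Hy E. apply in_cells in Hy. unfold save_addr in E. lia.
  - replace (67 - 128 * (x + 1)) with (save_addr (Z.to_nat x)) by (unfold save_addr; lia).
    rewrite J2 by (apply in_cells; lia). rewrite Z2Nat.id by lia. reflexivity.
Qed.

End Saved.

(** The exponents are 146 = 49 + 49 + 48 for [N * N * NB] and 144 = 3 * 48 for the number [NB ^ 3]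
    of calls. The 200 covers the copying of the register cells and the final step that halts. *)
Lemma full_ok (P : program) (w w0 : nat) (Y Bm : Z) (nn K : nat) t adj wt bn a Tm K' :
  256 <= Y -> (forall d, (d <= maxdeg)%nat -> 256 * Y ^ Z.of_nat d <= 2 ^ Z.of_nat w) ->
  (w0 <= w)%nat -> 2 ^ Z.of_nat w0 <= Bm ->
  (forall i x, In i P -> In x (iregs i) -> Z.of_nat x <= Bm) ->
  valid_instance K nn t adj wt -> 0 <= a -> Z.of_nat bn = 2 ^ a ->
  Z.of_nat nn <= bp (Z.of_nat bn) 49 -> a = 0 \/ bp (2 ^ (a - 1)) 49 < Z.of_nat nn ->
  6 <= Z.of_nat nn ->
  8 * bp (Z.of_nat bn) 49 * bp (Z.of_nat bn) 49 * bp (Z.of_nat bn) 49 + 10000 <= Y ->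
  256 * (bp (Z.of_nat bn) 144 + 3 * Z.of_nat nn * Z.of_nat nn + 4) <= Y ->
  (Bm + 2) * (bp (Z.of_nat bn) 144 + 3 * Z.of_nat nn * Z.of_nat nn + 4) <= Y ->
  2 * Z.of_nat (nn ^ K) <= Y ->
  Z.of_nat (nn ^ K) <= Z.of_nat ((3 * bn) ^ K') ->
  3 * Z.of_nat bn <= Bm -> Z.of_nat (nn ^ K) <= Bm ->
  (forall adj wt, valid_instance K' (3 * bn) t adj wt ->
    exists T M', exec w0 P T 0 (init_mem (3 * bn) t adj wt) = Some M' /\ Z.of_nat T <= Tm /\
      forall i j, (i < 3 * bn)%nat -> (j < 3 * bn)%nat -> adj i j = true ->
        M' (out_addr (3 * bn) i j) = detect_answer (3 * bn) t adj wt i j) ->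
  exists T M', exec w (full_prog P) T 0 (init_mem nn t adj wt) = Some M' /\
    Z.of_nat T <= 200 + 1000000 * bp (Z.of_nat bn) 146 + 13 * (bp (Z.of_nat bn) 144 * Tm) /\
    forall i j, (i < nn)%nat -> (j < nn)%nat -> adj i j = true ->
      M' (out_addr nn i j) = count_answer nn t adj wt i j.
Proof.
  intros HY Hw Hw0 HBm HP Hinst Ha Hba Hnb Hmin Hn6 HYN HSY HBS HWY HWm HB1 HB2 Horc.
  set (b := Z.of_nat bn) in *. set (n := Z.of_nat nn) in *.
  assert (Hb : 0 < b) by (rewrite Hba; apply Z.pow_pos_nonneg; lia).
  assert (H1w : 256 * Y <= 2 ^ Z.of_nat w).
  { specialize (Hw 1%nat ltac:(unfold maxdeg; lia)). change (Z.of_nat 1) with 1 in Hw.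
    now rewrite Z.pow_1_r in Hw. }
  assert (E49 : b * bp b 48 = bp b 49) by (rewrite (bp_add b 1 48 : bp b 49 = _), bp_1; reflexivity).
  assert (E144 : bp b 48 * bp b 48 * bp b 48 = bp b 144).
  { rewrite <- !bp_add. reflexivity. }
  assert (E146 : b * bp b 48 * (b * bp b 48) * bp b 48 = bp b 146).
  { rewrite E49, <- !bp_add. reflexivity. }
  assert (H49 : 0 < bp b 49 * bp b 49) by (apply Z.mul_pos_pos; apply bp_pos; auto).
  assert (HY10 : 10000 <= Y).
  { assert (0 < bp b 49 * bp b 49 * bp b 49) by (apply Z.mul_pos_pos; auto; apply bp_pos; auto). lia. }
  set (init := init_mem nn t adj wt).
  set (prog := full_prog P).
  assert (Hcode : code prog 0 prelude /\ code prog (length prelude) (comp P 2 (length prelude) main_cmd)).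
  { split; [apply code_prefix|apply code_suffix]. }
  destruct Hcode as [Hc1 Hc2].
  destruct (saving_ok w prog ltac:(lia) cells 0 init ltac:(intros; now apply in_cells) Hc1)
    as (M1 & R1 & J1 & J2 & J3 & J4).
  set (h := heap_of M1).
  assert (HM1 : forall x, Z.abs (M1 x) <= Y).
  { intros x. apply (saved_bound nn K t adj wt Hinst ltac:(lia) M1 J1 J2 J3 J4); auto.
    assert (n * 1 <= n * n) by (apply Z.mul_le_mono_nonneg_l; lia).
    pose proof (bp_pos b 144 Hb). fold n. lia. }
  assert (Hwp : wp P w0 Y Bm main_cmd (fun h' s' =>
      (forall i j, (i < nn)%nat -> (j < nn)%nat -> adj i j = true ->
         rv h' (out_addr nn i j) = count_answer nn t adj wt i j) /\
      s' <= 0 + 1000000 * bp b 146 + 13 * (bp b 144 * Tm)) [n; t] h 0).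
  { apply (main_ok P w0 Y Bm nn K t adj wt Hinst bn a Ha Hba Hnb Hmin Hn6
      _ _ _ _ _ _ _ _ _ _ _ eq_refl eq_refl eq_refl eq_refl eq_refl eq_refl eq_refl eq_refl eq_refl
      eq_refl eq_refl) with (K' := K') (Tm := Tm); fold b n; rewrite ?E144, ?E146, ?E49; auto; try lia.
    - intros k i Hi Hk. apply (saved_zero nn t adj wt ltac:(lia) M1 J3); auto.
    - intros x Hx. apply (saved_input nn K t adj wt Hinst ltac:(lia) M1 J2 J3); auto.
    - intros x Hx. unfold h. rewrite rv_heap_of, J1 by lia. reflexivity. }
  assert (Hb0 : bnd Y [n; t] h).
  { split.
    - intros [|[|i]] Hi; cbn [length nth] in *; [| |lia].
      + pose proof (HM1 0) as H0. rewrite J1 in H0 by lia. exact H0.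
      + pose proof (HM1 1) as H0. rewrite J1 in H0 by lia. exact H0.
    - intros k i. unfold h, heap_of. destruct (_ && _); [apply HM1|lia]. }
  assert (Hr0 : rep M1 [n; t] h).
  { split.
    - intros [|[|i]] Hi; cbn [length nth] in *; [| |lia]; rewrite J1 by lia; reflexivity.
    - intros x Hx. symmetry. apply rv_heap_of. }
  destruct (comp_ok P w w0 Y Bm HY Hw prog Hw0 HBm HP main_cmd _ [n; t] h 0 M1 (length prelude)
    main_wf ltac:(cbn; lia) Hc2 Hb0 Hr0 Hwp)
    as (k & M2 & h2 & s2 & R2 & HM2 & _ & [HQ1 HQ2] & Ht).
  exists (2 * length cells + (k + 1))%nat, M2. split; [|split].
  - rewrite Nat.add_assoc. eapply exec_end.
    + eapply reach_trans; [exact R1|]. cbn [Nat.add]. rewrite <- prelude_length. exact R2.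
    + unfold prog, full_prog. rewrite length_app. cbn [length]. lia.
  - rewrite cells_length. lia.
  - intros i j Hi Hj Hij. rewrite <- HQ1 by auto. apply HM2. right. unfold out_addr. fold n.
    assert (36 <= n * n) by nia. lia.
Qed.

(** * Real bounds on the running time *)

Section Real_bounds.
Local Open Scope R_scope.

(** In this section [x] stands for n and [B] for b. A saving in [B] is worth its 49th root in terms
    of [x], because [B] is at least the 49th root of [x]. *)
Lemma inv_power_bound (x B e : R) : 1 <= x -> 1 <= B -> x <= B ^ 49 -> 0 <= e ->
  Rpower B (- e) <= Rpower x (- (e / 49)).
Proof.
  intros Hx HB HxB He.
  rewrite !Rpower_Ropp. apply Rinv_le_contravar; [apply exp_pos|].
  replace (Rpower B e) with (Rpower (B ^ 49) (e / 49)).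
  - apply Rle_Rpower_l; [lra|lra].
  - rewrite <- Rpower_pow by lra. rewrite Rpower_mult. f_equal.
    replace (INR 49) with 49 by (rewrite INR_IZR_INZ; reflexivity). field.
Qed.

Lemma cube_saving (x B e c : R) : 1 <= x -> 1 <= B -> x <= B ^ 49 -> B ^ 49 <= c * x ->
  0 <= e -> B ^ 147 * Rpower B (- e) <= c ^ 3 * Rpower x (3 - e / 49).
Proof.
  intros Hx HB HxB HBc He.
  pose proof (inv_power_bound x B e Hx HB HxB He) as H1.
  assert (H2 : B ^ 147 <= c ^ 3 * x ^ 3).
  { replace 147%nat with (49 * 3)%nat by reflexivity. rewrite pow_mult, <- Rpow_mult_distr.
    apply pow_incr. split; [apply pow_le; lra|exact HBc]. }
  assert (H3 : Rpower x (3 - e / 49) = x ^ 3 * Rpower x (- (e / 49))).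
  { unfold Rminus. rewrite Rpower_plus. f_equal.
    replace 3 with (INR 3) by (rewrite INR_IZR_INZ; reflexivity). apply Rpower_pow. lra. }
  rewrite H3, <- Rmult_assoc.
  apply Rmult_le_compat; auto.
  - apply pow_le; lra.
  - left. apply exp_pos.
Qed.

(** Measured against [B ^ 147], which is N^3, the work outside the calls saves a factor [B] and the
    calls save [B ^ eps]; [Rmin eps 1] is common to both. The 27 comes from the three parts of an
    oracle instance. *)
Lemma real_bounds (x B eps c : R) : 1 <= x -> 1 <= B -> x <= B ^ 49 -> B ^ 49 <= c * x ->
  0 < eps ->
  B ^ 146 <= c ^ 3 * Rpower x (3 - Rmin eps 1 / 49) /\
  B ^ 144 * Rpower (3 * B) (3 - eps) <= 27 * (c ^ 3 * Rpower x (3 - Rmin eps 1 / 49)).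
Proof.
  intros Hx HB HxB HBc Heps. set (e := Rmin eps 1).
  assert (He : 0 < e <= 1 /\ e <= eps).
  { unfold e. pose proof (Rmin_l eps 1). pose proof (Rmin_r eps 1).
    split; [split|]; auto. apply Rmin_glb_lt; lra. }
  pose proof (cube_saving x B e c Hx HB HxB HBc ltac:(lra)) as H1.
  assert (HB147 : 0 <= B ^ 147) by (apply pow_le; lra).
  split.
  - eapply Rle_trans; [|exact H1].
    replace (B ^ 146) with (B ^ 147 * Rpower B (- (1))).
    + apply Rmult_le_compat_l; auto. apply Rle_Rpower; lra.
    + rewrite Rpower_Ropp, Rpower_1 by lra.
      change (B ^ 147) with (B * B ^ 146). field. lra.
  - apply Rle_trans with (27 * (B ^ 147 * Rpower B (- e))); [|lra].
    assert (H2 : Rpower (3 * B) (3 - eps) <= Rpower (3 * B) (3 - e)) by (apply Rle_Rpower; lra).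
    assert (H3 : Rpower (3 * B) (3 - e) <= 27 * (B ^ 3 * Rpower B (- e))).
    { replace (3 - e) with (3 + - e) by ring. rewrite Rpower_plus.
      replace (Rpower (3 * B) 3) with (27 * B ^ 3).
      - rewrite Rmult_assoc. apply Rmult_le_compat_l; [lra|]. apply Rmult_le_compat_l; [apply pow_le; lra|].
        rewrite !Rpower_Ropp. apply Rinv_le_contravar; [apply exp_pos|].
        apply Rle_Rpower_l; lra.
      - replace (Rpower (3 * B) 3) with (Rpower (3 * B) (INR 3))
          by (f_equal; rewrite INR_IZR_INZ; reflexivity).
        rewrite Rpower_pow by lra. ring. }
    replace (B ^ 147) with (B ^ 144 * B ^ 3) by (rewrite <- pow_add; reflexivity).
    assert (0 <= B ^ 144) by (apply pow_le; lra).
    apply Rle_trans with (B ^ 144 * (27 * (B ^ 3 * Rpower B (- e)))).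
    + apply Rmult_le_compat_l; auto. lra.
    + lra.
Qed.

(** The constants are 1000213 = 1000000 + 200 + 13 and 351 = 13 * 27; the added 1 in the bound on
    [tm] allows for rounding up. *)
Lemma time_real (x B eps c C0 tm T : R) : 1 <= x -> 1 <= B -> x <= B ^ 49 -> B ^ 49 <= c * x ->
  0 < eps -> tm <= Rabs C0 * Rpower (3 * B) (3 - eps) + 1 ->
  T <= 200 + 1000000 * B ^ 146 + 13 * (B ^ 144 * tm) ->
  T <= (1000213 + 351 * Rabs C0) * c ^ 3 * Rpower x (3 - Rmin eps 1 / 49).
Proof.
  intros Hx HB HxB HBx Heps Htm HT.
  destruct (real_bounds x B eps c Hx HB HxB HBx Heps) as [H1 H2].
  set (q := c ^ 3 * Rpower x (3 - Rmin eps 1 / 49)) in *.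
  assert (H146 : 1 <= B ^ 146) by (apply pow_R1_Rle; auto).
  assert (H144 : 0 <= B ^ 144 <= B ^ 146).
  { split; [apply pow_le; lra|]. apply Rle_pow; [auto|lia]. }
  pose proof (Rabs_pos C0) as HC.
  assert (Hq : B ^ 144 * tm <= B ^ 146 + Rabs C0 * (27 * q)).
  { apply Rle_trans with (B ^ 144 * (Rabs C0 * Rpower (3 * B) (3 - eps) + 1)).
    - apply Rmult_le_compat_l; lra.
    - assert (Rabs C0 * (B ^ 144 * Rpower (3 * B) (3 - eps)) <= Rabs C0 * (27 * q))
        by (apply Rmult_le_compat_l; auto). lra. }
  rewrite Rmult_assoc. fold q. lra.
Qed.

End Real_bounds.

(** * Choice of the parameters *)

Lemma least_scale (n : Z) (m : nat) : n <= bp (2 ^ Z.of_nat m) 49 ->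
  exists a, 0 <= a /\ n <= bp (2 ^ a) 49 /\ (a = 0 \/ bp (2 ^ (a - 1)) 49 < n).
Proof.
  induction m as [|m IH]; intros Hm.
  - exists 0. split; [lia|]. split; [exact Hm|]. now left.
  - destruct (Z.le_gt_cases n (bp (2 ^ Z.of_nat m) 49)) as [Hle|Hgt]; [auto|].
    exists (Z.of_nat (S m)). split; [lia|]. split; [exact Hm|]. right.
    now replace (Z.of_nat (S m) - 1) with (Z.of_nat m) by lia.
Qed.

Lemma scale_exists (n : Z) : 0 <= n ->
  exists a, 0 <= a /\ n <= bp (2 ^ a) 49 /\ (a = 0 \/ bp (2 ^ (a - 1)) 49 < n).
Proof.
  intros Hn. apply (least_scale n (Z.to_nat n)). rewrite Z2Nat.id by auto.
  pose proof (Z.pow_gt_lin_r 2 n ltac:(lia) Hn) as H1.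
  assert (H2 : bp (2 ^ n) 1 <= bp (2 ^ n) 49) by (apply bp_le_exp; lia).
  rewrite bp_1 in H2. lia.
Qed.

(** By minimality half of b is too small, so padding to N vertices costs at most the constant factor
    2^49. *)
Lemma scale_upper (n a : Z) : 1 <= n -> 0 <= a -> (a = 0 \/ bp (2 ^ (a - 1)) 49 < n) ->
  bp (2 ^ a) 49 <= bp 2 49 * n.
Proof.
  intros Hn Ha [->|H].
  - replace (bp (2 ^ 0) 49) with 1 by reflexivity. pose proof (bp_pos 2 49 ltac:(lia)). nia.
  - destruct (Z.eq_dec a 0) as [->|Ha0].
    { replace (bp (2 ^ 0) 49) with 1 by reflexivity. pose proof (bp_pos 2 49 ltac:(lia)). nia. }
    assert (E : bp (2 ^ a) 49 = bp 2 49 * bp (2 ^ (a - 1)) 49).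
    { unfold bp. rewrite <- Z.pow_mul_l. f_equal.
      replace a with (Z.succ (a - 1)) at 1 by lia. rewrite Z.pow_succ_r by lia. reflexivity. }
    rewrite E. apply Z.mul_le_mono_nonneg_l; [|lia]. pose proof (bp_pos 2 49 ltac:(lia)). lia.
Qed.

Lemma bp_2_le X k : 2 <= X -> 2 ^ Z.of_nat k <= bp X k.
Proof. intros. apply Z.pow_le_mono_l. lia. Qed.

Lemma bp_bp X j k : bp (bp X j) k = bp X (j * k).
Proof. unfold bp. rewrite <- Z.pow_mul_r by lia. f_equal. lia. Qed.

Lemma bp_mul_le X u v j k : 0 <= u -> 0 <= v -> u <= bp X j -> v <= bp X k -> u * v <= bp X (j + k).
Proof. intros. rewrite bp_add. apply Z.mul_le_mono_nonneg; auto. Qed.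

(** The range of words of size [word_size c n] is the [c]-th power of this number, so all magnitudes
    are estimated by its powers. *)
Definition base_word (n : nat) : Z := 2 ^ Z.of_nat (Nat.log2 n + 1).

Lemma word_pow c n : 2 ^ Z.of_nat (word_size c n) = bp (base_word n) c.
Proof. unfold word_size, base_word, bp. rewrite <- Z.pow_mul_r by lia. f_equal. lia. Qed.

Lemma base_word_spec n : (1 <= n)%nat -> Z.of_nat n < base_word n <= 2 * Z.of_nat n.
Proof.
  intros Hn. destruct (Nat.log2_spec n ltac:(lia)) as [H1 H2].
  unfold base_word. rewrite Nat.add_1_r.
  rewrite <- (Nat2Z.inj_pow 2). rewrite Nat.pow_succ_r' in *. lia.
Qed.

(* Exponents of [base_word n], a power of 2 between n and 2 n, in the bound on oracle memory
   values, the bound on stored values, and the word range. *)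
Definition eB (c0 K R : nat) : nat := 53 * c0 + K + R + 53.
Definition eY (c0 K R : nat) : nat := eB c0 K R + 200.
Definition eW (c0 K R : nat) : nat := 8 + maxdeg * eY c0 K R.

(** * Magnitudes and word size *)

Section Magnitudes.
Variables (c0 K R nn bn : nat) (a : Z).
Let n := Z.of_nat nn.
Let b := Z.of_nat bn.
Let X := base_word nn.
Let Bm := bp X (eB c0 K R).
Let Y := bp X (eY c0 K R).
Hypothesis Hn : 6 <= n.
Hypothesis Ha : 0 <= a.
Hypothesis Hba : b = 2 ^ a.
Hypothesis Hmin : a = 0 \/ bp (2 ^ (a - 1)) 49 < n.

Lemma X_spec : n < X <= 2 * n /\ 2 <= X.
Proof. pose proof (base_word_spec nn ltac:(lia)). fold n X in H. lia. Qed.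

Lemma b_ge1 : 1 <= b.
Proof. rewrite Hba. pose proof (Z.pow_pos_nonneg 2 a). lia. Qed.

Lemma X_le j k : (j <= k)%nat -> bp X j <= bp X k.
Proof. intros. apply bp_le_exp; auto. pose proof X_spec. lia. Qed.

(** The padding factor 2^49 accounts for 49 powers of [X], and n itself for one more. *)
Lemma N_le_X : bp b 49 <= bp X 50.
Proof.
  destruct X_spec as [H1 H2].
  pose proof (scale_upper n a ltac:(lia) Ha Hmin) as H3. rewrite <- Hba in H3.
  etransitivity; [exact H3|]. apply (bp_mul_le X _ _ 49 1).
  - pose proof (bp_pos 2 49 ltac:(lia)). lia.
  - lia.
  - apply bp_le_base. lia.
  - rewrite bp_1. lia.
Qed.

Lemma b_le_X : b <= bp X 50.
Proof.
  etransitivity; [|apply N_le_X]. rewrite <- (bp_1 b) at 1. apply bp_le_exp; [|lia].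
  pose proof b_ge1. lia.
Qed.

Lemma lit_X k v : v <= 2 ^ Z.of_nat k -> v <= bp X k.
Proof. intros. etransitivity; [eassumption|]. apply bp_2_le. apply X_spec. Qed.

(** The base for [3 * b] vertices is at most [6 * b <= X ^ 53]; this is the origin of the term
    [53 * c0] in [eB]. *)
Lemma w0_le : 2 ^ Z.of_nat (word_size c0 (3 * bn)) <= Bm.
Proof.
  pose proof b_ge1 as Hb1.
  rewrite word_pow. pose proof (base_word_spec (3 * bn) ltac:(lia)) as H1.
  assert (H2 : base_word (3 * bn) <= bp X 53).
  { etransitivity; [apply H1|]. replace (2 * Z.of_nat (3 * bn)) with (6 * b) by lia.
    apply (bp_mul_le X _ _ 3 50); try lia; [apply lit_X; cbn; lia|apply b_le_X]. }
  etransitivity; [apply bp_le_base; split; [|exact H2]; lia|].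
  rewrite bp_bp. apply X_le. unfold eB. lia.
Qed.

Lemma nK_le : Z.of_nat (nn ^ K) <= bp X K.
Proof. rewrite Nat2Z.inj_pow. apply bp_le_base. pose proof X_spec. fold n. lia. Qed.

Lemma Bm_facts : 3 * b <= Bm /\ Z.of_nat (nn ^ K) <= Bm /\ Z.of_nat R <= Bm /\ 1 <= Bm.
Proof.
  pose proof b_ge1 as Hb1. split; [|split; [|split]].
  - etransitivity; [apply (bp_mul_le X _ _ 2 50); try lia; [apply lit_X; cbn; lia|apply b_le_X]|].
    apply X_le. unfold eB. lia.
  - etransitivity; [apply nK_le|]. apply X_le. unfold eB. lia.
  - etransitivity; [apply (lit_X R)|].
    + pose proof (Z.pow_gt_lin_r 2 (Z.of_nat R)). lia.
    + apply X_le. unfold eB. lia.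
  - pose proof (bp_pos X (eB c0 K R)). pose proof X_spec. fold Bm in H. lia.
Qed.

Lemma S_le : 0 <= bp b 144 + 3 * n * n + 4 <= bp X 153.
Proof.
  pose proof b_ge1 as Hb1. destruct X_spec as [H1 H2].
  pose proof (bp_pos b 144 ltac:(lia)) as H144.
  (* Enlarging the exponent to 147 makes the left side the cube of N, and 150 is 3 * 50. *)
  assert (H3 : bp b 144 <= bp X 150).
  { etransitivity; [apply (bp_le_exp b 144 147); lia|].
    replace (bp b 147) with (bp (bp b 49) 3) by (rewrite bp_bp; reflexivity).
    replace (bp X 150) with (bp (bp X 50) 3) by (rewrite bp_bp; reflexivity).
    apply bp_le_base. split; [|apply N_le_X]. pose proof (bp_pos b 49 ltac:(lia)). lia. }
  assert (H4 : n * n <= bp X 150).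
  { etransitivity; [apply (bp_mul_le X _ _ 1 1); rewrite ?bp_1; lia|]. apply X_le. lia. }
  assert (H5 : 1 <= bp X 150) by (pose proof (bp_pos X 150 ltac:(lia)); lia).
  split; [nia|].
  etransitivity; [|apply (bp_mul_le X 8 (bp X 150) 3 150); try lia; apply lit_X; cbn; lia].
  lia.
Qed.

Lemma Y_facts :
  256 <= Y /\ 8 * bp b 49 * bp b 49 * bp b 49 + 10000 <= Y /\
  256 * (bp b 144 + 3 * n * n + 4) <= Y /\ (Bm + 2) * (bp b 144 + 3 * n * n + 4) <= Y /\
  2 * Z.of_nat (nn ^ K) <= Y.
Proof.
  pose proof b_ge1 as Hb1. destruct S_le as [HS0 HS].
  destruct Bm_facts as (_ & _ & _ & HB1).
  destruct X_spec as [_ HX2].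
  split; [|split; [|split; [|split]]].
  - etransitivity; [apply (lit_X 8); cbn; lia|]. apply X_le. unfold eY. lia.
  - assert (H1 : bp b 49 * bp b 49 * bp b 49 <= bp X 150).
    { replace (bp b 49 * bp b 49 * bp b 49) with (bp (bp b 49) 3)
        by (rewrite (bp_add (bp b 49) 2 1 : bp (bp b 49) 3 = _),
          (bp_add (bp b 49) 1 1 : bp (bp b 49) 2 = _), !bp_1; reflexivity).
      replace (bp X 150) with (bp (bp X 50) 3) by (rewrite bp_bp; reflexivity).
      apply bp_le_base. split; [|apply N_le_X]. pose proof (bp_pos b 49 ltac:(lia)). lia. }
    assert (H5 : 1 <= bp X 150) by (pose proof (bp_pos X 150 ltac:(lia)); lia).
    etransitivity; [|apply (X_le 170); unfold eY; lia].
    etransitivity; [|apply (bp_mul_le X 20000 (bp X 150) 20 150); try lia; apply lit_X; cbn; lia].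
    lia.
  - etransitivity; [apply (bp_mul_le X _ _ 8 153); try lia; apply lit_X; cbn; lia|].
    apply X_le. unfold eY. lia.
  - etransitivity; [apply (bp_mul_le X _ _ (2 + eB c0 K R) 153); try lia|].
    + rewrite bp_add. fold Bm. pose proof (lit_X 2 4 ltac:(cbn; lia)) as H4. nia.
    + apply X_le. unfold eY. lia.
  - etransitivity; [apply (bp_mul_le X _ _ 1 K); try lia|].
    + apply lit_X. cbn. lia.
    + apply nK_le.
    + apply X_le. unfold eY, eB. lia.
Qed.

Lemma word_facts d : (d <= maxdeg)%nat ->
  256 * Y ^ Z.of_nat d <= 2 ^ Z.of_nat (word_size (eW c0 K R) nn).
Proof.
  intros Hd. rewrite word_pow. fold X. fold (bp Y d). unfold Y. rewrite bp_bp. unfold eW.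
  pose proof X_spec. apply (bp_mul_le X).
  - lia.
  - pose proof (bp_pos X (eY c0 K R * d)). lia.
  - apply lit_X. cbn. lia.
  - apply X_le. rewrite (Nat.mul_comm maxdeg). apply Nat.mul_le_mono_l. auto.
Qed.

Lemma words_le : (word_size c0 (3 * bn) <= word_size (eW c0 K R) nn)%nat.
Proof.
  assert (H1 : 2 ^ Z.of_nat (word_size c0 (3 * bn)) <= 2 ^ Z.of_nat (word_size (eW c0 K R) nn)).
  { etransitivity; [apply w0_le|]. rewrite word_pow. fold X. apply X_le.
    unfold eW, eY, maxdeg. lia. }
  apply Z.pow_le_mono_r_iff in H1; lia.
Qed.

End Magnitudes.

(** * The reduction *)

Lemma regs_bound (P : program) i x : In i P -> In x (iregs i) ->
  (x <= list_max (flat_map iregs P))%nat.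
Proof.
  intros Hi Hx. assert (Hin : In x (flat_map iregs P)) by (apply in_flat_map; eauto).
  pose proof (proj1 (list_max_le (flat_map iregs P) _) (le_n _)) as HF.
  rewrite Forall_forall in HF. auto.
Qed.

Lemma IZR_bp z k : IZR (bp z k) = (IZR z ^ k)%R.
Proof. unfold bp. symmetry. apply pow_IZR. Qed.

Lemma bp_nonneg z k : 0 <= z -> 0 <= bp z k.
Proof. apply Z.pow_nonneg. Qed.

(** Weights polynomial in n are still polynomial in the size of the small instances, with an
    exponent [q] times as large; this is why detection is invoked for [49 * K]. *)
Lemma pow_scale q nn bn K : Z.of_nat nn <= bp (Z.of_nat bn) q ->
  Z.of_nat (nn ^ K) <= Z.of_nat ((3 * bn) ^ (q * K)).
Proof.
  intros Hq. apply inj_le. rewrite Nat.pow_mul_r. apply Nat.pow_le_mono_l.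
  unfold bp in Hq. rewrite <- Nat2Z.inj_pow in Hq. apply Nat2Z.inj_le in Hq.
  etransitivity; [exact Hq|]. apply Nat.pow_le_mono_l. lia.
Qed.

(** From n > n0^49 and b^49 >= n it will follow that b >= n0, so the oracle instances are large
    enough for the hypothesis on detection. The 6 is the lower bound on n that the output needs. *)
Lemma threshold (n0 nn : nat) : (n0 ^ 49 + 6 <= nn)%nat ->
  bp (Z.of_nat n0) 49 + 6 <= Z.of_nat nn.
Proof.
  intros Hn. unfold bp. rewrite <- Nat2Z.inj_pow. revert Hn. generalize (n0 ^ 49)%nat. lia.
Qed.

Lemma count_from_detect K eps : (0 < eps)%R ->
  has_subcubic_alg detect_answer (49 * K) eps ->
  has_subcubic_alg count_answer K (Rmin eps 1 / 49).
Proof.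
  intros Heps (P & c0 & n0 & C0 & HP).
  set (R := list_max (flat_map iregs P)).
  exists (full_prog P), (eW c0 K R), (n0 ^ 49 + 6)%nat,
    ((1000213 + 351 * Rabs C0) * IZR (bp 2 49) ^ 3)%R.
  intros nn t adj wt Hnn Hinst. apply threshold in Hnn.
  assert (Hn6 : 6 <= Z.of_nat nn) by (pose proof (bp_nonneg (Z.of_nat n0) 49 ltac:(lia)); lia).
  destruct (scale_exists (Z.of_nat nn) ltac:(lia)) as (a & Ha & Hnb & Hmin).
  set (bn := Z.to_nat (2 ^ a)).
  assert (H2a : 0 < 2 ^ a) by (apply Z.pow_pos_nonneg; lia).
  assert (Hba : Z.of_nat bn = 2 ^ a) by (unfold bn; lia).
  rewrite <- Hba in Hnb.
  set (b := Z.of_nat bn) in *.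
  set (Bb := IZR b).
  assert (HB1 : (1 <= Bb)%R) by (apply IZR_le; lia).
  assert (Hn0 : (n0 <= 3 * bn)%nat).
  { destruct (Nat.le_gt_cases n0 bn) as [|Hgt]; [lia|exfalso].
    assert (H1 : bp b 49 <= bp (Z.of_nat n0) 49) by (apply bp_le_base; lia).
    lia. }
  (* The absolute value makes the bound nonnegative whatever the sign of [C0]; it is then rounded up
     to the integer [Tm]. *)
  set (ro := (Rabs C0 * Rpower (3 * Bb) (3 - eps))%R).
  assert (Hro : (0 <= ro)%R).
  { apply Rmult_le_pos; [apply Rabs_pos|left; apply exp_pos]. }
  set (Tm := up ro).
  destruct (archimed ro) as [HT1 HT2]. fold Tm in HT1, HT2.
  destruct (Y_facts c0 K R nn bn a Hn6 Ha Hba Hmin) as (Y1 & Y2 & Y3 & Y4 & Y5).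
  destruct (Bm_facts c0 K R nn bn a Hn6 Ha Hba Hmin) as (B1 & B2 & B3 & B4).
  destruct (full_ok P (word_size (eW c0 K R) nn) (word_size c0 (3 * bn))
    (bp (base_word nn) (eY c0 K R)) (bp (base_word nn) (eB c0 K R)) nn K t adj wt bn a Tm (49 * K))
    as (T & M' & Hex & HT & Hans); auto.
  - intros d Hd. eapply (word_facts c0 K R nn bn a); eauto.
  - apply (words_le c0 K R nn bn a); auto.
  - apply (w0_le c0 K R nn bn a); auto.
  - intros i x Hi Hx. pose proof (regs_bound P i x Hi Hx) as Hr. fold R in Hr. lia.
  - apply pow_scale. auto.
  - intros adj' wt' Hv. destruct (HP (3 * bn)%nat t adj' wt' Hn0 Hv) as (T & M' & Hex & HT & Hans).
    exists T, M'. split; [exact Hex|]. split; [|exact Hans].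
    apply le_IZR. rewrite <- INR_IZR_INZ.
    apply Rle_trans with ro; [|lra].
    apply Rle_trans with (C0 * Rpower (INR (3 * bn)) (3 - eps))%R; [exact HT|].
    replace (INR (3 * bn)) with (3 * Bb)%R.
    + unfold ro. apply Rmult_le_compat_r; [left; apply exp_pos|apply Rle_abs].
    + rewrite INR_IZR_INZ. unfold Bb, b. rewrite <- mult_IZR. f_equal. lia.
  - exists T, M'. split; [exact Hex|]. split; [|exact Hans].
    assert (Hx : (1 <= INR nn)%R) by (rewrite INR_IZR_INZ; apply IZR_le; lia).
    assert (HxB : (INR nn <= Bb ^ 49)%R)
      by (rewrite INR_IZR_INZ; unfold Bb; rewrite <- IZR_bp; apply IZR_le; auto).
    assert (HBx : (Bb ^ 49 <= IZR (bp 2 49) * INR nn)%R).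
    { rewrite INR_IZR_INZ, <- mult_IZR. unfold Bb. rewrite <- IZR_bp. apply IZR_le.
      rewrite Hba. apply scale_upper; auto; lia. }
    apply (time_real (INR nn) Bb eps (IZR (bp 2 49)) C0 (IZR Tm)); auto.
    + unfold ro in HT2. lra.
    + apply IZR_le in HT. rewrite <- INR_IZR_INZ in HT.
      rewrite !plus_IZR, !mult_IZR, !IZR_bp in HT. exact HT.
Qed.

(** As the hypothesis fixes [eps] before [K], passing from [K] to [49 * K] leaves it unchanged, and
    the resulting exponent is again the same for all [K]. *)
Theorem theorem4p2 :
  (exists eps : R, (0 < eps)%R /\
     forall K : nat, has_subcubic_alg detect_answer K eps) ->
  (exists eps' : R, (0 < eps')%R /\
     forall K : nat, has_subcubic_alg count_answer K eps').
Proof.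
  intros (eps & Heps & Hdet). exists (Rmin eps 1 / 49)%R. split.
  - assert (0 < Rmin eps 1)%R by (apply Rmin_glb_lt; lra). lra.
  - intros K. apply count_from_detect; auto.
Qed.
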